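(* Let $d\in\mathbb{N}$, $0<s<\infty$, $0<r\le\infty$, $2<p\le\infty$, and let $u_n\in\{a_n,d_n\}$ (approximation or Kolmogorov numbers). Then for any $\varepsilon>0$ there exists some $n_0\in\mathbb{N}$ such that $$\bigg(\frac{2s}{2s+1}\bigg)^s\bigg(\frac{2^d}{(d-1)!}\bigg)^s-\varepsilon\ \le\ \frac{u_n\big(id:\mathcal{A}^{s,r}_{\mathrm{mix}}(\mathbb{T}^d)\to L_p(\mathbb{T}^d)\big)}{n^{-s}(\ln n)^{s(d-1)}}\ \le\ \bigg(\frac{2^d}{(d-1)!}\bigg)^s+\varepsilon$$ holds for all $n\ge n_0$.
   Context: $\mathbb{T}^d$ is the $d$-dimensional torus ($[0,2\pi]^d$ with endpoints identified) with the probability measure $(2\pi)^{-d}d\boldsymbol{x}$, with respect to which the $L_p(\mathbb{T}^d)$ norms are taken; $\hat f(\boldsymbol{k})=(2\pi)^{-d}\int_{\mathbb{T}^d}f(\boldsymbol{x})e^{-i\boldsymbol{k}\boldsymbol{x}}\,d\boldsymbol{x}$, $\boldsymbol{k}\in\mathbb{Z}^d$. For a weight $\omega=(\omega(\boldsymbol{k}))_{\boldsymbol{k}\in\mathbb{Z}^d}$ of positive numbers, $\mathcal{A}_\omega(\mathbb{T}^d)$ is the space of all $f\in L_1(\mathbb{T}^d)$ with $\|f|\mathcal{A}_\omega(\mathbb{T}^d)\|:=\sum_{\boldsymbol{k}\in\mathbb{Z}^d}\omega(\boldsymbol{k})|\hat f(\boldsymbol{k})|<\infty$. $\mathcal{A}^{s,r}_{\mathrm{mix}}(\mathbb{T}^d):=\mathcal{A}_{\omega_{s,r}}(\mathbb{T}^d)$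 with $\omega_{s,r}(\boldsymbol{k})=\prod_{i=1}^d(1+|k_i|^r)^{s/r}$ if $0<r<\infty$, and $\omega_{s,\infty}(\boldsymbol{k})=\prod_{i=1}^d\max(1,|k_i|)^s$. $id$ denotes the identity (embedding) operator. For a continuous linear operator $T:X\to Y$ between Banach spaces and $n\in\mathbb{N}$: approximation numbers $a_n(T)=\inf\{\|T-A\|: A\in\mathcal{L}(X,Y),\ \mathrm{rank}(A)<n\}$; Kolmogorov numbers $d_n(T)=\inf_{L_{n-1}}\sup_{\|x|X\|\le1}\inf_{y\in L_{n-1}}\|Tx-y|Y\|$, infimum over all $(n-1)$-dimensional subspaces $L_{n-1}$ of $Y$. *)

(* Defs.v *)
From HB Require Import structures.
From mathcomp Require Import all_boot all_order all_algebra ring_quotient.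
From mathcomp Require Import all_classical all_reals all_analysis.
From mathcomp Require Import measurable_realfun ess_sup_inf.
From mathcomp Require Import complex.

Set Implicit Arguments.
Unset Strict Implicit.
Unset Printing Implicit Defensive.

Import Order.TTheory GRing.Theory Num.Theory.
Import numFieldNormedType.Exports.
Import ComplexField Normc.

Local Open Scope classical_set_scope.
Local Open Scope ring_scope.

Section ComplexLebesgue.
Context {d : measure_display} {T : measurableType d} {R : realType}.
Implicit Types (mu : {measure set T -> \bar R}) (p : \bar R) (f g : T -> R[i]).

(* R[i] carries no measurable structure in the library: measurability and
   integration of complex functions are taken componentwise. *)
Definition cmeasurable f :=
  measurable_fun setT (fun x => complex.Re (f x)) /\
  measurable_fun setT (fun x => complex.Im (f x)).

Definition cLnorm mu p f : \bar R := 'N[mu]_p[EFin \o (fun x => normc (f x))]%E.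

Definition cLfun mu p (p1 : (1 <= p)%E) : {pred T -> R[i]} :=
  mem [set f | cmeasurable f /\ (cLnorm mu p f < +oo)%E].

Definition cintegral mu f : R[i] :=
  Complex (\int[mu]_x complex.Re (f x)) (\int[mu]_x complex.Im (f x)).

End ComplexLebesgue.

Section ComplexLebesgueTheory.
Context {d : measure_display} {T : measurableType d} {R : realType}.
Variable mu : {measure set T -> \bar R}.
Implicit Types (p : \bar R) (f g : T -> R[i]).

Lemma normc_sqrt (z : R[i]) :
  normc z = Num.sqrt (complex.Re z ^+ 2 + complex.Im z ^+ 2).
Proof. by case: z. Qed.

Lemma measurable_normc f : cmeasurable f ->
  measurable_fun setT (fun x => normc (f x)).
Proof.
move=> [mr mi]; under eq_fun do rewrite normc_sqrt.
rewrite (_ : (fun x => _) = Num.sqrt \o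
  (fun x => complex.Re (f x) ^+ 2 + complex.Im (f x) ^+ 2))//.
apply: measurableT_comp => //.
  by apply: continuous_measurable_fun; exact: sqrt_continuous.
by apply: measurable_funD; apply: measurable_funX.
Qed.

Lemma cReD (x y : R[i]) : complex.Re (x + y) = complex.Re x + complex.Re y.
Proof. by case: x; case: y. Qed.
Lemma cImD (x y : R[i]) : complex.Im (x + y) = complex.Im x + complex.Im y.
Proof. by case: x; case: y. Qed.
Lemma cReM (x y : R[i]) : complex.Re (x * y) =
  complex.Re x * complex.Re y - complex.Im x * complex.Im y.
Proof. by case: x; case: y. Qed.
Lemma cImM (x y : R[i]) : complex.Im (x * y) =
  complex.Re x * complex.Im y + complex.Im x * complex.Re y.
Proof. by case: x; case: y. Qed.

Lemma cmeasurableD f g : cmeasurable f -> cmeasurable g -> cmeasurable (f + g).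
Proof.
move=> [fr fi] [gr gi]; split.
  by under eq_fun do rewrite fctE cReD; exact: measurable_funD.
by under eq_fun do rewrite fctE cImD; exact: measurable_funD.
Qed.

Lemma cmeasurableM f g : cmeasurable f -> cmeasurable g -> cmeasurable (f \* g).
Proof.
move=> [fr fi] [gr gi]; split.
  by under eq_fun do rewrite /= cReM; apply: measurable_funB; exact: measurable_funM.
by under eq_fun do rewrite /= cImM; apply: measurable_funD; exact: measurable_funM.
Qed.

Lemma cmeasurable_cst (c : R[i]) : cmeasurable (cst c : T -> R[i]).
Proof. by split; exact: measurable_cst. Qed.

Lemma le_Lnorm p (f g : T -> R) : (1 <= p)%E ->
  measurable_fun setT f -> measurable_fun setT g ->
  (forall x, 0 <= f x <= g x) ->
  ('N[mu]_p[EFin \o f] <= 'N[mu]_p[EFin \o g])%E.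
Proof.
move=> p1 mf mg fg.
have abs_fg x : (`|f x| <= `|g x|)%R.
  have /andP[f0 fgx] := fg x.
  by rewrite !ger0_norm// (le_trans f0).
rewrite unlock /Lnorm; case: p p1 => [r r1|_|//].
- have r0 : (0 <= r)%R by rewrite (le_trans ler01) // -lee_fin.
  have mpow (h : T -> R) : measurable_fun setT h ->
      measurable_fun setT (fun x : T => (`|(EFin \o h) x| `^ r)%E).
    move=> mh; apply: (@measurableT_comp _ _ _ _ _ _ (fun x => x `^ r)%E) => //.
      exact: measurable_poweR.
    by apply: measurableT_comp => //; exact: measurableT_comp.
  apply: gt0_ler_poweR.
  + by rewrite invr_ge0.
  + by rewrite in_itv/= leey andbT; apply: integral_ge0 => x _; rewrite lee_fin powR_ge0.
  + by rewrite in_itv/= leey andbT; apply: integral_ge0 => x _; rewrite lee_fin powR_ge0.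
  + apply: ge0_le_integral => //.
    * by move=> x _; rewrite /= lee_fin powR_ge0.
    * exact: mpow.
    * exact: mpow.
    * move=> x _; rewrite /= lee_fin; apply: ge0_ler_powR; rewrite ?nnegrE//.
- case: ifPn => // _; apply: le_ess_sup; apply/nearW => x /=.
  by rewrite lee_fin.
Qed.

Lemma cLnormD p f g : (1 <= p)%E -> cmeasurable f -> cmeasurable g ->
  (cLnorm mu p (f + g)%R <= cLnorm mu p f + cLnorm mu p g)%E.
Proof.
move=> p1 mf mg.
apply: (@le_trans _ _
  'N[mu]_p[EFin \o ((fun x => normc (f x)) \+ (fun x => normc (g x)))%R]%E); last first.
  by apply: eminkowski => //; exact: measurable_normc.
apply: (@le_Lnorm p (fun x => normc ((f + g) x))) => //.
- by apply: measurable_normc; exact: cmeasurableD.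
- by apply: measurable_funD; exact: measurable_normc.
- by move=> x; rewrite {1}normc_sqrt sqrtr_ge0 /= fctE; exact: le_normcD.
Qed.

Lemma cmeasurableZ (c : R[i]) f : cmeasurable f -> cmeasurable (c *: f).
Proof.
by move=> mf; apply: (@cmeasurableM (cst c) f) => //; exact: cmeasurable_cst.
Qed.

Lemma normc_ge0 (z : R[i]) : 0 <= normc z.
Proof. by rewrite normc_sqrt sqrtr_ge0. Qed.

Lemma cLnorm_fin p (p1 : (1 <= p)%E) f : f \in cLfun mu p1 ->
  (fun x => normc (f x)) \in Lfun mu p.
Proof.
rewrite inE => -[mf lf]; rewrite inE; apply/andP; split; rewrite inE//=.
exact: measurable_normc.
Qed.

Lemma cLfun_submod_closed p (p1 : (1 <= p)%E) : submod_closed (cLfun mu p1).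
Proof.
have N0 : (fun x : T => normc ((0 : T -> R[i]) x)) = cst 0.
  by apply/funext => x /=; exact: normc0.
split.
  rewrite inE; split; first exact: cmeasurable_cst.
  by rewrite /cLnorm N0 Lnorm0// gt_eqF// (lt_le_trans _ p1).
move=> c f g fL gL; have := fL; rewrite inE => -[mf _].
have := gL; rewrite inE => -[mg lg].
have mcf := cmeasurableZ c mf.
rewrite inE; split; first exact: cmeasurableD.
apply: le_lt_trans (cLnormD p1 mcf mg) _; rewrite lte_add_pinfty//.
have [N1 N2] := Lfun_submod_closed mu p1.
have := N2 (normc c) _ _ (cLnorm_fin fL) N1; rewrite addr0 inE => /andP[_].
rewrite inE /= /finite_norm; congr (_ < _)%E; congr Lnorm; apply/funext => x /=.
by rewrite fctE normcM.
Qed.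

End ComplexLebesgueTheory.

Section LpSpace.
Context {d : measure_display} {T : measurableType d} {R : realType}.
Variables (mu : {measure set T -> \bar R}) (p : \bar R) (p1 : (1 <= p)%E).

HB.instance Definition _ := GRing.isSubmodClosed.Build R[i] (T -> R[i])
  (cLfun mu p1) (cLfun_submod_closed mu p1).

(* The library's Lfun/LfunType only cover real-valued functions. *)
Record cLfunType := CLfun {
  cLfun_fun :> T -> R[i];
  cLfunP : cLfun_fun \in cLfun mu p1 }.

HB.instance Definition _ := [isSub for cLfun_fun].
HB.instance Definition _ := [Choice of cLfunType by <:].
HB.instance Definition _ := [SubChoice_isSubLmodule of cLfunType by <:].

Definition cLnull : {pred cLfunType} :=
  mem [set f : cLfunType | (f : T -> R[i]) = cst 0 %[ae mu]].

Lemma cLnull_submod_closed : submod_closed cLnull.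
Proof.
split; first by rewrite inE; exact: ae_eq_refl.
move=> c f g; rewrite !inE => f0 g0.
move: f0 g0; apply: filterS2 => x /= f0 g0 _.
by rewrite /= [LHS](_ : _ = c * f x + g x)// f0// g0// mulr0 addr0.
Qed.

HB.instance Definition _ := GRing.isSubmodClosed.Build R[i] cLfunType
  cLnull cLnull_submod_closed.

(* L_p(mu; C): classes of p-integrable functions modulo equality mu-a.e. *)
Definition Lp : Type := Quotient.quot cLnull.

HB.instance Definition _ := GRing.Zmodule.on Lp.
HB.instance Definition _ := EqQuotient.on Lp.

Local Open Scope quotient_scope.

Definition Lp_fun (x : Lp) : T -> R[i] := repr x : cLfunType.

Definition Lp_scale (c : R[i]) (x : Lp) : Lp := \pi_Lp (c *: repr x).

Lemma Lp_eqP (f g : cLfunType) :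
  \pi_Lp f = \pi_Lp g <-> (f : T -> R[i]) = g %[ae mu].
Proof.
have -> : \pi_Lp f = \pi_Lp g <-> f - g \in cLnull.
  by rewrite Quotient.idealrBE; split=> [->//|/eqP].
rewrite inE; split; apply: filterS => x /= fg xT; last first.
  by rewrite [LHS](_ : _ = f x - g x)// fg// subrr.
by apply/eqP; rewrite -subr_eq0; apply/eqP; exact: fg.
Qed.

Lemma Lp_piK (f : cLfunType) : Lp_fun (\pi_Lp f) = f %[ae mu].
Proof. by apply/Lp_eqP; rewrite reprK. Qed.

Lemma pi_scale (c : R[i]) (f : cLfunType) :
  Lp_scale c (\pi_Lp f) = \pi_Lp (c *: f).
Proof.
apply/Lp_eqP; move: (Lp_piK f); apply: filterS => x /= h xT.
by rewrite [LHS](_ : _ = c * Lp_fun (\pi_Lp f) x)// h.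
Qed.

Lemma Lp_scaleA a b x : Lp_scale a (Lp_scale b x) = Lp_scale (a * b) x.
Proof.
by elim/quotW: x => x; rewrite (pi_scale b) (pi_scale a) pi_scale scalerA.
Qed.

Lemma Lp_scale1 : left_id 1 Lp_scale.
Proof. by elim/quotW => x; rewrite pi_scale scale1r. Qed.

Lemma Lp_scaleDr : right_distributive Lp_scale +%R.
Proof.
move=> a; elim/quotW => x; elim/quotW => y.
have pi_add := @Quotient.pi_add cLfunType cLnull.
by rewrite (pi_scale a x) (pi_scale a y) -[LHS]/(Lp_scale a (Quotient.add _ _))
  -pi_add pi_scale scalerDr pi_add.
Qed.

Lemma Lp_scaleDl x : {morph Lp_scale^~ x : a b / a + b}.
Proof.
move=> a b; elim/quotW: x => x.
have pi_add := @Quotient.pi_add cLfunType cLnull.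
by rewrite (pi_scale a x) (pi_scale b x) pi_scale scalerDl pi_add.
Qed.

HB.instance Definition _ := GRing.Zmodule_isLmodule.Build R[i] Lp
  Lp_scaleA Lp_scale1 Lp_scaleDr Lp_scaleDl.

Lemma Lp_funD (x y : Lp) : Lp_fun (x + y) = (repr x + repr y : cLfunType) %[ae mu].
Proof.
have xy : x + y = \pi_Lp (repr x + repr y).
  by rewrite (@Quotient.pi_add cLfunType cLnull) !reprK.
by have := Lp_piK (repr x + repr y); rewrite -xy.
Qed.

Lemma Lp_funZ (c : R[i]) (x : Lp) :
  Lp_fun (c *: x) = (c *: repr x : cLfunType) %[ae mu].
Proof. exact: Lp_piK. Qed.

Definition Lp_norm (x : Lp) : R := fine (cLnorm mu p (Lp_fun x)).

End LpSpace.
Arguments Lp_norm {d T R mu p p1} x.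

Section Torus.
Context {R : realType}.

Lemma lt0_2pi : (0 : R) < 2 * pi.
Proof. by rewrite mulr_gt0// pi_gt0. Qed.

Definition circle : probability (measurableTypeR R) R := uniform_prob lt0_2pi.

Definition tcons n (x : measurableTypeR R * n.-tuple (measurableTypeR R)) :
  n.+1.-tuple (measurableTypeR R) := [tuple of x.1 :: x.2].

Lemma measurable_tcons n : measurable_fun setT (@tcons n).
Proof. by apply: measurable_cons; [exact: measurable_fst | exact: measurable_snd]. Qed.

HB.instance Definition _ n := isMeasurableFun.Build _ _ _ _ (@tcons n) (@measurable_tcons n).

(* The torus T^d is modelled by d.-tuple R with the d-fold product of the uniform
   probability on [0, 2 pi], i.e. (2 pi)^-d dx carried by [0, 2 pi]^d; identifying
   endpoints is immaterial since only classes modulo null sets are considered. *)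
Fixpoint torus (n : nat) : probability (n.-tuple (measurableTypeR R)) R :=
  if n is m.+1 then distribution (circle \x torus m)%E (@tcons m)
  else dirac [tuple].

Definition expi (t : R) : R[i] := Complex (cos t) (sin t).

Definition phase d (k : d.-tuple int) (x : d.-tuple (measurableTypeR R)) : R :=
  \sum_(i < d) (tnth k i)%:~R * (tnth x i : R).

Definition fourier d (f : d.-tuple (measurableTypeR R) -> R[i])
    (k : d.-tuple int) : R[i] :=
  cintegral (torus d) (fun x => f x * expi (- phase k x)).

End Torus.

Section CintegralTheory.
Context {d : measure_display} {T : measurableType d} {R : realType}.
Variable mu : {measure set T -> \bar R}.
Implicit Types f g : T -> R[i].

Lemma Re_le_normc (z : R[i]) : `|complex.Re z| <= normc z.
Proof. by rewrite normc_sqrt -sqrtr_sqr ler_wsqrtr// lerDl sqr_ge0. Qed.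

Lemma Im_le_normc (z : R[i]) : `|complex.Im z| <= normc z.
Proof. by rewrite normc_sqrt -sqrtr_sqr ler_wsqrtr// lerDr sqr_ge0. Qed.

Definition cintegrable f := mu.-integrable setT (EFin \o (@complex.Re R \o f)) /\
  mu.-integrable setT (EFin \o (@complex.Im R \o f)).

Lemma cLfun1_integrable f : f \in cLfun mu (lexx 1%E) -> cintegrable f.
Proof.
move=> fL; have := fL; rewrite inE => -[[mr mi] _].
have /Lfun1_integrable iN := cLnorm_fin fL.
split; apply: le_integrable iN => //.
- exact/measurable_EFinP.
- move=> x _ /=; rewrite lee_fin [leRHS]ger0_norm ?normc_ge0//.
  exact: Re_le_normc.
- exact/measurable_EFinP.
- move=> x _ /=; rewrite lee_fin [leRHS]ger0_norm ?normc_ge0//.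
  exact: Im_le_normc.
Qed.

Lemma cintegralD f g : cintegrable f -> cintegrable g ->
  cintegral mu (f \+ g) = cintegral mu f + cintegral mu g.
Proof.
move=> [fr fi] [gr gi]; rewrite /cintegral.
under eq_Rintegral do rewrite /= cReD.
under [X in Complex _ X]eq_Rintegral do rewrite /= cImD.
by rewrite !RintegralD.
Qed.

Lemma cintegralZ (c : R[i]) f : cintegrable f ->
  cintegral mu (c \*: f) = c * cintegral mu f.
Proof.
move=> [fr fi]; rewrite /cintegral.
under eq_Rintegral do rewrite /= cReM.
under [X in Complex _ X]eq_Rintegral do rewrite /= cImM.
have Z (a : R) (h : T -> R) : mu.-integrable setT (EFin \o h) ->
    mu.-integrable setT (EFin \o (fun x => a * h x)).
  move=> ih; rewrite (_ : _ \o _ = (fun x => a%:E * (EFin \o h) x)%E)//.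
  exact: integrableZl.
rewrite RintegralB//; [|exact: Z|exact: Z].
rewrite RintegralD//; [|exact: Z|exact: Z].
by rewrite !RintegralZl//; case: c.
Qed.

Lemma ae_eq_cintegral f g : cmeasurable f -> cmeasurable g ->
  f = g %[ae mu] -> cintegral mu f = cintegral mu g.
Proof.
move=> [fr fi] [gr gi] fg; congr Complex; congr fine; apply: ae_eq_integral => //.
- exact/measurable_EFinP.
- exact/measurable_EFinP.
- by move: fg; apply: filterS => x /= h xT; rewrite h.
- exact/measurable_EFinP.
- exact/measurable_EFinP.
- by move: fg; apply: filterS => x /= h xT; rewrite h.
Qed.

Lemma cLfun_mul_unimodular p (p1 : (1 <= p)%E) f g : cmeasurable g ->
  (forall x, normc (g x) = 1) -> f \in cLfun mu p1 ->
  (fun x => f x * g x) \in cLfun mu p1.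
Proof.
move=> mg g1; rewrite !inE => -[mf lf]; split; first exact: cmeasurableM.
move: lf; rewrite /cLnorm; congr (_ < _)%E; congr Lnorm; apply/funext => x /=.
by rewrite normcM g1 mulr1.
Qed.

End CintegralTheory.

Section FourierTheory.
Local Open Scope quotient_scope.
Context {R : realType} {d : nat}.
Local Notation mu := (@torus R d).
Local Notation L1 := (Lp mu (lexx 1%E)).
Implicit Types (x y : L1) (k : d.-tuple int).

Lemma normc_expi (t : R) : normc (expi t) = 1.
Proof. by rewrite /= cos2Dsin2 sqrtr1. Qed.

Lemma measurable_phase k : measurable_fun setT (@phase R d k).
Proof.
apply: measurable_sum => i; apply: measurable_funM => //.
exact: measurable_tnth.
Qed.

Lemma cmeasurable_char k :
  cmeasurable (fun x : d.-tuple (measurableTypeR R) => expi (- phase k x)).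
Proof.
have mN : measurable_fun setT (fun z => - @phase R d k z).
  by apply: measurableT_comp => //; exact: measurable_phase.
split => /=.
  apply: (@measurableT_comp _ _ _ _ _ _ (@cos R)) => //.
  by apply: continuous_measurable_fun; exact: continuous_cos.
apply: (@measurableT_comp _ _ _ _ _ _ (@sin R)) => //.
by apply: continuous_measurable_fun; exact: continuous_sin.
Qed.

Lemma fourier_integrable (f : cLfunType mu (lexx 1%E)) k :
  cintegrable mu (fun z => f z * expi (- phase k z)).
Proof.
apply: cLfun1_integrable; apply: cLfun_mul_unimodular.
- exact: cmeasurable_char.
- by move=> x; exact: normc_expi.
- exact: cLfunP.
Qed.

Lemma cmeasurable_cLfun p (p1 : (1 <= p)%E) (f : cLfunType mu p1) : cmeasurable f.
Proof. by have := cLfunP f; rewrite inE => -[]. Qed.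

Lemma ae_eq_fourier (f g : cLfunType mu (lexx 1%E)) k :
  (f : _ -> _) = g %[ae mu] -> fourier f k = fourier g k.
Proof.
move=> fg; apply: ae_eq_cintegral.
- apply: cmeasurableM; [exact: cmeasurable_cLfun | exact: cmeasurable_char].
- apply: cmeasurableM; [exact: cmeasurable_cLfun | exact: cmeasurable_char].
- by move: fg; apply: filterS => x /= h xT; rewrite h.
Qed.

Lemma fourierD x y k :
  fourier (Lp_fun (x + y)) k = fourier (Lp_fun x) k + fourier (Lp_fun y) k.
Proof.
rewrite (ae_eq_fourier _ (Lp_funD x y)) -cintegralD; last 2 first.
- exact: fourier_integrable.
- exact: fourier_integrable.
by congr cintegral; apply/funext => z /=; rewrite -mulrDl.
Qed.

Lemma fourierZ (c : R[i]) x k :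
  fourier (Lp_fun (c *: x)) k = c * fourier (Lp_fun x) k.
Proof.
rewrite (ae_eq_fourier _ (Lp_funZ c x)) -cintegralZ; last exact: fourier_integrable.
by congr cintegral; apply/funext => z /=; rewrite -mulrA.
Qed.

End FourierTheory.

Section WeightedWiener.
Context {R : realType} {d : nat} (w : d.-tuple int -> {posnum R}).
Local Notation mu := (@torus R d).
Local Notation L1 := (Lp mu (lexx 1%E)).

(* w(k) |f^(k)| summed over Z^d, possibly +oo *)
Definition wiener_sum (f : L1) : \bar R :=
  \esum_(k in [set: d.-tuple int]) ((w k)%:num * normc (fourier (Lp_fun f) k))%:E.

Definition wiener_pred : {pred L1} := mem [set f | (wiener_sum f < +oo)%E].

Lemma wiener_submod_closed : submod_closed wiener_pred.
Proof.
have pos f k : (0 <= ((w k)%:num * normc (fourier (Lp_fun (f : L1)) k))%:E)%E.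
  by rewrite lee_fin mulr_ge0// normc_ge0.
have le_fin (f : L1) (h : d.-tuple int -> \bar R) :
    (forall k, ((w k)%:num * normc (fourier (Lp_fun f) k))%:E <= h k)%E ->
    (\esum_(k in setT) h k < +oo)%E -> f \in wiener_pred.
  move=> fh hoo; rewrite inE; apply: le_lt_trans hoo.
  by apply: le_esum => k _; exact: fh.
split.
  apply: (@le_fin 0 (cst 0)) => [k|]; last by rewrite esum1.
  by rewrite -(scale0r 0) fourierZ mul0r normc0 mulr0.
move=> c f g fw gw.
have lf : (wiener_sum f < +oo)%E by move: fw; rewrite inE.
have lg : (wiener_sum g < +oo)%E by move: gw; rewrite inE.
pose n := (Num.trunc (normc c)).+1.
have cn : normc c <= n%:R by rewrite ltW// truncnS_gt.
apply: (@le_fin _ (fun k => (\sum_(i < n)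
    ((w k)%:num * normc (fourier (Lp_fun f) k))%:E)
    + ((w k)%:num * normc (fourier (Lp_fun g) k))%:E)%E).
  move=> k; rewrite fourierD fourierZ sumEFin -EFinD lee_fin sumr_const card_ord.
  rewrite -mulr_natl mulrCA -mulrDr ler_pM2l//.
  apply: le_trans (le_normcD _ _) _; rewrite lerD2r normcM.
  by rewrite ler_wpM2r ?normc_ge0.
rewrite esumD//; last by move=> k _; apply: sume_ge0.
apply: lte_add_pinfty => //; rewrite esum_sum//.
by apply: lte_sum_pinfty.
Qed.

HB.instance Definition _ := GRing.isSubmodClosed.Build R[i] L1
  wiener_pred wiener_submod_closed.

(* A_w = { f in L_1(T^d) : wiener_sum w f < +oo } *)
Record wiener := Wiener { wiener_val :> L1; wienerP : wiener_val \in wiener_pred }.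

HB.instance Definition _ := [isSub for wiener_val].
HB.instance Definition _ := [Choice of wiener by <:].
HB.instance Definition _ := [SubChoice_isSubLmodule of wiener by <:].

Definition wiener_norm (f : wiener) : R := fine (wiener_sum f).

End WeightedWiener.
Arguments wiener_norm {R d w} f.

Section MixedWeight.
Context {R : realType}.

(* only used for 0 < r <= +oo; r = -oo gets a dummy value *)
Definition mix_weight (s : R) (r : \bar R) d (k : d.-tuple int) : R :=
  if r is r'%:E
  then \prod_(i < d) (1 + `|(tnth k i)%:~R| `^ r') `^ (s / r')
  else \prod_(i < d) Num.max 1 `|(tnth k i)%:~R| `^ s.

Lemma mix_weight_gt0 s r d (k : d.-tuple int) : 0 < mix_weight s r k.
Proof.
rewrite /mix_weight; case: r => [r||].
- by apply: prodr_gt0 => i _; rewrite powR_gt0// ltr_wpDr// powR_ge0.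
- by apply: prodr_gt0 => i _; rewrite powR_gt0// lt_max ltr01.
- by apply: prodr_gt0 => i _; rewrite powR_gt0// lt_max ltr01.
Qed.

Definition Amix (d : nat) (s : R) (r : \bar R) :=
  wiener (fun k : d.-tuple int => PosNum (mix_weight_gt0 s r k)).

End MixedWeight.

(* s-numbers of operators between normed spaces (X, normX) and (Y, normY), with
   values in \bar R. The norms are explicit functions, so that no proof that a
   Fourier-defined norm is definite is needed to form them. *)
Section SNumbers.
Context {R : realType} {X Y : lmodType R[i]}.
Variables (normX : X -> R) (normY : Y -> R).

Definition bounded_op (T : X -> Y) :=
  exists M : R, forall x, normY (T x) <= M * normX x.

Definition unit_ball : set X := [set x | normX x <= 1].

Definition op_norm (T : X -> Y) : \bar R :=
  ereal_sup [set (normY (T x))%:E | x in unit_ball].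

(* L is an m-dimensional linear subspace of Y *)
Definition has_dim (m : nat) (L : set Y) :=
  exists e : 'I_m -> Y,
    (forall c : 'I_m -> R[i], \sum_(i < m) c i *: e i = 0 -> forall i, c i = 0) /\
    L = range (fun c : 'I_m -> R[i] => \sum_(i < m) c i *: e i).

Definition rank_lt (n : nat) (A : X -> Y) :=
  exists2 m, (m < n)%N & has_dim m (range A).

Definition approx_number (T : X -> Y) (n : nat) : \bar R :=
  ereal_inf [set op_norm (fun x => T x - A x) |
    A in [set A : {linear X -> Y} | bounded_op A /\ rank_lt n A]].

Definition kolmogorov_number (T : X -> Y) (n : nat) : \bar R :=
  ereal_inf [set ereal_sup [set ereal_inf [set (normY (T x - y))%:E | y in L]
    | x in unit_ball] | L in has_dim n.-1].

End SNumbers.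

Lemma gt2_ge1 {R : realType} (p : \bar R) : (2%:E < p)%E -> (1 <= p)%E.
Proof. by move=> /ltW; apply: le_trans; rewrite lee_fin ler1n. Qed.

(* id maps the class of f in A_w to the class of the same function in L_p, and is
   bounded; the first property determines id uniquely. *)
Definition is_embedding {R : realType} {d : nat} {w : d.-tuple int -> {posnum R}}
    {p : \bar R} {p1 : (1 <= p)%E} (id : wiener w -> Lp (torus d) p1) :=
  (forall f : wiener w, Lp_fun (id f) = Lp_fun f %[ae torus d]) /\
  bounded_op wiener_norm Lp_norm id.

(* Main.v *)
Require Import Defs.
From HB Require Import structures.
From mathcomp Require Import all_boot all_order all_algebra.
From mathcomp Require Import all_classical all_reals all_analysis.
From mathcomp Require Import measurable_realfun ess_sup_inf complex.
From mathcomp Require Import sesquilinear spectral.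
From mathcomp Require Import ring lra.

(** Write [v(k)] for the product over the coordinates of the one-dimensional weight
    with the exponent [s] removed, so that the weight is [v^s]; let [N(T)] be the
    number of frequencies with [v <= T] and [C = 2^d / (d-1)!].

    Upper bound. A function with absolutely summable Fourier coefficients is almost
    everywhere bounded by the sum of their moduli ([ae_le_sum_fourier]); this rests on
    the uniqueness of Fourier coefficients of integrable functions
    ([torus_uniqueness]). Hence the embedding exists, and on the unit ball the partial
    sum over the hyperbolic cross [v <= T] is within [T^-s] of [f]
    ([partial_sum_err]). Its rank is [N(T)], so both s-numbers are at most [T^-s] as
    soon as [N(T) < n].

    Lower bound. Since [p > 2], an L_p error of at most [e] is an L_2 error of at most
    [e] ([integral_normc2_le]), and by Bessel's inequality the Fourier coefficients of
    the error have l_2 norm at most [e] ([bessel]). Let an [m]-dimensional subspace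
    approximate within [e] every normalized character [v(k)^-s e^(ikx)], for [k] in a
    finite set [S]. The coefficients at [S] of the errors, multiplied by [v(k)^s], form
    a matrix [1 - Y] with [Y] of rank at most [m], whose row of index [k] has l_2 norm
    at most [e v(k)^s]. The squared Frobenius norm of [1 - Y] is at least [|S| - m]
    ([frobenius_rank_ge]), whence [|S| - m <= e^2 sum_(k in S) v(k)^(2s)]
    ([lower_of_subspace]).

    Counting. Induction on the dimension, comparing sums over the first coordinate with
    telescoping sums of powers of logarithms, gives [N(T) ~ C T (ln T)^(d-1)]
    ([ncross_upper], [ncross_lower]); in terms of [n] this says that the cross of radius
    [T = a n / (ln n)^(d-1)] has about [a C n] points ([ncross_cvg]), while
    [T^-s = a^-s n^-s (ln n)^(s(d-1))]. Only [|k| <= v(k)] and [v(k) ~ |k|] in dimension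
    one matter, which is why [r] does not occur in the limit.

    Constants. For the upper bound [a C] may be any number below 1, so the constant is
    [C^s] ([near_rate_upper]). For the lower bound take for [S] the cross with
    [a C = lam := (2s+1)/(2s)]. Cutting it into thin layers on which [v] is almost
    constant turns [sum_(k in S) v(k)^(2s)] into a Riemann sum of
    [lam n T^(2s) int_0^1 x^(2s) dx = lam n T^(2s) / (2s+1)], and [|S| - n] is about
    [(lam - 1) n]. Since [lam - 1 = lam / (2s+1)], this forces [e >= T^-s] up to a factor
    tending to 1, with constant [a^-s = (C / lam)^s] ([near_rate_lower]). This value of
    [lam] maximizes the resulting bound [(2s+1) C^(2s) (lam-1) / lam^(2s+1)] for the
    square of the constant. *)

Set Implicit Arguments.
Unset Strict Implicit.
Unset Printing Implicit Defensive.

Import Order.TTheory GRing.Theory Num.Theory.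
Import numFieldNormedType.Exports.
Import ComplexField Normc.

Local Open Scope classical_set_scope.
Local Open Scope ring_scope.

(** * Sums of powers of logarithms *)

Section Telescoping.
Context {R : realType}.
Implicit Types (a b x X : R) (j n : nat).

(** The two mean value inequalities for powers. With [b - a] a difference of logarithms
    of consecutive integers they compare a sum of terms [ln (x / i) ^ j / i] with a
    telescoping sum. *)
Lemma subX_le a b j : 0 <= a -> a <= b ->
  b ^+ j.+1 - a ^+ j.+1 <= j.+1%:R * (b - a) * b ^+ j.
Proof.
move=> a0 ab; have b0 : 0 <= b := le_trans a0 ab.
elim: j => [|j IH]; first by rewrite !expr1 expr0 mul1r mulr1.
rewrite exprS [a ^+ _]exprS.
have -> : b * b ^+ j.+1 - a * a ^+ j.+1 =
  b * (b ^+ j.+1 - a ^+ j.+1) + (b - a) * a ^+ j.+1 by ring.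
have h1 : b * (b ^+ j.+1 - a ^+ j.+1) <= b * (j.+1%:R * (b - a) * b ^+ j).
  by rewrite ler_wpM2l.
have h2 : (b - a) * a ^+ j.+1 <= (b - a) * b ^+ j.+1.
  by rewrite ler_wpM2l ?subr_ge0// lerXn2r// nnegrE.
apply: le_trans (lerD h1 h2) _.
by rewrite [in leRHS]mulrSr !exprS le_eqVlt; apply/orP; left; apply/eqP; ring.
Qed.

Lemma subX_ge a b j : 0 <= a -> a <= b ->
  j.+1%:R * (b - a) * a ^+ j <= b ^+ j.+1 - a ^+ j.+1.
Proof.
move=> a0 ab; have b0 : 0 <= b := le_trans a0 ab.
elim: j => [|j IH]; first by rewrite !expr1 expr0 mul1r mulr1.
rewrite [b ^+ _]exprS [a ^+ j.+2]exprS.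
have -> : b * b ^+ j.+1 - a * a ^+ j.+1 =
  a * (b ^+ j.+1 - a ^+ j.+1) + (b - a) * b ^+ j.+1 by ring.
have h1 : a * (j.+1%:R * (b - a) * a ^+ j) <= a * (b ^+ j.+1 - a ^+ j.+1).
  by rewrite ler_wpM2l.
have h2 : (b - a) * a ^+ j.+1 <= (b - a) * b ^+ j.+1.
  by rewrite ler_wpM2l ?subr_ge0// lerXn2r// nnegrE.
apply: le_trans (lerD h1 h2).
by rewrite mulrSr !exprS le_eqVlt; apply/orP; left; apply/eqP; ring.
Qed.

Lemma lnS_le n : ln n.+2%:R - ln n.+1%:R <= (n.+1%:R : R)^-1.
Proof.
rewrite -ln_div ?posrE ?ltr0n//.
have -> : n.+2%:R / n.+1%:R = 1 + n.+1%:R^-1 :> R.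
  by rewrite -[n.+2]addn1 natrD mulrDl divff ?pnatr_eq0// mul1r.
by rewrite le_ln1Dx// (lt_trans (ltrN10 R))// invr_gt0.
Qed.

Lemma lnS_ge n : (n.+2%:R : R)^-1 <= ln n.+2%:R - ln n.+1%:R.
Proof.
rewrite -lerN2 opprB -ln_div ?posrE ?ltr0n//.
have -> : n.+1%:R / n.+2%:R = 1 + - n.+2%:R^-1 :> R.
  have y0 : 0 < n.+1%:R :> R by rewrite ltr0n.
  rewrite -[n.+2]addn1 natrD; move: y0; move: (n.+1%:R) => y y0.
  by field; rewrite gt_eqF// addr_gt0.
by rewrite le_ln1Dx// ltrN2 invf_lt1// ltr1n.
Qed.

Lemma sum_inv_ln_le x b j n : 0 <= b -> n.+1%:R <= x ->
  \sum_(2 <= i < n.+2) i%:R^-1 * (ln (x / i%:R) + b) ^+ j <=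
  ((ln x + b) ^+ j.+1 - (ln (x / n.+1%:R) + b) ^+ j.+1) / j.+1%:R.
Proof.
move=> b0; elim: n => [|n IH] nx.
  by rewrite big_geq// divr1 subrr mul0r.
have n1x : n.+1%:R <= x by apply: le_trans nx; rewrite ler_nat.
have x0 : 0 < x by apply: lt_le_trans nx.
rewrite big_nat_recr//=.
set B := ln (x / n.+1%:R) + b; set A := ln (x / n.+2%:R) + b.
have A0 : 0 <= A by rewrite addr_ge0// ln_ge0// ler_pdivlMr// mul1r.
have BA : B - A = ln n.+2%:R - ln n.+1%:R.
  by rewrite /B /A !ln_div ?posrE ?ltr0n//; ring.
have AB : A <= B by rewrite -subr_ge0 BA (le_trans _ (lnS_ge n))// invr_ge0.
have h : n.+2%:R^-1 * A ^+ j <= (B ^+ j.+1 - A ^+ j.+1) / j.+1%:R; last first.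
  by apply: le_trans (lerD (IH n1x) h) _; rewrite -mulrDl addrA subrK.
rewrite ler_pdivlMr//; apply: le_trans (subX_ge j A0 AB).
rewrite mulrC mulrA ler_wpM2r ?exprn_ge0// ler_wpM2l// BA; exact: lnS_ge.
Qed.

Lemma sum_inv_ln_ge X j K n : (0 < K)%N -> K%:R <= X -> (K <= n)%N -> n%:R <= X ->
  (ln (X / K%:R) ^+ j.+1 - ln (X / n%:R) ^+ j.+1) / j.+1%:R <=
  \sum_(K <= i < n) i%:R^-1 * ln (X / i%:R) ^+ j.
Proof.
move=> K0 KX; elim: n => [|n IH] Kn nX.
  by move: Kn; rewrite leqn0 => /eqP E; rewrite E in K0.
move: Kn; rewrite leq_eqVlt => /orP[/eqP->|Kn].
  by rewrite big_geq// subrr mul0r.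
have n1x : n%:R <= X by apply: le_trans nX; rewrite ler_nat.
have X0 : 0 < X by apply: lt_le_trans nX.
rewrite big_nat_recr//=.
case: n IH Kn n1x nX => [|n] IH Kn n1x nX; first by have := leq_trans K0 Kn.
set B := ln (X / n.+1%:R); set A := ln (X / n.+2%:R).
have A0 : 0 <= A by rewrite ln_ge0// ler_pdivlMr// mul1r.
have BA : B - A = ln n.+2%:R - ln n.+1%:R.
  by rewrite /B /A !ln_div ?posrE ?ltr0n//; ring.
have AB : A <= B by rewrite -subr_ge0 BA (le_trans _ (lnS_ge n))// invr_ge0.
have h : (B ^+ j.+1 - A ^+ j.+1) / j.+1%:R <= n.+1%:R^-1 * B ^+ j; last first.
  by apply: le_trans (lerD (IH Kn n1x) h); rewrite -mulrDl addrA subrK.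
rewrite ler_pdivrMr//; apply: le_trans (subX_le j A0 AB) _.
rewrite -[leRHS]mulrC mulrA ler_wpM2r ?exprn_ge0 ?(le_trans A0)//.
by rewrite ler_wpM2l// BA; exact: lnS_le.
Qed.

(** Stopping at the integer part [M] of [X] loses nothing: the piece that the telescoping
    sum lacks, [ln (X / M) ^ j.+1 / j.+1], is at most the last term
    [ln (X / M) ^ j / M], because [ln (X / M) <= 1 / M]. *)
Lemma sum_inv_ln_trunc_ge X j K : (0 < K)%N -> K%:R <= X ->
  ln (X / K%:R) ^+ j.+1 / j.+1%:R <=
  \sum_(K <= i < (Num.trunc X).+1) i%:R^-1 * ln (X / i%:R) ^+ j.
Proof.
move=> K0 KX; set M := Num.trunc X.
have X0 : 0 < X by apply: lt_le_trans KX; rewrite ltr0n.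
have KM : (K <= M)%N by rewrite truncn_ge_nat// ltW.
have MX : M%:R <= X by rewrite truncn_le ltW.
have M0 : (0 < M)%N := leq_trans K0 KM.
rewrite big_nat_recr//=; apply: le_trans (lerD (sum_inv_ln_ge j K0 KX KM MX) (lexx _)).
rewrite mulrBl -addrA lerDl addrC subr_ge0 ler_pdivrMr//.
set B := ln _; have B0 : 0 <= B by rewrite ln_ge0// ler_pdivlMr ?ltr0n// mul1r.
rewrite exprS mulrAC ler_wpM2r ?exprn_ge0//.
have : B <= M%:R^-1.
  apply: le_trans (_ : ln (1 + M%:R^-1) <= _); last first.
    by rewrite le_ln1Dx// (lt_trans (ltrN10 R))// invr_gt0 ltr0n.
  rewrite ler_ln ?posrE ?divr_gt0 ?ltr0n ?addr_gt0 ?invr_gt0 ?ltr0n//.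
  rewrite -[X in X + _](@divff _ M%:R) ?pnatr_eq0 ?lt0n_neq0//.
  by rewrite -[X in _ + X]mul1r -mulrDl natr1 ler_wpM2r ?invr_ge0// ltW// truncnS_gt.
move/le_trans; apply; rewrite ler_peMr ?invr_ge0//.
by rewrite ler1n.
Qed.

End Telescoping.

(** * Counting the points of hyperbolic crosses *)

Section SymmetricRange.

(** The integers of absolute value at most [M], zero first so that the sign
    symmetry can be used in sums. *)
Definition zrange (M : nat) : seq int :=
  0 :: [seq Posz i | i <- iota 1 M] ++ [seq - Posz i | i <- iota 1 M].

Lemma mem_zrange M (k : int) : (k \in zrange M) = (`|k| <= M)%N.
Proof.
rewrite inE mem_cat; apply/idP/idP.
  case/orP => [/eqP->//|/orP[]] /mapP[j];
    by rewrite mem_iota add1n ltnS => /andP[_ iM] ->; rewrite ?abszN.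
case: k => [[|i] iM|i iM]; rewrite ?eqxx//=.
  by apply/orP; left; apply/mapP; exists i.+1 => //; rewrite mem_iota add1n ltnS.
apply/orP; right; apply/mapP; exists i.+1; last by rewrite NegzE.
by rewrite mem_iota add1n ltnS.
Qed.

Lemma zrange_uniq M : uniq (zrange M).
Proof.
rewrite /zrange cons_uniq cat_uniq mem_cat negb_or; apply/and4P; split.
- apply/andP; split; apply/negP => /mapP[j]; rewrite mem_iota => /andP[i0 _].
    by case=> i0'; rewrite -i0' in i0.
  by move/eqP; rewrite eq_sym oppr_eq0 => /eqP[i0']; rewrite i0' in i0.
- by rewrite map_inj_uniq ?iota_uniq// => x y [].
- apply/hasPn => x /mapP[j]; rewrite mem_iota => /andP[i0 _] ->.
  by apply/negP => /mapP[l _]; case: j i0.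
- by rewrite map_inj_uniq ?iota_uniq// => x y /oppr_inj [].
Qed.

Lemma big_zrange (V : nmodType) M (F : int -> V) :
  \sum_(k <- zrange M) F k = F 0 + \sum_(1 <= i < M.+1) (F i%:Z + F (- i%:Z)).
Proof.
by rewrite big_cons big_cat /= !big_map -big_split/= /index_iota subSS subn0.
Qed.

End SymmetricRange.

Section HyperbolicCross.
Context {R : realType} (v : int -> R).
Hypothesis v1 : forall k, 1 <= v k.
Hypothesis vk : forall k : int, `|k|%:R <= v k.
Implicit Types (x y : R) (d j n : nat).

(** Hyperbolic crosses, enumerated by the first coordinate so that the recursion on the
    dimension in [ncrossS] holds by computation. *)
Fixpoint cross d x : seq (d.-tuple int) :=
  if d is d'.+1 then
    [seq cons_tuple k t | k <- zrange (Num.trunc x), t <- cross d' (x / v k)]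
  else if 1 <= x then [:: [tuple]] else [::].

Let v0 k : 0 < v k. Proof. exact: lt_le_trans (v1 k). Qed.

Lemma prod_weight_ge1 d (t : d.-tuple int) : 1 <= \prod_(i < d) v (tnth t i).
Proof. by elim/big_ind: _ => // x y x1 y1; rewrite mulr_ege1. Qed.

Lemma mem_cross d x (t : d.-tuple int) :
  (t \in cross d x) = (\prod_(i < d) v (tnth t i) <= x).
Proof.
elim: d x t => [|d IH] x t.
  rewrite big_ord0 /=; case: ifP => _; rewrite ?inE ?in_nil//.
  by rewrite [t]tuple0.
case/tupleP: t => k t; rewrite big_ord_recl tnth0.
under eq_bigr do rewrite tnthS.
apply/allpairsPdep/idP => [[k' [t' [_ t'x /(congr1 val)/= [-> /val_inj->]]]]|kx].
  by move: t'x; rewrite IH ler_pdivlMr// mulrC.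
exists k, t; split=> //; last by rewrite IH ler_pdivlMr// mulrC.
have kx' : v k <= x.
  by apply: le_trans kx; rewrite ler_peMr ?prod_weight_ge1// ltW.
rewrite mem_zrange truncn_ge_nat; first exact: le_trans (vk k) kx'.
exact: le_trans (ltW (v0 k)) kx'.
Qed.

Lemma cross_uniq d x : uniq (cross d x).
Proof.
elim: d x => [|d IH] x; first by rewrite /=; case: ifP.
apply: (@allpairs_uniq_dep _ (fun=> d.-tuple int) _ (fun k t => cons_tuple k t)).
- exact: zrange_uniq.
- by move=> k _; exact: IH.
- by move=> [k t] [k' t'] _ _ /(congr1 val)/= [-> /val_inj->].
Qed.

Lemma cross0 d x : x < 1 -> cross d x = [::].
Proof.
move=> x1; apply/eqP; rewrite -size_eq0 -leqn0 leqNgt -has_predT.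
apply/hasP => -[t]; rewrite mem_cross => tx _.
by have := le_lt_trans (le_trans (prod_weight_ge1 t) tx) x1; rewrite ltxx.
Qed.

Definition ncross d x : R := (size (cross d x))%:R.

Lemma ncross_ge0 d x : 0 <= ncross d x. Proof. exact: ler0n. Qed.

Lemma le_ncross d x y : x <= y -> ncross d x <= ncross d y.
Proof.
move=> xy; rewrite ler_nat; apply: uniq_leq_size; first exact: cross_uniq.
by move=> t; rewrite !mem_cross => /le_trans; apply.
Qed.

Lemma ncrossS d x : ncross d.+1 x = ncross d (x / v 0) +
  \sum_(1 <= i < (Num.trunc x).+1) (ncross d (x / v i%:Z) + ncross d (x / v (- i%:Z))).
Proof.
rewrite /ncross [X in size X](_ : _ = [seq cons_tuple k t | k <- zrange (Num.trunc x),
  t <- cross d (x / v k)])// size_allpairs_dep sumnE big_map natr_sum.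
exact: big_zrange.
Qed.

Lemma ncross_0_le1 x : ncross 0 x <= 1.
Proof. by rewrite /ncross /=; case: ifP => _; rewrite ?ler01. Qed.

Lemma ncross_1_le x : 1 <= x -> ncross 1 x <= 2 * x + 1.
Proof.
move=> x1; have x0 : 0 <= x by apply: le_trans x1.
rewrite ncrossS addrC; apply: lerD; last exact: ncross_0_le1.
apply: le_trans (_ : \sum_(1 <= i < (Num.trunc x).+1) 2 <= _).
  by apply: ler_sum => i _; rewrite -[2](natrD _ 1 1) natrD lerD ?ncross_0_le1.
rewrite sumr_const_nat subn1/= -[leLHS]mulr_natr ler_wpM2l// truncn_le//.
Qed.

(** The first coordinates 0, 1 and -1 give three crosses of radius at most [x], as
    [v >= 1]; for the others [v k >= |k|] is used. *)
Lemma ncrossS_le d x : 1 <= x -> ncross d.+1 x <=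
  3 * ncross d x + 2 * \sum_(2 <= i < (Num.trunc x).+1) ncross d (x / i%:R).
Proof.
move=> x1; have x0 : 0 <= x by apply: le_trans x1.
have divle k : x / v k <= x by rewrite ler_pdivrMr// ler_peMr.
have T1 : (0 < Num.trunc x)%N by rewrite truncn_gt0.
rewrite ncrossS big_ltn// addrA mulr_sumr; apply: lerD.
  have -> : 3 * ncross d x = ncross d x + (ncross d x + ncross d x) by ring.
  by rewrite lerD// ?lerD// le_ncross.
apply: ler_sum_nat => i /andP[i2 _].
have i0 : 0 < i%:R :> R by rewrite ltr0n; apply: leq_trans i2.
rewrite mulr2n mulrDl mul1r.
by apply: lerD; apply: le_ncross; rewrite ler_wpM2l// lef_pV2 ?posrE//;
  have := vk i%:Z; have := vk (- i%:Z); rewrite ?abszN.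
Qed.

(** By induction, [ncrossS_le] and [sum_inv_ln_le]. The induction starts at two
    coordinates: with one the count is [2x + O(1)], and the additive constant cannot be
    hidden in the shift [b] of the logarithm, which has exponent 0. *)
Lemma ncross_upper d : exists2 b : R, 0 <= b & forall x, 1 <= x ->
  ncross d.+2 x <= 2 ^+ d.+2 * x * (ln x + b) ^+ d.+1 / (d.+1)`!%:R.
Proof.
elim: d => [|d [b b0 IH]].
  exists 3 => // x x1; have x0 : 0 < x by apply: lt_le_trans x1.
  have L0 : 0 <= ln x by rewrite ln_ge0.
  apply: le_trans (ncrossS_le _ x1) _.
  have h : \sum_(2 <= i < (Num.trunc x).+1) ncross 1 (x / i%:R) <= 2 * x * ln x + x.
    have [T T0] : exists T, Num.trunc x = T.+1.
      by exists (Num.trunc x).-1; rewrite prednK// truncn_gt0.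
    have Tx : T.+1%:R <= x by rewrite -T0 truncn_le ltW.
    have h1 := @sum_inv_ln_le R x 0 0 T (lexx 0) Tx.
    apply: le_trans (_ : \sum_(2 <= i < T.+2) (2 * x * (i%:R^-1 * (ln (x / i%:R) + 0) ^+ 0) + 1) <= _).
      rewrite T0; apply: ler_sum_nat => i /andP[i2 iT].
      have ix : i%:R <= x by apply: le_trans Tx; rewrite ler_nat.
      have i0 : 0 < i%:R :> R by rewrite ltr0n; apply: leq_trans i2.
      rewrite expr0 mulr1 -mulrA; apply: ncross_1_le.
      by rewrite ler_pdivlMr// mul1r.
    rewrite big_split/= -mulr_sumr; apply: lerD.
      rewrite ler_wpM2l ?mulr_ge0 ?(ltW x0)//; apply: le_trans h1 _.
      rewrite !expr1 divr1 !addr0 lerBlDr lerDl ln_ge0//.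
      by rewrite ler_pdivlMr// mul1r.
    rewrite sumr_const_nat subSS subn1/=; apply: le_trans Tx.
    by rewrite ler_nat.
  have h1 := ncross_1_le x1.
  rewrite expr1 divr1 [2 ^+ 2](_ : _ = 4); last by ring.
  have : 3 * ncross 1 x + 2 * \sum_(2 <= i < (Num.trunc x).+1) ncross 1 (x / i%:R)
    <= 3 * (2 * x + 1) + 2 * (2 * x * ln x + x).
    by rewrite lerD// ler_wpM2l.
  move=> /le_trans; apply; nra.
(* the three copies of the previous cross are absorbed by raising b by 3/2, because
   (y + 3/2)^(j+1) >= y^(j+1) + (j+1) (3/2) y^j *)
have b1 : 0 <= b + 3/2 by rewrite addr_ge0// divr_ge0.
exists (b + 3/2) => // x x1; have x0 : 0 < x by apply: lt_le_trans x1.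
have L0 : 0 <= ln x by rewrite ln_ge0.
apply: le_trans (ncrossS_le _ x1) _.
have [T T0] : exists T, Num.trunc x = T.+1.
  by exists (Num.trunc x).-1; rewrite prednK// truncn_gt0.
have Tx : T.+1%:R <= x by rewrite -T0 truncn_le ltW.
have h1 := @sum_inv_ln_le R x b d.+1 T b0 Tx.
set C := 2 ^+ d.+2 / (d.+1)`!%:R : R.
have C0 : 0 <= C by rewrite divr_ge0// exprn_ge0.
have h : \sum_(2 <= i < (Num.trunc x).+1) ncross d.+2 (x / i%:R) <=
    C * x * ((ln x + b) ^+ d.+2 / d.+2%:R).
  apply: le_trans (_ : \sum_(2 <= i < T.+2) C * x * (i%:R^-1 * (ln (x / i%:R) + b) ^+ d.+1) <= _).
    rewrite T0; apply: ler_sum_nat => i /andP[i2 iT].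
    have ix : i%:R <= x by apply: le_trans Tx; rewrite ler_nat.
    have i0 : 0 < i%:R :> R by rewrite ltr0n; apply: leq_trans i2.
    have xi : 1 <= x / i%:R by rewrite ler_pdivlMr// mul1r.
    by apply: le_trans (IH _ xi) _; rewrite le_eqVlt; apply/orP; left; apply/eqP; rewrite /C; ring.
  rewrite -mulr_sumr; apply: (ler_wpM2l (mulr_ge0 C0 (ltW x0))); apply: le_trans h1 _.
  rewrite ler_wpM2r ?invr_ge0// gerBl exprn_ge0// addr_ge0// ln_ge0//.
  by rewrite ler_pdivlMr// mul1r.
apply: le_trans (lerD (ler_wpM2l _ (IH x x1)) (ler_wpM2l _ h)) _ => //.
have LB0 : 0 <= ln x + b by rewrite addr_ge0.
have h2 := @subX_ge R (ln x + b) (ln x + (b + 3/2)) d.+1 LB0.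
have {}h2 : d.+2%:R * (3/2) * (ln x + b) ^+ d.+1 + (ln x + b) ^+ d.+2 <= (ln x + (b + 3/2)) ^+ d.+2.
  rewrite -lerBrDr; apply: le_trans (h2 _); last by rewrite lerD2l lerDl divr_ge0.
  by rewrite le_eqVlt; apply/orP; left; apply/eqP; ring.
rewrite [(d.+2)`!]factS natrM.
have -> : 2 ^+ d.+3 * x * (ln x + (b + 3 / 2)) ^+ d.+2 / (d.+2%:R * (d.+1)`!%:R) =
   2 * C * x / d.+2%:R * (ln x + (b + 3 / 2)) ^+ d.+2.
  by rewrite /C [2 ^+ d.+3]exprS invfM; ring.
have e1 : 3 * (2 ^+ d.+2 * x * (ln x + b) ^+ d.+1 / (d.+1)`!%:R) +
    2 * (C * x * ((ln x + b) ^+ d.+2 / d.+2%:R)) =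
  2 * C * x / d.+2%:R * (d.+2%:R * (3/2) * (ln x + b) ^+ d.+1 + (ln x + b) ^+ d.+2).
  have d2 : d.+2%:R != 0 :> R by rewrite pnatr_eq0.
  rewrite mulrDr; congr (_ + _); last by rewrite /C; ring.
  rewrite /C; move: (d.+2%:R) d2 => D D0; move: ((ln x + b) ^+ d.+1) (2 ^+ d.+2) => A B.
  have f0 : (d.+1)`!%:R != 0 :> R by rewrite pnatr_eq0 -lt0n fact_gt0.
  move: ((d.+1)`!%:R) f0 => F F0; field; first by rewrite D0 F0.
rewrite e1; apply: ler_wpM2l h2; apply: divr_ge0 => //.
by apply: mulr_ge0 (ltW x0); exact: mulr_ge0.
Qed.

Section Lower.
Context (c : R) (c1 : 1 < c) (K : nat) (K0 : (0 < K)%N).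
Hypothesis vc : forall k : int, (K <= `|k|)%N -> v k <= c * `|k|%:R.

Let c0 : 0 < c. Proof. exact: lt_trans c1. Qed.

Lemma ncrossS_ge d x : 0 <= x -> 2 * \sum_(K <= i < (Num.trunc x).+1) ncross d (x / (c * i%:R))
  <= ncross d.+1 x.
Proof.
move=> x0; rewrite ncrossS -[leLHS]add0r lerD ?ncross_ge0//.
have [KT|TK] := leqP K (Num.trunc x).+1; last first.
  rewrite (big_geq (ltnW TK)) mulr0; apply: sumr_ge0 => i _.
  by rewrite addr_ge0 ?ncross_ge0.
rewrite [leRHS](@big_cat_nat _ _ _ K)//= -[leLHS]add0r lerD//.
  by apply: sumr_ge0 => i _; rewrite addr_ge0 ?ncross_ge0.
rewrite mulr_sumr; apply: ler_sum_nat => i /andP[Ki _].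
have i0 : 0 < i%:R :> R by rewrite ltr0n; apply: leq_trans Ki.
rewrite mulr2n mulrDl mul1r.
apply: lerD; apply: le_ncross; rewrite ler_wpM2l// lef_pV2 ?posrE ?mulr_gt0//.
  by have := vc (k := i%:Z) Ki.
by have := vc (k := - i%:Z); rewrite abszN => /(_ Ki).
Qed.

(** By induction, keeping only the frequencies whose first coordinate is so large that
    its weight is at most [c |k|]. One factor [c] is lost per coordinate, so the constant
    is the right one in the limit [c -> 1]. *)
Lemma ncross_lower d : exists2 b : R, 0 <= b & forall x, expR b <= x ->
  2 ^+ d.+1 / c ^+ d.+2 * x * (ln x - b) ^+ d / d`!%:R <= ncross d.+1 x.
Proof.
elim: d => [|d [b b0 IH]].
  (* with one coordinate the bound has a factor 1/c to spare, which absorbs the K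
     discarded integers as soon as x/c - K >= x/c^2 *)
  have A0 : 0 < c * K%:R / (1 - c^-1).
    by rewrite divr_gt0 ?mulr_gt0 ?ltr0n// subr_gt0 invf_lt1.
  exists (ln (c * K%:R / (1 - c^-1))).
    rewrite ln_ge0// ler_pdivlMr ?subr_gt0 ?invf_lt1// mul1r.
    apply: le_trans (_ : 1 <= _); first by rewrite gerBl invr_ge0 ltW.
    by rewrite mulr_ege1 ?ler1n// ltW.
  move=> x; rewrite lnK// => xK.
  have x0 : 0 < x by apply: lt_le_trans xK.
  rewrite expr1 expr0 fact0 divr1 mulr1.
  apply: le_trans (ncrossS_ge 0 (ltW x0)).
  have cn : 1 - c^-1 != 0 by rewrite gt_eqF// subr_gt0 invf_lt1.
  have h : \sum_(K <= i < (Num.trunc (x / c)).+1) 1 <=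
      \sum_(K <= i < (Num.trunc x).+1) ncross 0 (x / (c * i%:R)).
    have Tle : (Num.trunc (x / c) <= Num.trunc x)%N.
      by apply: le_truncn; rewrite ler_pdivrMr// ler_peMr ?(ltW x0)// ltW.
    have [KT|TK] := leqP K (Num.trunc (x / c)).+1; last first.
      by rewrite big_geq ?(ltnW TK)//; apply: sumr_ge0 => i _; exact: ncross_ge0.
    rewrite [leRHS](@big_cat_nat _ _ _ (Num.trunc (x / c)).+1)//= -[leLHS]addr0 lerD//.
      apply: ler_sum_nat => i /andP[Ki iT].
      rewrite /ncross /= ifT// ler_pdivlMr ?mulr_gt0 ?ltr0n ?(leq_trans K0)//.
      move: iT; rewrite ltnS truncn_ge_nat ?divr_ge0 ?(ltW x0) ?(ltW c0)//.
      by rewrite ler_pdivlMr// mul1r mulrC.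
    by apply: sumr_ge0 => i _; exact: ncross_ge0.
  apply: le_trans (ler_wpM2l _ h) => //.
  rewrite sumr_const_nat -mulrA ler_wpM2l//.
  have : x / c <= (Num.trunc (x / c)).+1%:R by rewrite ltW// truncnS_gt.
  have : x / c - K%:R >= x / c ^+ 2.
    move: xK; rewrite ler_pdivrMr ?subr_gt0 ?invf_lt1// => xK.
    rewrite lerBrDr -lerBrDl.
    have -> : x / c - x / c ^+ 2 = x * (1 - c^-1) / c by field; rewrite gt_eqF.
    by rewrite ler_pdivlMr// mulrC.
  move=> h1 h2; rewrite mulrC; apply: le_trans h1 _.
  have [KT|TK] := leqP K (Num.trunc (x / c)).+1; first by rewrite natrB// lerB.
  rewrite (eqP (ltnW TK)) subr_le0; apply: le_trans h2 _.
  by rewrite ler_nat ltnW.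
exists (b + ln c + ln K%:R).
  by rewrite !addr_ge0 ?ln_ge0 ?ler1n// ltW.
move=> x; rewrite !expRD !lnK ?posrE ?ltr0n// => xb.
have x0 : 0 < x by apply: lt_le_trans xb; rewrite !mulr_gt0 ?expR_gt0 ?ltr0n.
(* the radius x / (c i) is in the range of the induction hypothesis when X / i >= 1 *)
pose X := x / (c * expR b).
have X0 : 0 < X by rewrite divr_gt0 ?mulr_gt0 ?expR_gt0.
have KX : K%:R <= X.
  by rewrite ler_pdivlMr ?mulr_gt0 ?expR_gt0// mulrC [c * _]mulrC.
have lnX : ln X = ln x - (b + ln c).
  by rewrite /X ln_div ?posrE ?mulr_gt0 ?expR_gt0// lnM ?posrE ?expR_gt0// expRK; ring.
apply: le_trans (ncrossS_ge _ (ltW x0)).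
set A := 2 ^+ d.+1 / c ^+ d.+2 / d`!%:R : R.
have A0 : 0 <= A by rewrite !mulr_ge0 ?invr_ge0 ?exprn_ge0 ?(ltW c0).
have term i : (K <= i <= Num.trunc X)%N ->
    A * (x / c) * (i%:R^-1 * ln (X / i%:R) ^+ d) <= ncross d.+1 (x / (c * i%:R)).
  case/andP => Ki; rewrite truncn_ge_nat ?(ltW X0)// => iX.
  have i0 : 0 < i%:R :> R by rewrite ltr0n (leq_trans K0).
  have xi : expR b <= x / (c * i%:R).
    rewrite ler_pdivlMr ?mulr_gt0//; move: iX; rewrite ler_pdivlMr ?mulr_gt0 ?expR_gt0//.
    by rewrite (_ : i%:R * (c * expR b) = expR b * (c * i%:R))//; ring.
  apply: le_trans (IH _ xi); rewrite [ln (X / _)]ln_div ?posrE//.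
  rewrite ln_div ?posrE ?mulr_gt0// lnM ?posrE// lnX le_eqVlt; apply/orP; left; apply/eqP.
  have -> : ln x - (ln c + ln i%:R) - b = ln x - (b + ln c) - ln i%:R by ring.
  by rewrite /A [(c * i%:R)^-1]invfM; ring.
have h := sum_inv_ln_trunc_ge d K0 KX.
have TX : (Num.trunc X <= Num.trunc x)%N.
  apply: le_truncn; rewrite /X ler_pdivrMr ?mulr_gt0 ?expR_gt0//.
  by rewrite ler_peMr ?(ltW x0)// mulr_ege1 ?(ltW c1)// -expR0 ler_expR.
apply: le_trans (_ : 2 * \sum_(K <= i < (Num.trunc X).+1)
    (A * (x / c) * (i%:R^-1 * ln (X / i%:R) ^+ d)) <= _); last first.
  rewrite ler_wpM2l// [leRHS](@big_cat_nat _ _ _ (Num.trunc X).+1)//=; last first.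
    by rewrite ltnW// ltnS truncn_ge_nat// ltW.
  rewrite -[leLHS]addr0 lerD//; last by apply: sumr_ge0 => i _; exact: ncross_ge0.
  by apply: ler_sum_nat => i; rewrite ltnS; exact: term.
rewrite -mulr_sumr.
apply: le_trans (_ : 2 * (A * (x / c) * (ln (X / K%:R) ^+ d.+1 / d.+1%:R)) <= _); last first.
  apply: ler_wpM2l => //; apply: ler_wpM2l h; apply: (mulr_ge0 A0).
  by rewrite divr_ge0 ?(ltW x0) ?(ltW c0).
rewrite ln_div ?posrE ?ltr0n// lnX le_eqVlt; apply/orP; left; apply/eqP.
have -> : ln x - (b + ln c + ln K%:R) = ln x - (b + ln c) - ln K%:R by ring.
by rewrite /A factS natrM [2 ^+ d.+2]exprS [c ^+ d.+3]exprS [(c * c ^+ d.+2)^-1]invfM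
  [(d.+1%:R * _)^-1]invfM; ring.
Qed.

End Lower.
End HyperbolicCross.

(** * Crosses with about n points *)

Section Scaling.
Context {R : realType}.
Implicit Types (a b : R) (d n : nat).
Import numFieldNormedType.Exports.

(** In dimension [d + 1], the radius at which a hyperbolic cross has a number of points
    proportional to [n]. *)
Definition cross_radius a d n : R := a * n%:R / ln n%:R ^+ d.

Lemma near_ln_ge b : \forall n \near \oo, b <= ln (n%:R : R).
Proof.
near=> n; rewrite -(expRK b) ler_ln ?posrE ?expR_gt0//; last first.
  by rewrite ltr0n; near: n; exists 1%N.
by near: n; exact: nbhs_infty_ger.
Unshelve. all: by end_near. Qed.

Lemma ln_sqrt_le (x : R) : 0 < x -> ln x <= 2 * Num.sqrt x.
Proof.
move=> x0; rewrite -{1}(sqr_sqrtr (ltW x0)) lnXn ?sqrtr_gt0//.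
by rewrite -[leLHS]mulr_natl ler_wpM2l// ltW// ln_sublinear// sqrtr_gt0.
Qed.

Lemma cvg_inv_ln : (fun n => (ln (n%:R : R))^-1) @ \oo --> (0 : R).
Proof.
apply/cvgrPdist_le => e e0; near=> n; rewrite sub0r normrN/=.
have L : e^-1 <= ln (n%:R : R) by near: n; exact: near_ln_ge.
have L0 : 0 < ln (n%:R : R) by rewrite (lt_le_trans _ L)// invr_gt0.
by rewrite ger0_norm ?invr_ge0 ?(ltW L0)// invf_ple ?posrE.
Unshelve. all: by end_near. Qed.

Lemma cvg_lnln_ln : (fun n => ln (ln (n%:R : R)) / ln n%:R) @ \oo --> (0 : R).
Proof.
apply/cvgrPdist_le => e e0; near=> n; rewrite sub0r normrN/=.
have L : Num.max 1 (4 * e ^- 2) <= ln (n%:R : R) by near: n; exact: near_ln_ge.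
move: L; rewrite ge_max => /andP[L1 L]; have L0 := lt_le_trans ltr01 L1.
rewrite ger0_norm ?divr_ge0 ?(ltW L0) ?ln_ge0// ler_pdivrMr//.
apply: le_trans (ln_sqrt_le L0) _.
rewrite -[in leRHS](sqr_sqrtr (ltW L0)) expr2 mulrA ler_wpM2r ?sqrtr_ge0//.
rewrite mulrC -ler_pdivrMr// -(ler_pXn2r (n := 2)) ?nnegrE ?divr_ge0 ?sqrtr_ge0 ?(ltW e0)//.
by rewrite sqr_sqrtr ?(ltW L0)// expr_div_n -natrX.
Unshelve. all: by end_near. Qed.

Lemma ln_cross_radius a d n : 0 < a -> 0 < ln (n%:R : R) ->
  ln (cross_radius a d n) = ln a + ln n%:R - d%:R * ln (ln n%:R).
Proof.
move=> a0 L0; have n0 : 0 < n%:R :> R.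
  by rewrite ltr0n; case: n L0 => //; rewrite ln0// ltxx.
rewrite /cross_radius ln_div ?posrE ?mulr_gt0 ?exprn_gt0// lnM ?posrE// lnXn//.
by rewrite mulr_natl.
Qed.

Lemma cvg_ln_cross_radius a b d : 0 < a ->
  (fun n => (ln (cross_radius a d n) + b) / ln n%:R) @ \oo --> (1 : R).
Proof.
move=> a0.
have H : (fun n => (1 : R) + ((ln a + b) * (ln (n%:R : R))^-1
    - d%:R * (ln (ln (n%:R : R)) / ln n%:R))) @ \oo --> (1 + ((ln a + b) * 0 - d%:R * 0) : R).
  apply: cvgD; first exact: cvg_cst.
  apply: cvgB; apply: cvgMl_tmp; [exact: cvg_inv_ln | exact: cvg_lnln_ln].
rewrite !mulr0 subr0 addr0 in H; move: H; apply: cvg_trans.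
apply: near_eq_cvg; near=> n.
have L1 : 1 <= ln (n%:R : R) by near: n; exact: near_ln_ge.
have L0 := lt_le_trans ltr01 L1.
by rewrite ln_cross_radius//; field; rewrite gt_eqF.
Unshelve. all: by end_near. Qed.

Lemma near_cross_radius_ge a d (B : R) : 0 < a ->
  \forall n \near \oo, B <= cross_radius a d n.
Proof.
move=> a0.
have C : 0 < Num.max 1 B by rewrite lt_max ltr01.
have /cvgrPdist_le/(_ _ (_ : 0 < 1/2)) H := cvg_ln_cross_radius 0 d a0.
near=> n.
have L : Num.max 1 (2 * ln (Num.max 1 B)) <= ln (n%:R : R) by near: n; exact: near_ln_ge.
move: L; rewrite ge_max => /andP[L1 L]; have L0 := lt_le_trans ltr01 L1.
have n0 : 0 < n%:R :> R.
  by rewrite ltr0n; case: (n) L0 => //; rewrite ln0// ltxx.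
have T0 : 0 < cross_radius a d n by rewrite divr_gt0 ?mulr_gt0// exprn_gt0.
apply: le_trans (_ : Num.max 1 B <= _); first by rewrite le_max lexx orbT.
rewrite -ler_ln ?posrE//.
have : `|1 - (ln (cross_radius a d n) + 0) / ln n%:R| <= 1/2.
  by near: n; apply: H; rewrite divr_gt0.
rewrite ler_norml => /andP[_]; rewrite lerBlDr -lerBlDl addr0 => h.
have {}h : 1/2 <= ln (cross_radius a d n) / ln n%:R by lra.
move: h; rewrite ler_pdivlMr// => h.
lra.
Unshelve. all: by end_near. Qed.

Lemma bernoulli_le (x : R) d : 0 <= x <= 1 -> 1 - d%:R * x <= (1 - x) ^+ d.
Proof.
case/andP => x0 x1; elim: d => [|d IH]; first by rewrite mul0r subr0 expr0.
rewrite exprS; apply: le_trans (ler_wpM2l _ IH); last by rewrite subr_ge0.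
by rewrite mulrSr; have : 0 <= d%:R :> R := ler0n _ _; nra.
Qed.

End Scaling.

Section CrossAsymptotics.
Context {R : realType} (v : int -> R).
Hypothesis v1 : forall k, 1 <= v k.
Hypothesis vk : forall k : int, `|k|%:R <= v k.
Hypothesis vc : forall c : R, 1 < c ->
  exists2 K : nat, (0 < K)%N & forall k : int, (K <= `|k|)%N -> v k <= c * `|k|%:R.
Import numFieldNormedType.Exports.

(** The count [C T (ln T + O(1))^d] at [T = a n / (ln n)^d], since [ln T ~ ln n]. *)
Lemma ncross_cvg (a : R) d : 0 < a ->
  (fun n => ncross v d.+1 (cross_radius a d n) / n%:R) @ \oo -->
  (a * (2 ^+ d.+1 / d`!%:R) : R).
Proof.
move=> a0; set C := 2 ^+ d.+1 / d`!%:R : R.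
have C0 : 0 < C by rewrite divr_gt0 ?exprn_gt0// ltr0n fact_gt0.
have cvgX b : (fun n => a * C * ((ln (cross_radius a d n) + b) / ln n%:R) ^+ d)
    @ \oo --> (a * C : R).
  have E : a * C = a * C * 1 ^+ d by rewrite expr1n mulr1.
  rewrite [X in _ --> X]E.
  apply: cvgMl_tmp; apply: (cvg_comp _ (fun z : R => z ^+ d)).
    exact: cvg_ln_cross_radius.
  exact: exprn_continuous.
apply/cvgrPdist_le => e e0.
have [bu bu0 Hu] : exists2 b : R, 0 <= b & forall x, 1 <= x ->
    ncross v d.+1 x <= C * x * (ln x + b) ^+ d + 1.
  case: d @C {C0 cvgX} => [|d] C.
    exists 0 => // x x1; rewrite expr0 mulr1 /C fact0 divr1 expr1.
    exact: ncross_1_le.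
  have [b b0 H] := ncross_upper v1 vk d; exists b => // x x1.
  apply: le_trans (H x x1) _; rewrite -[leLHS]addr0 lerD// /C.
  by rewrite le_eqVlt; apply/orP; left; apply/eqP; ring.
have e2 : 0 < e / 2 by rewrite divr_gt0.
(* the comparison v k <= |k| / (1 - t) costs a factor (1 - t)^(d+2) in the lower count,
   which is at least 1 - (d+2) t *)
pose t := Num.min (1/2) (e / 2 / (d.+2%:R * (a * C))).
have t0 : 0 < t by rewrite lt_min !divr_gt0 ?mulr_gt0.
have t1 : t <= 1/2 by rewrite ge_min lexx.
have t2 : d.+2%:R * t * (a * C) <= e / 2.
  have : t <= e / 2 / (d.+2%:R * (a * C)) by rewrite ge_min lexx orbT.
  by rewrite ler_pdivlMr ?mulr_gt0// => h; rewrite (mulrC d.+2%:R) -mulrA.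
have u0 : 0 < 1 - t by lra.
have c1 : 1 < (1 - t)^-1 by rewrite invf_gt1//; lra.
have [K K0 HK] := vc c1.
have [bl bl0 Hl] := ncross_lower v1 vk c1 K0 HK d.
near=> n.
have L1 : 1 <= ln (n%:R : R) by near: n; exact: near_ln_ge.
have L0 := lt_le_trans ltr01 L1.
have n0 : 0 < n%:R :> R.
  by rewrite ltr0n; case: (n) L0 => //; rewrite ln0// ltxx.
have TM : Num.max 1 (expR bl) <= cross_radius a d n.
  by near: n; exact: near_cross_radius_ge.
have hl0 : `|a * C - a * C * ((ln (cross_radius a d n) - bl) / ln n%:R) ^+ d| <= e / 4.
  by near: n; have /cvgrPdist_le := cvgX (- bl); apply; rewrite divr_gt0.
have hu0 : `|a * C - a * C * ((ln (cross_radius a d n) + bu) / ln n%:R) ^+ d| <= e / 2.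
  by near: n; have /cvgrPdist_le := cvgX bu; apply.
have ne : (e / 2)^-1 <= n%:R by near: n; exact: nbhs_infty_ger.
set T := cross_radius a d n in TM hl0 hu0 *.
have Tn : T = a * n%:R / ln n%:R ^+ d by [].
move: TM; rewrite ge_max => /andP[T1 Tb].
have T0 := lt_le_trans ltr01 T1.
have eqn (b : R) : C * T * (ln T + b) ^+ d / n%:R = a * C * ((ln T + b) / ln n%:R) ^+ d.
  rewrite expr_div_n Tn; field.
  by rewrite expf_neq0 ?gt_eqF.
rewrite ler_distlC; apply/andP; split.
  have h : a * C * ((ln T - bl) / ln n%:R) ^+ d >= a * C - e / 4.
    by move: hl0; rewrite ler_norml => /andP[_]; lra.
  set w := (1 - t) ^+ d.+2.
  have w1 : w <= 1 by rewrite exprn_ile1 ?(ltW u0)// gerBl ltW.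
  have w0 : 0 <= w by rewrite exprn_ge0 ?(ltW u0).
  have wt : 1 - d.+2%:R * t <= w by apply: bernoulli_le; rewrite (ltW t0)/=; lra.
  have waC : (1 - d.+2%:R * t) * (a * C) <= w * (a * C).
    by rewrite ler_wpM2r// ltW// mulr_gt0.
  have we : w * (e / 4) <= e / 4 by rewrite ler_piMl// divr_ge0 ?(ltW e0).
  have wQ := ler_wpM2l w0 h.
  apply: le_trans (_ : w * (a * C * ((ln T - bl) / ln n%:R) ^+ d) <= _).
    by apply: le_trans wQ; rewrite mulrBr; lra.
  rewrite -eqn mulrA ler_wpM2r ?invr_ge0 ?(ltW n0)//.
  apply: le_trans (Hl _ Tb); rewrite exprVn invrK.
  by rewrite le_eqVlt; apply/orP; left; apply/eqP; rewrite /C /w; ring.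
have h : a * C * ((ln T + bu) / ln n%:R) ^+ d <= a * C + e / 2.
  by move: hu0; rewrite ler_norml => /andP[]; lra.
have n1 : n%:R^-1 <= e / 2 by rewrite invf_ple ?posrE.
apply: le_trans (_ : (C * T * (ln T + bu) ^+ d + 1) / n%:R <= _).
  by rewrite ler_wpM2r ?invr_ge0 ?(ltW n0)// Hu.
by rewrite mulrDl eqn mul1r; lra.
Unshelve. all: by end_near. Qed.

End CrossAsymptotics.

(** * Riemann sums and layers of a cross *)

Section RiemannSum.
Context {R : realType}.
Implicit Types (x y p q : R) (n : nat).

(** Bernoulli's inequality for real exponents, from the concavity of the logarithm. *)
Lemma powR_tangent y q : 0 <= y -> 1 <= q -> 1 + q * (y - 1) <= y `^ q.
Proof.
rewrite le_eqVlt => /predU1P[<- q1|y0 q1].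
  by rewrite sub0r mulrN1; apply: le_trans (powR_ge0 _ _); rewrite subr_le0.
have q0 : 0 < q by apply: lt_le_trans q1.
set z := y `^ q; have z0 : 0 < z by rewrite powR_gt0.
have t01 : 0 <= q^-1 <= 1 by rewrite invr_ge0 ltW//= invf_le1.
pose t := Itv01 (proj1 (andP t01)) (proj2 (andP t01)).
have := @concave_ln R t z 1 z0 ltr01.
rewrite !convRE /= ln1 mulr0 addr0 mulr1 {1}/z ln_powR mulKf ?gt_eqF//.
rewrite /unstable.onem; have w0 : 0 < q^-1 * z + (1 - q^-1).
  by rewrite ltr_pwDl// ?mulr_gt0 ?invr_gt0// subr_ge0 invf_le1.
rewrite ler_ln ?posrE// -(ler_pM2l q0).
have -> : q * (q^-1 * z + (1 - q^-1)) = z + q - 1 by field; rewrite gt_eqF.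
lra.
Qed.

Lemma powR_succ_ge n p : 0 < p ->
  (p + 1) * n%:R `^ p <= n.+1%:R `^ (p + 1) - n%:R `^ (p + 1).
Proof.
move=> p0; case: n => [|n].
  rewrite !powR0 ?gt_eqF ?addr_gt0// mulr0 subr0; exact: powR_ge0.
have n0 : 0 < n.+1%:R :> R by rewrite ltr0n.
have -> : n.+2%:R = n.+1%:R * (1 + n.+1%:R^-1) :> R.
  by rewrite mulrDr mulr1 divff ?gt_eqF// natr1.
rewrite powRM// ?addr_ge0 ?invr_ge0// lerBrDr.
have h : 1 + (p + 1) * n.+1%:R^-1 <= (1 + n.+1%:R^-1) `^ (p + 1).
  have := @powR_tangent (1 + n.+1%:R^-1) (p + 1).
  by rewrite addrAC subrr add0r => -> //; rewrite ?addr_ge0 ?invr_ge0// lerDr ltW.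
apply: le_trans (ler_wpM2l _ h); last exact: powR_ge0.
rewrite powRD; last by rewrite (gt_eqF n0) implybT.
rewrite powRr1 ?(ltW n0)//.
by rewrite le_eqVlt; apply/orP; left; apply/eqP; field; rewrite gt_eqF.
Qed.

(** The left Riemann sum of an increasing function is below its integral; the right one
    exceeds it by the last term, [1 / (n + 1)]. *)
Lemma riemann_powR p n : 0 < p ->
  \sum_(i < n.+1) n.+1%:R^-1 * (i.+1%:R / n.+1%:R) `^ p <= (p + 1)^-1 + n.+1%:R^-1.
Proof.
move=> p0; set m := n.+1%:R : R; have m0 : 0 < m by rewrite ltr0n.
have q0 : 0 < p + 1 by rewrite addr_gt0.
have H k : \sum_(i < k) i%:R `^ p <= k%:R `^ (p + 1) / (p + 1).
  elim: k => [|k IH]; first by rewrite big_ord0 divr_ge0 ?powR_ge0 ?(ltW q0).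
  rewrite big_ord_recr/=; apply: le_trans (lerD IH (lexx _)) _.
  rewrite -lerBrDl -mulrBl ler_pdivlMr// mulrC; exact: powR_succ_ge.
have -> : \sum_(i < n.+1) m^-1 * (i.+1%:R / m) `^ p =
   m^-1 * (m `^ p)^-1 * \sum_(i < n.+1) i.+1%:R `^ p.
  rewrite mulr_sumr; apply: eq_bigr => i _; rewrite powRM ?invr_ge0 ?(ltW m0)//.
  by rewrite -powRN -powR_inv1 ?(ltW m0)// -powRrM mulN1r -!mulrA [_ `^ (-p) * _]mulrC.
have E : \sum_(i < n.+1) i.+1%:R `^ p = \sum_(i < n.+1) i%:R `^ p + m `^ p.
  rewrite [in RHS]big_ord_recl powR0 ?gt_eqF// add0r [in LHS]big_ord_recr/=.
  by congr (_ + _); apply: eq_bigr => i _.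
rewrite E mulrDr mulfVK ?gt_eqF ?powR_gt0// lerD2r.
have h := H n.+1; have w0 : 0 <= m^-1 * (m `^ p)^-1.
  by rewrite mulr_ge0// invr_ge0 ?powR_ge0 ?(ltW m0).
apply: le_trans (ler_wpM2l w0 h) _.
rewrite powRD; last by rewrite (gt_eqF m0) implybT.
rewrite powRr1 ?(ltW m0)//.
rewrite le_eqVlt; apply/orP; left; apply/eqP; rewrite -/m.
have mp : m `^ p != 0 by rewrite gt_eqF// powR_gt0.
by field; rewrite mp !gt_eqF.
Qed.

End RiemannSum.

Section Layers.
Context {R : realType} (v : int -> R).
Hypothesis v1 : forall k, 1 <= v k.
Hypothesis vk : forall k : int, `|k|%:R <= v k.

Definition prod_weight d (t : d.-tuple int) : R := \prod_(i < d) v (tnth t i).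

Lemma prod_weight_gt0 d (t : d.-tuple int) : 0 < prod_weight t.
Proof. exact: lt_le_trans (prod_weight_ge1 v1 t). Qed.

Lemma big_cross_split (d : nat) x y (F : d.-tuple int -> R) : x <= y ->
  \sum_(t <- cross v d y) F t = \sum_(t <- cross v d x) F t +
  \sum_(t <- cross v d y | ~~ (prod_weight t <= x)) F t.
Proof.
move=> xy; rewrite (bigID (fun t => prod_weight t <= x))/=; congr (_ + _).
rewrite -big_filter; apply: perm_big; apply: uniq_perm.
- by rewrite filter_uniq// cross_uniq.
- exact: cross_uniq.
move=> t; rewrite mem_filter !(mem_cross v1 vk); apply/andP/idP => [[]//|tx].
by split=> //; exact: le_trans xy.
Qed.

Lemma ncross_sum d x : ncross v d x = \sum_(t <- cross v d x) 1.
Proof. by rewrite /ncross big_const_seq count_predT -Monoid.iteropE. Qed.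

(** Comparison of a sum over a hyperbolic cross with the counts of the crosses
    of radii [T 0 <= ... <= T m]: [c i] bounds the summand on the [i]-th layer. *)
Lemma sum_layers_le d m (T c : nat -> R) (F : d.-tuple int -> R) :
  {homo T : i j / (i <= j)%N >-> i <= j} -> T 0 < 1 ->
  (forall i t, prod_weight t <= T i.+1 -> F t <= c i) ->
  \sum_(t <- cross v d (T m)) F t <=
  \sum_(i < m) c i * (ncross v d (T i.+1) - ncross v d (T i)).
Proof.
move=> Tm T0 cF; elim: m => [|m IH].
  by rewrite cross0// big_nil big_ord0.
rewrite big_ord_recr/= (@big_cross_split _ (T m))//; last exact: Tm.
apply: lerD => //; rewrite [in leRHS]ncross_sum (@big_cross_split _ (T m)) ?Tm//.
rewrite -ncross_sum [X in _ * X]addrAC subrr add0r mulr_sumr.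
rewrite big_seq_cond [leRHS]big_seq_cond; apply: ler_sum => t /andP[tT _].
by rewrite mulr1; apply: cF; move: tT; rewrite mem_cross.
Qed.

End Layers.

(** * From counting to s-numbers *)

Section Asymptotics.
Context {R : realType} (v : int -> R).
Hypothesis v1 : forall k, 1 <= v k.
Hypothesis vk : forall k : int, `|k|%:R <= v k.
Hypothesis vc : forall c : R, 1 < c ->
  exists2 K : nat, (0 < K)%N & forall k : int, (K <= `|k|)%N -> v k <= c * `|k|%:R.
Context (d : nat) (s : R) (s0 : 0 < s) (u : nat -> \bar R).
Import numFieldNormedType.Exports.

(* [u_upper] is what truncation to a cross with fewer than [n] points gives, and
   [u_lower] what testing on the characters with frequencies in [S] gives. *)
Hypothesis u_ge0 : forall n, (0 <= u n)%E.
Hypothesis u_upper : forall n T, 0 < T -> (size (cross v d.+1 T) < n)%N ->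
  (u n <= (T `^ (- s))%:E)%E.
Hypothesis u_lower : forall n (e : R) (S : seq (d.+1.-tuple int)), uniq S -> 0 < e ->
  (u n < e%:E)%E ->
  (size S)%:R - n%:R <= e ^+ 2 * \sum_(t <- S) (prod_weight v t `^ s) ^+ 2.

Let C : R := 2 ^+ d.+1 / d`!%:R.
Let C0 : 0 < C. Proof. by rewrite divr_gt0 ?exprn_gt0// ltr0n fact_gt0. Qed.

Let rate n : R := n%:R `^ (- s) * ln n%:R `^ (s * d%:R).

Lemma rate_gt0 n : 0 < ln (n%:R : R) -> 0 < rate n.
Proof.
move=> L0; rewrite mulr_gt0 ?powR_gt0// ltr0n.
by case: n L0 => //; rewrite ln0// ltxx.
Qed.

Lemma cross_radius_powR (a : R) n : 0 < a -> 0 < ln (n%:R : R) ->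
  cross_radius a d n `^ (- s) = a `^ (- s) * rate n.
Proof.
move=> a0 L0; have n0 : 0 < n%:R :> R.
  by rewrite ltr0n; case: n L0 => //; rewrite ln0// ltxx.
rewrite /cross_radius powRM ?mulr_ge0 ?invr_ge0 ?exprn_ge0 ?(ltW a0) ?(ltW L0)//.
rewrite powRM ?(ltW a0)// -mulrA; congr (_ * (_ * _)).
rewrite -powR_mulrn ?(ltW L0)// -powR_inv1 ?powR_ge0// -!powRrM.
by congr (_ `^ _); ring.
Qed.

(** A radius slightly below that of the cross with [n] points. *)
Lemma near_rate_upper (e : R) : 0 < e ->
  \forall n \near \oo, (u n <= ((C `^ s + e) * rate n)%:E)%E.
Proof.
(* the radius with a = 1/C' has the rate C'^s = C^s + e, and its cross has about
   (C/C') n < n points *)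
move=> e0; pose C' := (C `^ s + e) `^ (s^-1).
have Cs0 : 0 < C `^ s by rewrite powR_gt0.
have Cse0 : 0 < C `^ s + e by rewrite addr_gt0.
have C'0 : 0 < C' by rewrite powR_gt0.
have C's : C' `^ s = C `^ s + e.
  by rewrite /C' -powRrM mulVf ?gt_eqF// powRr1 ?(ltW Cse0).
have CC' : C < C'.
  rewrite ltNge; apply/negP => h.
  have := @ge0_ler_powR R s (ltW s0) C' C (ltW C'0) (ltW C0) h.
  by rewrite C's; lra.
pose a := C'^-1; have a0 : 0 < a by rewrite invr_gt0.
have aC : a * C < 1 by rewrite mulrC ltr_pdivrMr ?mul1r.
have /cvgrPdist_le/(_ ((1 - a * C) / 2)) H := ncross_cvg v1 vk vc (d := d) a0.
near=> n.
have L1 : 1 <= ln (n%:R : R) by near: n; exact: near_ln_ge.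
have L0 := lt_le_trans ltr01 L1.
have n0 : 0 < n%:R :> R.
  by rewrite ltr0n; case: (n) L0 => //; rewrite ln0// ltxx.
have nb : ((1 - a * C) / 4)^-1 <= n%:R by near: n; exact: nbhs_infty_ger.
have hn : `|a * C - ncross v d.+1 (cross_radius a d n) / n%:R| <= (1 - a * C) / 2.
  by near: n; apply: H; rewrite divr_gt0// subr_gt0.
have T0 : 0 < cross_radius a d n by rewrite divr_gt0 ?mulr_gt0// exprn_gt0.
have size_lt : (size (cross v d.+1 (cross_radius a d n)) < n)%N.
  rewrite -(ltr_nat R) -/(ncross v d.+1 _) -[ltRHS]mul1r -ltr_pdivrMr//.
  by move: hn; rewrite ler_norml => /andP[h _]; lra.
apply: le_trans (u_upper T0 size_lt) _; rewrite lee_fin cross_radius_powR//.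
rewrite ler_wpM2r ?(ltW (rate_gt0 L0))// /a -powR_inv1 ?(ltW C'0)// -powRrM.
by rewrite mulN1r opprK C's.
Unshelve. all: by end_near. Qed.

Let lam : R := (2 * s + 1) / (2 * s).
Let a : R := lam / C.

(** Testing on the cross of radius [T] with about [lam n] points, [lam > 1]: the sum of
    [v^(2s)] over it is a Riemann sum for [lam n T^(2s) / (2 s + 1)], and [lam] is such
    that [lam - 1 = lam / (2 s + 1)], so that [u n] cannot be much smaller than
    [T^-s]. *)
Lemma near_rate_lower (e : R) : 0 < e ->
  \forall n \near \oo, (((a `^ (- s) - e) * rate n)%:E <= u n)%E.
Proof.
have s2 : 0 < 2 * s by rewrite mulr_gt0.
have s21 : 0 < 2 * s + 1 by rewrite addr_gt0.
have lam0 : 0 < lam by rewrite divr_gt0.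
have a0 : 0 < a by rewrite divr_gt0.
(* t is the relative error: a^-s - e = a^-s (1 - t) *)
move=> e0; pose t := e * a `^ s.
have as0 : 0 < a `^ s by rewrite powR_gt0.
have asN0 : 0 < a `^ (- s) by rewrite powR_gt0.
have t0 : 0 < t by rewrite mulr_gt0.
have te : a `^ (- s) - e = a `^ (- s) * (1 - t).
  by rewrite /t mulrBr mulr1 mulrCA -powRD ?addNr ?powRr0 ?mulr1// (gt_eqF a0) implybT.
have [t1|t1] := leP 1 t.
  near=> n; apply: le_trans (u_ge0 n); rewrite lee_fin te.
  have L1 : 1 <= ln (n%:R : R) by near: n; exact: near_ln_ge.
  have r0 := rate_gt0 (lt_le_trans ltr01 L1).
  by rewrite pmulr_lle0// pmulr_rle0// subr_le0.
(* the inequality to be contradicted has the room lam t / (2 s + 1) = 2 lam g: one half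
   is for the error 1/m < g of the Riemann sum over m layers, the other one for the
   errors h of the m counts *)
pose g := (2 * s + 1)^-1 * t / 2.
have g0 : 0 < g by rewrite divr_gt0// mulr_gt0// invr_gt0.
pose m := (Num.trunc g^-1).+1.
have mg : (m%:R : R)^-1 < g by rewrite invf_plt ?posrE ?ltr0n// truncnS_gt.
have m0 : 0 < m%:R :> R by rewrite ltr0n.
pose A i : R := a * (i%:R / m%:R).
have aC : a * C = lam by rewrite /a divfK// gt_eqF.
have Acvg i : (fun n => ncross v d.+1 (cross_radius (A i.+1) d n) / n%:R) @ \oo -->
    (lam * (i.+1%:R / m%:R) : R).
  rewrite -aC mulrAC; apply: ncross_cvg => //.
  by rewrite /A mulr_gt0// divr_gt0 ?ltr0n.
pose h : R := lam * g / (1 + 2 * m%:R).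
have m2 : 0 < 1 + 2 * m%:R :> R by rewrite addr_gt0// mulr_gt0.
have h0 : 0 < h by rewrite divr_gt0// mulr_gt0.
have hE : h * (1 + 2 * m%:R) = lam * g by rewrite /h divfK// gt_eqF.
have Anear : \forall n \near \oo, forall i : 'I_m,
    `|lam * (i.+1%:R / m%:R) - ncross v d.+1 (cross_radius (A i.+1) d n) / n%:R| <= h.
  apply: filter_forall => i.
  by have /cvgrPdist_le := Acvg i; exact.
near=> n.
have L1 : 1 <= ln (n%:R : R) by near: n; exact: near_ln_ge.
have L0 := lt_le_trans ltr01 L1.
have n0 : 0 < n%:R :> R.
  by rewrite ltr0n; case: (n) L0 => //; rewrite ln0// ltxx.
have hN : forall i : 'I_m,
    `|lam * (i.+1%:R / m%:R) - ncross v d.+1 (cross_radius (A i.+1) d n) / n%:R| <= h.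
  by near: n.
rewrite leNgt te -mulrA mulrCA mulrC -cross_radius_powR//; apply/negP.
set T := cross_radius a d n; set N := fun i => ncross v d.+1 (cross_radius (A i) d n).
have T0 : 0 < T by apply: divr_gt0; [exact: mulr_gt0|exact: exprn_gt0].
have Ts0 : 0 < T `^ (- s) by rewrite powR_gt0.
have AT i : cross_radius (A i) d n = T * (i%:R / m%:R) by rewrite /T /A /cross_radius; ring.
have AmT : cross_radius (A m) d n = T by rewrite AT divff ?mulr1// gt_eqF.
have t1' : 0 < 1 - t by rewrite subr_gt0.
(* the cross of radius T, with its lam n points, serves as the set of test frequencies *)
move=> /(u_lower (cross_uniq v d.+1 T)) => /(_ (mulr_gt0 Ts0 t1')).
rewrite -/(ncross v d.+1 T) => H.
pose b (i : nat) : R := (i.+1%:R / m%:R) `^ (2 * s).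
have layers := @sum_layers_le R v v1 vk d.+1 m (fun i => cross_radius (A i) d n)
  (fun i => (T `^ s) ^+ 2 * b i) (fun x => (prod_weight v x `^ s) ^+ 2).
have {}layers : \sum_(x <- cross v d.+1 T) (prod_weight v x `^ s) ^+ 2 <=
    \sum_(i < m) (T `^ s) ^+ 2 * b i * (N i.+1 - N i).
  rewrite -{1}AmT; apply: layers.
  - by move=> i j ij; rewrite !AT ler_wpM2l ?(ltW T0)// ler_wpM2r ?invr_ge0// ler_nat.
  - by rewrite AT mul0r mulr0.
  - move=> i x xT; rewrite -!powR_mulrn ?powR_ge0// -!powRrM.
    have -> : T `^ (s * 2) * b i = (T * (i.+1%:R / m%:R)) `^ (s * 2).
      by rewrite powRM ?(ltW T0) ?divr_ge0// /b [2 * s]mulrC.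
    have px := ltW (prod_weight_gt0 v1 x).
    have im0 : 0 <= T * (i.+1%:R / m%:R) by apply: mulr_ge0 (ltW T0) _; exact: divr_ge0.
    apply: ge0_ler_powR; [exact: mulr_ge0 (ltW s0) _|exact: px|exact: im0|].
    by move: xT; rewrite AT.
have b01 (i : 'I_m) : 0 <= b i <= 1.
  rewrite powR_ge0/=.
  have <- : 1 `^ (2 * s) = 1 :> R by rewrite powR1.
  apply: ge0_ler_powR; rewrite ?nnegrE ?divr_ge0 ?(ltW s2)//.
  by rewrite ler_pdivrMr// mul1r ler_nat.
have N0 : N 0 = 0.
  by rewrite /N AT mul0r mulr0 /ncross cross0.
have hN' i : (i <= m)%N -> `|lam * (i%:R / m%:R) - N i / n%:R| <= h.
  case: i => [|i] im; first by rewrite N0 !mul0r mulr0 subrr normr0 ltW.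
  exact: (hN (Ordinal im)).
have diff (i : 'I_m) : (N i.+1 - N i) / n%:R <= lam / m%:R + 2 * h.
  have := hN' i.+1 (ltn_ord i); have := hN' i (ltnW (ltn_ord i)).
  rewrite !ler_norml -natr1 !mulrDl mulrDr mulNr mul1r => /andP[_ h1] /andP[h2 _].
  lra.
have sumb : \sum_(i < m) b i * ((N i.+1 - N i) / n%:R) <= lam * (2 * s + 1)^-1 + lam * g + 2 * h * m%:R.
  apply: le_trans (_ : \sum_(i < m) (lam * (m%:R^-1 * b i) + 2 * h) <= _).
    apply: ler_sum => i _; have /andP[bi0 bi1] := b01 i.
    apply: le_trans (ler_wpM2l bi0 (diff i)) _.
    rewrite mulrDr; apply: lerD; last by rewrite ler_piMl// mulr_ge0// ltW.
    by rewrite le_eqVlt; apply/orP; left; apply/eqP; ring.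
  rewrite big_split/= sumr_const card_ord -[X in _ + X]mulr_natr lerD2r -mulr_sumr -mulrDr.
  rewrite ler_wpM2l ?(ltW lam0)//; apply: le_trans (riemann_powR _ s2) _.
  by rewrite lerD2l ltW.
have Tss : (T `^ (- s)) ^+ 2 * (T `^ s) ^+ 2 = 1.
  by rewrite -exprMn -powRD ?addNr ?powRr0 ?expr1n// (gt_eqF T0) implybT.
have H2 : N m / n%:R - 1 <= (1 - t) ^+ 2 * (\sum_(i < m) b i * ((N i.+1 - N i) / n%:R)).
  have e1 : (T `^ (- s) * (1 - t)) ^+ 2 * \sum_(i < m) (T `^ s) ^+ 2 * b i * (N i.+1 - N i)
      = n%:R * ((1 - t) ^+ 2 * (\sum_(i < m) b i * ((N i.+1 - N i) / n%:R))).
    rewrite mulrCA !mulr_sumr; apply: eq_bigr => i _.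
    have -> : n%:R * (b i * ((N i.+1 - N i) / n%:R)) = b i * (N i.+1 - N i).
      by field; rewrite gt_eqF.
    have -> : (T `^ (- s) * (1 - t)) ^+ 2 * ((T `^ s) ^+ 2 * b i * (N i.+1 - N i)) =
      (T `^ (- s)) ^+ 2 * (T `^ s) ^+ 2 * ((1 - t) ^+ 2 * (b i * (N i.+1 - N i))) by ring.
    by rewrite Tss mul1r.
  rewrite -(ler_pM2l n0) -e1 mulrBr mulr1 mulrCA divff ?gt_eqF// mulr1 {1}/N AmT.
  apply: le_trans H _; rewrite ler_wpM2l//; exact: sqr_ge0.
have Nm := hN' m (leqnn m); move: Nm; rewrite divff ?gt_eqF// mulr1 ler_norml => /andP[_ Nm].
have sq : (1 - t) ^+ 2 <= 1 - t.
  by rewrite expr2 ler_piMl ?(ltW t1')// gerBl ltW.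
set sb := \sum_(i < m) _ in sumb H2.
(* by the choice of lam the leading terms of the two sides agree but for (1 - t) *)
have lamE : lam - 1 = lam * (2 * s + 1)^-1 by rewrite /lam; field; rewrite !gt_eqF.
have gE : g * 2 = (2 * s + 1)^-1 * t by rewrite /g divfK.
set q := (2 * s + 1)^-1 in sumb lamE gE.
have mh : 2 * h * m%:R + h = lam * g by rewrite -hE; ring.
have H3 : lam - h - 1 <= (1 - t) ^+ 2 * (lam * q + lam * g + 2 * h * m%:R).
  apply: le_trans (ler_wpM2l (sqr_ge0 _) sumb); apply: le_trans H2; lra.
have q0 : 0 < q by rewrite invr_gt0.
have X0 : 0 <= lam * q + lam * g + 2 * h * m%:R.
  apply: addr_ge0; first by apply: addr_ge0; apply: mulr_ge0; exact: ltW.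
  by apply: mulr_ge0 (ltW m0); apply: mulr_ge0 => //; exact: ltW.
have H4 : lam * q - h <= (1 - t) * (lam * q + 2 * (lam * g) - h).
  apply: le_trans (_ : _ <= (1 - t) * (lam * q + lam * g + 2 * h * m%:R)) _.
    have -> : lam * q - h = lam - h - 1 by lra.
    by apply: le_trans H3 _; exact: ler_wpM2r.
  apply: (ler_wpM2l (ltW t1')); lra.
have H5 : lam * q * t = 2 * (lam * g).
  by rewrite -mulrA -gE; ring.
have lg : 0 < lam * g by rewrite mulr_gt0.
have hm0 : 0 <= 2 * h * m%:R by apply: mulr_ge0 (ltW m0); apply: mulr_ge0 => //; exact: ltW.
have : 0 < t * (2 * (lam * g) - h).
  by rewrite mulr_gt0// subr_gt0; lra.
lra.
Unshelve. all: by end_near. Qed.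

Lemma near_rate (e : R) : 0 < e -> exists2 n0 : nat, (0 < n0)%N & forall n : nat, (n0 <= n)%N ->
  (((2 * s / (2 * s + 1)) `^ s * C `^ s - e)%:E <= u n / (rate n)%:E <= (C `^ s + e)%:E)%E.
Proof.
move=> e0; have [N _ H] : \forall n \near \oo,
    (((2 * s / (2 * s + 1)) `^ s * C `^ s - e)%:E <= u n / (rate n)%:E <= (C `^ s + e)%:E)%E.
  near=> n.
  have L1 : 1 <= ln (n%:R : R) by near: n; exact: near_ln_ge.
  have r0 := rate_gt0 (lt_le_trans ltr01 L1).
  rewrite inver gt_eqF//; apply/andP; split; last first.
    rewrite lee_pdivrMr// -EFinM; near: n; exact: near_rate_upper.
  rewrite lee_pdivlMr// -EFinM.
  have s2 : 0 < 2 * s by rewrite mulr_gt0.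
  have s21 : 0 < 2 * s + 1 by rewrite addr_gt0.
  have -> : (2 * s / (2 * s + 1)) `^ s * C `^ s = a `^ (- s).
    have lC : 0 < lam / C by rewrite !divr_gt0.
    rewrite -powRM ?divr_ge0 ?(ltW s2) ?(ltW s21) ?(ltW C0)// -[- s]mulN1r powRrM.
    rewrite /a powR_inv1 ?(ltW lC)//; congr (_ `^ s).
    by rewrite invf_div mulrC /lam invf_div.
  near: n; exact: near_rate_lower.
exists (maxn 1 N); first by rewrite leq_max.
by move=> n; rewrite geq_max => /andP[_ Nn]; exact: H.
Unshelve. all: by end_near. Qed.
End Asymptotics.

(** * The Frobenius distance from the identity to matrices of small rank *)

Section FrobeniusRank.
Context {C : numClosedFieldType}.
Local Open Scope sesquilinear_scope.

Lemma mxtrace_adjoint m n (A : 'M[C]_(m, n)) :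
  \tr (A *m A ^t*) = \sum_i \sum_j `|A i j| ^+ 2.
Proof.
rewrite /mxtrace; apply: eq_bigr => i _; rewrite mxE; apply: eq_bigr => j _.
by rewrite !mxE normCK.
Qed.

Lemma trmxC_mul m n p (A : 'M[C]_(m, n)) (B : 'M[C]_(n, p)) :
  (A *m B) ^t* = B ^t* *m A ^t*.
Proof. by rewrite trmx_mul map_mxM. Qed.

(** Projecting onto the orthogonal complement of the left kernel of [Y]:
    if the rows of [U] are an orthonormal basis of this kernel and [P = U^* U],
    then [U (1 - Y) = U], whence [||(1 - Y) - P||^2 = ||1 - Y||^2 - rank P]. *)
Lemma frobenius_rank_ge m (Y : 'M[C]_m) :
  (m - \rank Y)%:R <= \sum_i \sum_j `|(1%:M - Y) i j| ^+ 2.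
Proof.
rewrite -mxtrace_adjoint; set X := 1%:M - Y.
pose k := \rank (kermx Y); have kE : k = (m - \rank Y)%N by rewrite /k mxrank_ker.
have km : (k <= m)%N by rewrite kE leq_subr.
pose U := schmidt (row_base (kermx Y)).
have UU : U *m U ^t* = 1%:M by apply/unitarymxP; exact: schmidt_unitarymx.
have UY : U *m Y = 0.
  apply/sub_kermxP; apply: submx_trans (_ : (row_base (kermx Y) <= _)%MS).
    by rewrite eqmx_schmidt_free// row_base_free.
  by rewrite eq_row_base.
have UX : U *m X = U by rewrite mulmxBr mulmx1 UY subr0.
pose P := U ^t* *m U.
have PC : P ^t* = P by rewrite /P trmxC_mul trmxCK.
have trP : \tr P = k%:R by rewrite /P mxtrace_mulC UU mxtrace1.
have PP : P *m P = P by rewrite /P mulmxA -[X in X *m _]mulmxA UU mulmx1.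
have PX : \tr (X *m P) = k%:R by rewrite mxtrace_mulC /P -mulmxA UX.
have XC : \tr (P *m X ^t*) = k%:R.
  have -> : P *m X ^t* = (X *m P) ^t* by rewrite trmxC_mul PC.
  by rewrite trace_map_mx mxtrace_tr PX rmorph_nat.
rewrite -kE -subr_ge0; clearbody X.
have -> : \tr (X *m X ^t*) - k%:R = \tr ((X - P) *m (X - P) ^t*).
  have -> : (X - P) ^t* = X ^t* - P by rewrite [(X - P)^T]linearB map_mxB PC.
  rewrite mulmxBr !mulmxBl PP.
  have trB (A B : 'M[C]_m) : \tr (A - B) = \tr A - \tr B by rewrite raddfB.
  by rewrite !trB trP PX XC subrr subr0.
by rewrite mxtrace_adjoint; apply: sumr_ge0 => i _; apply: sumr_ge0 => j _; rewrite exprn_ge0.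
Qed.

End FrobeniusRank.

(** * Multipliers of orthogonality relations *)

Section SignIteration.
Context {R : realType}.
Implicit Types x y : R.

(** The Newton-Schulz iteration for the sign: a polynomial map of [-1, 1] whose
    iterates converge pointwise to the sign function. *)
Definition sg_step y : R := (3 * y - y ^+ 3) / 2.

Lemma sg_stepN y : sg_step (- y) = - sg_step y.
Proof. by rewrite /sg_step; field. Qed.

Lemma iter_sg_stepN n y : iter n sg_step (- y) = - iter n sg_step y.
Proof. by elim: n => // n IH; rewrite !iterS IH sg_stepN. Qed.

Lemma iter_sg_step_bound n y : 0 <= y <= 1 -> y <= iter n sg_step y <= 1.
Proof.
move=> y01; elim: n => [|n]; first by case/andP: y01 => [_ ->]; rewrite lexx.
rewrite iterS; move: (iter n sg_step y) => z /andP[yz z1].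
have /andP[y0 _] := y01; have z0 := le_trans y0 yz.
apply/andP; split; rewrite /sg_step; last first.
  rewrite ler_pdivrMr// mul1r -subr_ge0.
  have -> : 2 - (3 * z - z ^+ 3) = (1 - z) ^+ 2 * (2 + z) by ring.
  by rewrite mulr_ge0 ?sqr_ge0 ?addr_ge0.
apply: le_trans yz _; rewrite ler_pdivlMr// -subr_ge0.
have -> : 3 * z - z ^+ 3 - z * 2 = z * ((1 - z) * (1 + z)) by ring.
by rewrite !mulr_ge0 ?subr_ge0 ?addr_ge0.
Qed.

Lemma sg_step_norm n y : `|y| <= 1 -> `|iter n sg_step y| <= 1.
Proof.
move=> y1; have h : 0 <= `|y| <= 1 by rewrite normr_ge0.
have /andP[yi i1] := iter_sg_step_bound n h.
have i0 : 0 <= iter n sg_step `|y| := le_trans (normr_ge0 y) yi.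
have [y0|y0] := leP 0 y; first by move: i0 i1; rewrite ger0_norm// => i0; rewrite ger0_norm.
by move: i0 i1; rewrite ltr0_norm// iter_sg_stepN => i0; rewrite -normrN ger0_norm.
Qed.

Lemma sg_step_cvg_pos y : 0 < y <= 1 -> iter n sg_step y @[n --> \oo] --> (1 : R).
Proof.
move=> /andP[y0 y1]; have yb : 0 <= y <= 1 by rewrite ltW.
have H n : 1 - iter n sg_step y <= (1 - y / 2) ^+ n.
  elim: n => [|n IH]; first by rewrite expr0 gerBl ltW.
  have /andP[yz z1] := iter_sg_step_bound n yb.
  rewrite iterS exprSr; move: (iter n sg_step y) IH yz z1 => z IH yz z1.
  have -> : 1 - sg_step z = (1 - z) * ((1 - z) * (2 + z) / 2) by rewrite /sg_step; field.
  apply: ler_pM => //; rewrite ?subr_ge0//; last by nra.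
  by rewrite divr_ge0// mulr_ge0 ?subr_ge0// addr_ge0// (le_trans (ltW y0)).
have q : `|1 - y / 2| < 1 by rewrite ltr_norml; apply/andP; split; lra.
have geo : (1 - (1 - y / 2) ^+ n) @[n --> \oo] --> (1 - 0 : R).
  by apply: cvgB; [exact: cvg_cst|exact: cvg_expr].
rewrite subr0 in geo.
apply: (squeeze_cvgr _ geo (cvg_cst (1 : R))).
apply: nearW => n; have /andP[_ ->] := iter_sg_step_bound n yb.
by rewrite andbT lerBlDr -lerBlDl; exact: H.
Qed.

Lemma sg_step_cvg y : `|y| <= 1 -> iter n sg_step y @[n --> \oo] --> Num.sg y.
Proof.
rewrite ler_norml => /andP[yl yr]; have [y0|y0|->] := ltrgtP y 0.
- rewrite ltr0_sg// -(opprK y).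
  have -> : (fun n => iter n sg_step (- - y)) = (fun n => - iter n sg_step (- y)).
    by apply/funext => n; rewrite iter_sg_stepN.
  by apply: cvgN; apply: sg_step_cvg_pos; rewrite oppr_gt0 y0 lerNl.
- by rewrite gtr0_sg//; apply: sg_step_cvg_pos; rewrite y0.
- rewrite sgr0; have -> : (fun n => iter n sg_step 0) = cst 0.
    apply/funext => n; elim: n => // n /= ->; rewrite /sg_step; ring.
  exact: cvg_cst.
Qed.

End SignIteration.

Section Multipliers.
Context {dp : measure_display} {T : measurableType dp} {R : realType}.
Variables (mu : {finite_measure set T -> \bar R}) (u : T -> R).
Hypothesis iu : mu.-integrable setT (EFin \o u).
Variable tests : set (T -> R).

Definition bounded_measurable (f : T -> R) :=
  measurable_fun setT f /\ exists M, forall x, `|f x| <= M.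

Hypothesis bm_tests : tests `<=` bounded_measurable.

Lemma bm_cst (c : R) : bounded_measurable (cst c).
Proof. by split; [exact: measurable_cst | exists `|c|]. Qed.

Lemma bmD f g : bounded_measurable f -> bounded_measurable g ->
  bounded_measurable (f \+ g).
Proof.
move=> [mf [M fM]] [mg [N gN]]; split; first exact: measurable_funD.
by exists (M + N) => x; apply: le_trans (ler_normD _ _) _; exact: lerD.
Qed.

Lemma bmM f g : bounded_measurable f -> bounded_measurable g ->
  bounded_measurable (f \* g).
Proof.
move=> [mf [M fM]] [mg [N gN]]; split; first exact: measurable_funM.
by exists (M * N) => x; rewrite normrM; exact: ler_pM.
Qed.

Lemma integrable_bm f : bounded_measurable f ->
  mu.-integrable setT (EFin \o (u \* f)).
Proof.
move=> [mf [M fM]].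
have mu' : measurable_fun setT u by apply/measurable_EFinP; exact: measurable_int iu.
apply: (@le_integrable _ _ _ mu setT _ _ (fun x => M%:E * (EFin \o u) x)%E) => //.
- exact/measurable_EFinP/measurable_funM.
- move=> x _ /=; rewrite lee_fin !normrM mulrC.
  have M0 : 0 <= M by apply: le_trans (fM x).
  by rewrite ler_wpM2r// (ger0_norm M0).
- exact: integrableZl.
Qed.

Definition annihilates f := bounded_measurable f /\
  forall t, tests t -> (\int[mu]_x (u x * (f x * t x))%:E = 0)%E.

(** The functions [f] for which [u f] is orthogonal to the test functions form a vector
    space that has no reason to be closed under products. Its multipliers are closed
    under sums, products and bounded pointwise limits, hence can be led from
    trigonometric functions to indicators of measurable sets. *)
Definition multiplier p := bounded_measurable p /\
  forall f, annihilates f -> annihilates (p \* f).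

Lemma multiplier_cst c : multiplier (cst c).
Proof.
split=> [|f [bf f0]]; first exact: bm_cst.
split=> [|t tt]; first exact: bmM (bm_cst c) bf.
have -> : (fun x => (u x * ((cst c \* f) x * t x))%:E) =
    (fun x => c%:E * (EFin \o (u \* (f \* t))%R) x)%E.
  by apply/funext => x /=; rewrite -EFinM; congr EFin; ring.
rewrite integralZl//; last by apply: integrable_bm; apply: bmM => //; exact: bm_tests.
by rewrite [X in (_ * X)%E](f0 t tt) mule0.
Qed.

Lemma multiplierD p q : multiplier p -> multiplier q -> multiplier (p \+ q).
Proof.
move=> [bp mp] [bq mq]; split=> [|f af]; first exact: bmD.
have [bpf pf0] := mp f af; have [bqf qf0] := mq f af.
split=> [|t tt]; first by apply: bmM (bmD bp bq) _; case: af.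
have -> : (fun x => (u x * (((p \+ q) \* f) x * t x))%:E) =
    (fun x => (EFin \o (u \* ((p \* f) \* t))%R) x + (EFin \o (u \* ((q \* f) \* t))%R) x)%E.
  by apply/funext => x /=; rewrite -EFinD; congr EFin; ring.
rewrite integralD//; last 2 first.
- by apply: integrable_bm; apply: bmM => //; exact: bm_tests.
- by apply: integrable_bm; apply: bmM => //; exact: bm_tests.
by rewrite [X in (X + _)%E](pf0 t tt) [X in (_ + X)%E](qf0 t tt) adde0.
Qed.

Lemma multiplierM p q : multiplier p -> multiplier q -> multiplier (p \* q).
Proof.
move=> [bp mp] [bq mq]; split=> [|f af]; first exact: bmM.
have -> : (p \* q) \* f = p \* (q \* f) by apply/funext => x /=; rewrite mulrA.
exact/mp/mq.
Qed.

Lemma multiplierZ c p : multiplier p -> multiplier (fun x => c * p x).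
Proof. exact: (multiplierM (multiplier_cst c)). Qed.

(** By dominated convergence, the integrand being at most [M |u f t|]. *)
Lemma multiplier_cvg (p_ : (T -> R)^nat) p M : (forall n, multiplier (p_ n)) ->
  (forall n x, `|p_ n x| <= M) -> (forall x, p_ n x @[n --> \oo] --> p x) ->
  multiplier p.
Proof.
move=> mp pM pcvg.
have mmp n : measurable_fun setT (p_ n) by have [[]] := mp n.
have mpl : measurable_fun setT p.
  by apply: (measurable_fun_cvg mmp) => x _; exact: pcvg.
have bp : bounded_measurable p.
  split=> //; exists M => x; apply: (cvgr_to_le (cvg_norm (pcvg x))).
  by apply: nearW => n; exact: pM.
split=> // f af; split=> [|t tt]; first by apply: bmM bp _; case: af.
have [bf f0] := af; have bt := bm_tests tt.
have bft := bmM bf bt; have [_ [N ftN]] := bft.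
have iuft := integrable_bm bft.
have [] := @dominated_convergence _ _ _ mu setT measurableT
    (fun n x => (u x * ((p_ n \* f) x * t x))%:E) (fun x => (u x * ((p \* f) x * t x))%:E)
    (fun x => M%:E * `|(EFin \o (u \* (f \* t))%R) x|)%E.
- move=> n; apply: (measurable_int mu).
  have := @integrable_bm ((p_ n \* f) \* t); apply.
  by apply: bmM => //; apply: bmM => //; have [] := mp n.
- apply: (measurable_int mu); have := @integrable_bm ((p \* f) \* t); apply.
  by apply: bmM => //; exact: bmM.
- apply/nearW => x _; apply: cvg_EFin; first by near=> n.
  have -> : (fun n => (u x * ((p_ n \* f) x * t x))%:E) = EFin \o (fun n => u x * (p_ n x * f x * t x)) by [].
  rewrite (_ : fine \o _ = (fun n => p_ n x * (u x * (f x * t x)))).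
    rewrite [X in _ --> X](_ : _ = p x * (u x * (f x * t x))); last by rewrite /=; ring.
    by apply: cvgMr_tmp; exact: pcvg.
  by apply/funext => n /=; ring.
- by apply: integrableZl => //; exact: integrable_abse.
- apply/nearW => x n _ /=; rewrite -EFinM lee_fin.
  have -> : u x * (p_ n x * f x * t x) = p_ n x * (u x * (f x * t x)) by ring.
  by rewrite normrM ler_wpM2r.
move=> _ _ /cvg_lim <-//.
have -> : (fun n => \int[mu]_x (u x * ((p_ n \* f) x * t x))%:E)%E = cst 0%E.
  by apply/funext => n; have [_ /(_ f af)[_]] := mp n; apply.
exact: lim_cst.
Unshelve. all: by end_near. Qed.

(** Multipliers form an algebra, so the polynomial iterates approximating the sign are
    multipliers, and their pointwise limit is bounded. *)
Lemma multiplier_sg p : multiplier p -> (forall x, `|p x| <= 1) ->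
  multiplier (fun x => Num.sg (p x)).
Proof.
move=> mp p1; pose F n x := iter n (@sg_step R) (p x).
apply: (@multiplier_cvg F _ 1).
- elim=> [//|n IH].
  have -> : F n.+1 = (fun x => 3/2 * F n x) \+ (fun x => - (1/2) * (F n \* (F n \* F n)) x).
    by apply/funext => x; rewrite /F iterS /sg_step /=; field.
  by apply: multiplierD; apply: multiplierZ => //; do 2 apply: multiplierM => //.
- by move=> n x; exact: sg_step_norm.
- by move=> x; exact: sg_step_cvg.
Qed.

Definition multiplier_set (E : set T) := measurable E /\ multiplier (\1_E).

(** With [p] scaled to [-1, 1], the indicator of [p > 0] is [(sg p + (sg p)^2) / 2]. *)
Lemma multiplier_set_gt0 p : multiplier p -> multiplier_set [set x | 0 < p x].
Proof.
move=> mp; have [[mpf [M pM]] _] := mp.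
split.
  rewrite (_ : [set x | 0 < p x] = setT `&` p @^-1` `]0, +oo[%classic); first exact: mpf.
  by apply/seteqP; split=> x /=; rewrite in_itv/= andbT => // -[].
pose N := `|M| + 1; have N0 : 0 < N by rewrite ltr_wpDl.
have mq : multiplier (fun x => Num.sg (N^-1 * p x)).
  apply: multiplier_sg; first exact: multiplierZ.
  move=> x; rewrite normrM gtr0_norm ?invr_gt0// mulrC ler_pdivrMr// mul1r.
  apply: le_trans (pM x) _; apply: le_trans (ler_norm _) _; by rewrite lerDl.
have -> : \1_[set x | 0 < p x] = (fun x => (1/2) * ((fun x => Num.sg (N^-1 * p x)) \+
   ((fun x => Num.sg (N^-1 * p x)) \* (fun x => Num.sg (N^-1 * p x)))) x) :> (T -> R).
  apply/funext => x; rewrite /= indicE sgrM gtr0_sg ?invr_gt0// mul1r.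
  have [px|px|px] := ltrgtP (p x) 0.
  - by rewrite memNset/= ?ltr0_sg//; [field|apply/negP; rewrite -leNgt ltW].
  - by rewrite mem_set/= ?gtr0_sg//; field.
  - by rewrite memNset/= ?px ?ltxx// sgr0; field.
by apply: multiplierZ; apply: multiplierD => //; exact: multiplierM.
Qed.

Lemma multiplier_setC E : multiplier_set E -> multiplier_set (~` E).
Proof.
move=> [mE ME]; split; first exact: measurableC.
have -> : \1_(~` E) = cst 1 \+ (fun x => -1 * \1_E x) :> (T -> R).
  apply/funext => x; rewrite /= !indicE in_setC.
  by case: (x \in E); rewrite /=; ring.
by apply: multiplierD; [exact: multiplier_cst | exact: multiplierZ].
Qed.

Lemma multiplier_setI E F : multiplier_set E -> multiplier_set F ->
  multiplier_set (E `&` F).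
Proof.
move=> [mE ME] [mF MF]; split; first exact: measurableI.
by rewrite indicI; exact: multiplierM.
Qed.

Lemma multiplier_set_bigcup (E : (set T)^nat) : (forall n, multiplier_set (E n)) ->
  multiplier_set (\bigcup_n E n).
Proof.
move=> mE; split; first by apply: bigcupT_measurable => n; have [] := mE n.
pose G n := \big[setI/setT]_(i < n) ~` E i.
have mG n : multiplier_set (G n).
  elim: n => [|n IH].
    rewrite /G big_ord0; split => //.
    have -> : \1_setT = cst 1 :> (T -> R) by apply/funext => x; rewrite indicT.
    exact: multiplier_cst.
  rewrite /G big_ord_recr/=; apply: multiplier_setI => //; exact: multiplier_setC.
apply: (@multiplier_cvg (fun n => \1_(~` G n)) _ 1).
- by move=> n; have [] := multiplier_setC (mG n).
- by move=> n x; rewrite indicE; case: (_ \in _); rewrite ?normr1// normr0.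
move=> x; have [[n _ Enx]|nEx] := pselect ((\bigcup_n E n) x).
  apply: cvg_near_cst; exists n.+1 => // m /= nm.
  rewrite indicE [RHS]indicE mem_set; last first.
    move=> Gx; have : (\bigcap_(i < m) ~` E i) x by rewrite bigcap_mkord.
    by move=> /(_ n nm); apply.
  by rewrite mem_set//; exists n.
apply: cvg_near_cst; apply: nearW => m; rewrite indicE [RHS]indicE.
rewrite memNset; last first.
  have : (\bigcap_(i < m) ~` E i) x by move=> i _ Ei; apply: nEx; exists i.
  by rewrite bigcap_mkord => Gx; apply.
by rewrite memNset.
Qed.

Lemma multiplier_set_ae E F : multiplier_set E -> measurable F ->
  {ae mu, forall x, E x <-> F x} -> multiplier_set F.
Proof.
move=> [mE [bE ME]] mF EF; split=> //; split=> [|f af].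
  split; first exact: measurable_indic.
  by exists 1 => x; rewrite indicE; case: (_ \in _); rewrite ?normr1// normr0.
have bF : bounded_measurable (\1_F).
  split; first exact: measurable_indic.
  by exists 1 => x; rewrite indicE; case: (_ \in _); rewrite ?normr1// normr0.
have [bEf Ef0] := ME f af; have [bf _] := af.
split=> [|t tt]; first exact: bmM.
rewrite -[RHS](Ef0 t tt); apply: ae_eq_integral => //.
- apply: (measurable_int mu); have := @integrable_bm ((\1_F \* f) \* t); apply.
  by apply: bmM (bm_tests tt); exact: bmM.
- apply: (measurable_int mu); have := @integrable_bm ((\1_E \* f) \* t); apply.
  exact: bmM (bm_tests tt).
move: EF; apply: filterS => x [EFx FEx] _ /=; rewrite !indicE.
suff -> : (x \in F) = (x \in E) by [].
by apply/idP/idP; rewrite !inE.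
Qed.

(** If every measurable set is a multiplier set then [u] integrates to zero over every
    measurable set, since the constant 1 is annihilated. *)
Lemma ae0_of_multiplier : (forall E, measurable E -> multiplier_set E) ->
  tests (cst 1) -> (forall t, tests t -> (\int[mu]_x (u x * t x)%:E = 0)%E) ->
  {ae mu, forall x, u x = 0}.
Proof.
move=> mult t1 ut.
have a1 : annihilates (cst 1).
  split=> [|t tt]; first exact: bm_cst.
  by rewrite -[RHS](ut t tt); apply: eq_integral => x _; rewrite /= mul1r.
have : ae_eq mu setT (EFin \o u) (cst 0%E).
  apply: integral_ae_eq => // E _ mE.
  have [_ [_ /(_ _ a1)[_ /(_ _ t1)]]] := mult E mE.
  rewrite integral0 => <-; rewrite integral_mkcond; apply: eq_integral => x _.
  by rewrite /= !mulr1 patchE indicE; case: (x \in E); rewrite ?mulr1 ?mulr0.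
by apply: filterS => x /(_ I)/= [].
Qed.

End Multipliers.

(** * Integration on the torus *)

Section TorusMeasure.
Context {R : realType}.
Local Notation Tor d := (d.-tuple (measurableTypeR R)).
Local Notation circ := (@circle R).

Lemma bm_integrable (dp : measure_display) (T : measurableType dp)
    (mu : {finite_measure set T -> \bar R}) (f : T -> R) :
  bounded_measurable f -> mu.-integrable setT (EFin \o f).
Proof.
move=> [mf [M fM]]; apply: (@le_integrable _ _ _ mu setT _ _ (EFin \o cst M)) => //.
- exact/measurable_EFinP.
- move=> x _ /=; rewrite lee_fin; apply: le_trans (fM _) _; exact: ler_norm.
- exact: finite_measure_integrable_cst.
Qed.

Lemma torus_Fubini d (f : Tor d.+1 -> R) : bounded_measurable f ->
  (\int[torus d.+1]_x (f x)%:E =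
   \int[circ]_a \int[torus d]_y (f (tcons (a, y)))%:E)%E.
Proof.
move=> [mf [M fM]].
have bc : bounded_measurable (f \o @tcons R d).
  by split; [apply: measurableT_comp => //; exact: measurable_tcons | exists M => x; exact: fM].
have ic := bm_integrable ((circ \x torus d)%E : probability _ _) bc.
rewrite [LHS](@integral_pushforward _ _ _ _ _ (@tcons R d) (measurable_tcons (n := d))
  (circ \x torus d)%E setT (EFin \o f))//.
- by rewrite preimage_setT -(integral12_prod_meas1 ic).
- exact/measurable_EFinP.
Qed.

Lemma is_derive_sin_affine (k c x : R) : k != 0 ->
  is_derive x 1 (fun x : R => x + (sin \o (fun x => k * x + c)) x * k^-1)
    (1 + cos (k * x + c)).
Proof.
move=> k0; have h1 : is_derive x 1 (fun x : R => k * x + c) k.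
  by apply: is_derive_eq; rewrite /GRing.scale/= mulr1; exact: addr0.
apply: is_derive_eq; congr (_ + _); rewrite scaler0 add0r /GRing.scale/=.
by rewrite mulrCA mulVf// mulr1.
Qed.

Lemma bm_cos_affine (k c : R) : bounded_measurable (fun x : R => cos (k * x + c)).
Proof.
split; last by exists 1 => x; exact: cos_max.
apply: (@measurableT_comp _ _ _ _ _ _ (@cos R)).
  by apply: continuous_measurable_fun; exact: continuous_cos.
by apply: measurable_funD => //; exact: measurable_funM.
Qed.

Lemma sin_intD2pi (k : int) (c : R) : sin (k%:~R * (2 * pi) + c) = sin c.
Proof.
have H (n : nat) (x : R) : sin (n%:R * (2 * pi) + x) = sin x.
  elim: n x => [|n IH] x; first by rewrite mul0r add0r.
  rewrite mulrSr mulrDl mul1r -addrA IH addrC mulr_natl; exact: sinD2pi.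
case: k => n; first exact: H.
by rewrite -[LHS](H n.+1) NegzE mulrNz mulNr -pmulrn addNKr.
Qed.

Lemma circle_cos (k : int) (c : R) : k != 0 ->
  (\int[circ]_x (cos (k%:~R * x + c))%:E = 0)%E.
Proof.
move=> k0; pose g (x : R) := cos (k%:~R * x + c).
have kR : (k%:~R : R) != 0 by rewrite intr_eq0.
have bg : bounded_measurable g by exact: bm_cos_affine.
have ig := bm_integrable circ bg.
have i1 : circ.-integrable setT (EFin \o cst (1 : R)).
  by apply: bm_integrable; exact: bm_cst.
(* 1 + g is nonnegative, which the formula for integrals against a density asks for *)
have g1 : (\int[circ]_x (1 + g x)%:E = 1)%E.
  have b1g : bounded_measurable (fun x => 1 + g x) by apply: bmD bg; exact: bm_cst.
  have D x := @is_derive_sin_affine k%:~R c x kR.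
  have cF : continuous (fun x : R => x + (sin \o (fun x => k%:~R * x + c)) x * k%:~R^-1).
    move=> x; apply: differentiable_continuous; apply/derivable1_diffP.
    by apply: ex_derive; exact: D.
  rewrite integral_uniform; last 2 first.
  - by apply/measurable_EFinP; case: b1g.
  - by move=> x; rewrite lee_fin -lerBlDl sub0r; exact: cos_geN1.
  rewrite (@continuous_FTC2 _ _ (fun x => x + (sin \o (fun x => k%:~R * x + c)) x * k%:~R^-1)).
  - rewrite /= -EFinD -EFinM subr0 mulr0 add0r; congr EFin.
    rewrite sin_intD2pi.
    by rewrite add0r addrK mulVf// gt_eqF// lt0_2pi.
  - exact: lt0_2pi.
  - apply: continuous_subspaceT => x; apply: continuousD; first exact: cst_continuous.
    apply: (@continuous_comp _ _ _ (fun x : R => k%:~R * x + c) (@cos R)).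
      by apply: continuousD; [apply: cvgMl_tmp; exact: cvg_id|exact: cst_continuous].
    exact: continuous_cos.
  - split.
    + by move=> x _; apply: ex_derive; exact: D.
    + by apply: cvg_at_right_filter; exact: cF.
    + by apply: cvg_at_left_filter; exact: cF.
  - by move=> x _; rewrite derive1E; apply: derive_val; exact: D.
move: g1; under eq_integral do rewrite EFinD.
rewrite integralD//= integral_cst//= probability_setT mul1e.
have := integrable_fin_num measurableT ig; rewrite /comp.
set I := (\int[_]_x _)%E => fin.
by rewrite -(fineK fin) -EFinD => -[] h; congr EFin; lra.
Qed.

Lemma phase_cons d (k0 : int) (k : d.-tuple int) (a : R) (y : Tor d) :
  phase (cons_tuple k0 k) (tcons (a, y)) = k0%:~R * a + phase k y.
Proof.
rewrite /phase big_ord_recl; congr (_ * _ + _).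
by apply: eq_bigr => i _; rewrite !tnthS.
Qed.

Lemma bm_cos_phase d (k : d.-tuple int) (c : R) :
  bounded_measurable (fun x : Tor d => cos (phase k x + c)).
Proof.
split; last by exists 1 => x; exact: cos_max.
apply: (@measurableT_comp _ _ _ _ _ _ (@cos R)).
  by apply: continuous_measurable_fun; exact: continuous_cos.
by apply: measurable_funD => //; exact: measurable_phase.
Qed.

(** Induction on the dimension by Fubini: the terms of the other coordinates act as a
    phase, which is why an arbitrary phase [c] is carried along. *)
Lemma torus_cos_phase d (k : d.-tuple int) (c : R) : k != [tuple of nseq d 0] ->
  (\int[torus d]_x (cos (phase k x + c))%:E = 0)%E.
Proof.
elim: d k c => [|d IH] k c; first by rewrite (tuple0 k) => /eqP[]; exact/val_inj.
case/tupleP: k => k0 k kn.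
rewrite torus_Fubini; last exact: bm_cos_phase.
have [kE|/IH kN] := eqVneq k [tuple of nseq d 0]; last first.
  rewrite (eq_integral (cst 0%E)) ?integral0// => a _ /=.
  rewrite -(kN (k0%:~R * a + c)); apply: eq_integral => y _.
  by rewrite phase_cons; congr (cos _)%:E; ring.
have k00 : k0 != 0.
  apply: contra_neq kn => k00; rewrite kE k00; exact/val_inj.
rewrite -[RHS](circle_cos c k00); apply: eq_integral => a _.
rewrite (eq_integral (cst (cos (k0%:~R * a + c))%:E)).
  rewrite integral_cst// [X in (_ * X)%E](_ : _ = 1%E) ?mule1//.
  exact: (@probability_setT _ _ _ (torus d)).
move=> y _; rewrite phase_cons kE /phase big1 ?addr0// => i _.
by rewrite tnth_nseq mul0r.
Qed.

Lemma torus_coord_null d (i : 'I_d) (N : set R) : measurable N -> circ N = 0%E ->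
  torus d [set x | N (tnth x i)] = 0%E.
Proof.
move=> mN N0; elim: d i => [[]//|d IH] i.
rewrite /= /distribution /pushforward.
have [->|i0] := eqVneq i ord0.
  have -> : tcons (n := d) @^-1` [set x | N (tnth x ord0)] = N `*` setT.
    by apply/seteqP; split=> [[a y]|[a y] []]//=; rewrite tnth0.
  by rewrite product_measure1E// [X in (X * _)%E]N0 mul0e.
have [j ->] : exists j, i = lift ord0 j.
  by case: (unliftP ord0 i) i0 => [j ->|->]; [exists j | rewrite eqxx].
have -> : tcons (n := d) @^-1` [set x | N (tnth x (lift ord0 j))] =
    setT `*` [set y | N (tnth y j)].
  by apply/seteqP; split=> [[a y]|[a y] []]//=; rewrite tnthS.
rewrite product_measure1E//; first by rewrite [X in (_ * X)%E]IH mule0.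
rewrite -[X in measurable X]setTI; exact: (@measurable_tnth _ (measurableTypeR R) d j).
Qed.

Lemma circle_box_null : circ (~` `[0, 2 * pi[) = 0%E.
Proof.
apply/eqP; rewrite -measure_le0.
have -> : ~` `[0, 2 * pi[%classic = ~` `[0, 2 * pi]%classic `|` [set 2 * pi] :> set R.
  apply/seteqP; split=> x /=; rewrite !in_itv/=.
    move/negP; rewrite negb_and -!ltNge -leNgt.
    have [->|x2 h] := eqVneq x (2 * pi); first by right.
    left; apply/negP; rewrite negb_and -!ltNge.
    by move: h; rewrite le_eqVlt eq_sym (negbTE x2).
  case=> [/negP h|->]; last by rewrite ltxx andbF.
  by apply/negP; apply: contra h => /andP[-> /ltW].
apply: le_trans (measureU2 _ _ _) _ => //.
  by apply: measurableC; exact: measurable_itv.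
rewrite -[leRHS]adde0; apply: leeD.
  rewrite [leLHS](_ : _ = 0%E)//.
  have h := @integral_uniform_pdf R 0 (2 * pi) (~` `[0, 2 * pi]).
  by rewrite [LHS]h setICl integral_set0.
rewrite [leLHS](_ : _ = 0%E)//.
have /null_content_dominatesP := @dominates_uniform_prob R 0 (2 * pi) (lt0_2pi).
by apply=> //; exact: lebesgue_measure_set1.
Qed.

End TorusMeasure.

(** * Uniqueness of Fourier coefficients *)

Section Uniqueness.
Context {R : realType} {d : nat}.
Local Notation Tor := (d.-tuple (measurableTypeR R)).
Local Notation mu := (@torus R d).

Definition cos_tests : set (Tor -> R) :=
  [set f | exists k c, f = fun x => cos (phase k x + c)].

Lemma cos_tests_bm : cos_tests `<=` @bounded_measurable _ Tor R.
Proof. by move=> _ [k [c ->]]; exact: bm_cos_phase. Qed.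

Definition shift (k : d.-tuple int) (i : 'I_d) (e : int) : d.-tuple int :=
  [tuple tnth k j + (if j == i then e else 0) | j < d].

Lemma phase_shift k i e (x : Tor) : phase (shift k i e) x = phase k x + e%:~R * tnth x i.
Proof.
rewrite /phase; under eq_bigr do rewrite tnth_mktuple intrD mulrDl.
rewrite big_split/=; congr (_ + _); rewrite (bigD1 i)//= eqxx big1 ?addr0//.
by move=> j /negbTE ->; rewrite mul0r.
Qed.

Section Annihilated.
Variable u : Tor -> R.
Hypothesis iu : mu.-integrable setT (EFin \o u).
Local Notation multiplier := (multiplier mu u cos_tests).
Local Notation multiplier_set := (multiplier_set mu u cos_tests).

(** The product-to-sum formula turns the product of this cosine and a test function into
    a half-sum of two test functions with shifted frequencies. *)
Lemma multiplier_cos_coord i b : multiplier (fun x => cos (tnth x i + b)).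
Proof.
have bi : bounded_measurable (fun x : Tor => cos (tnth x i + b)).
  split; last by exists 1 => x; exact: cos_max.
  apply: (@measurableT_comp _ _ _ _ _ _ (@cos R)).
    by apply: continuous_measurable_fun; exact: continuous_cos.
  by apply: measurable_funD => //; exact: measurable_tnth.
split=> // f [bf f0]; split; first exact: bmM.
move=> _ [k [c ->]].
pose t1 x := cos (@phase R d (shift k i 1) x + (c + b)).
pose t2 x := cos (@phase R d (shift k i (-1)) x + (c - b)).
have T1 : cos_tests t1 by exists (shift k i 1), (c + b).
have T2 : cos_tests t2 by exists (shift k i (-1)), (c - b).
have I1 := integrable_bm iu (bmM bf (cos_tests_bm T1)).
have I2 := integrable_bm iu (bmM bf (cos_tests_bm T2)).
rewrite (eq_integral (fun x => (1/2)%:E * ((EFin \o (u \* (f \* t1))%R) x + (EFin \o (u \* (f \* t2))%R) x))%E).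
  rewrite integralZl//; last exact: integrableD.
  rewrite integralD// [X in (_ * (X + _))%E](f0 _ T1) [X in (_ * (_ + X))%E](f0 _ T2).
  by rewrite adde0 mule0.
move=> x _; rewrite /= -EFinD -EFinM; congr EFin.
rewrite /t1 /t2 !phase_shift mulr1z mulrN1z !mul1r mulN1r.
have -> : phase k x + tnth x i + (c + b) = (phase k x + c) + (tnth x i + b) by ring.
have -> : phase k x - tnth x i + (c - b) = (phase k x + c) - (tnth x i + b) by ring.
by move: (phase k x + c) (tnth x i + b) => A B; rewrite cosD cosB; field.
Qed.

Lemma multiplier_sin_coord i : multiplier (fun x => sin (tnth x i)).
Proof.
have := multiplier_cos_coord i (- (pi / 2)).
by under eq_fun do rewrite cosBpihalf.
Qed.

(** On this half-open box a coordinate is determined by its sine and cosine. *)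
Lemma ae_coord_box i : {ae mu, forall x, 0 <= tnth x i < 2 * pi}.
Proof.
exists [set x | (~` `[0, 2 * pi[%classic) (tnth x i)]; split.
- rewrite -[X in measurable X]setTI; apply: (@measurable_tnth _ (measurableTypeR R) d i) => //.
  by apply: measurableC; exact: measurable_itv.
- apply: torus_coord_null; last exact: circle_box_null.
  by apply: measurableC; exact: measurable_itv.
- by move=> x /= h; rewrite in_itv/=.
Qed.

(** Almost everywhere [x_i] is in [0, 2 pi[, where, for [a] in this interval, [x_i < a] is
    a condition on the signs of the multipliers [sin x_i] and [cos x_i - cos a]: the
    cosine decreases on the first half of the interval and increases on the second. *)
Lemma multiplier_set_ltr i a : multiplier_set [set x | tnth x i < a].
Proof.
have pi0 : 0 < pi :> R := pi_gt0 R.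
have bm := cos_tests_bm.
have mC c : multiplier_set [set x | 0 < cos (tnth x i) - c].
  apply: (multiplier_set_gt0 iu bm).
  have := multiplierD iu bm (multiplier_cos_coord i 0) (multiplier_cst iu bm (- c)).
  by under eq_fun do rewrite /= addr0.
have mCN c : multiplier_set [set x | 0 < c - cos (tnth x i)].
  apply: (multiplier_set_gt0 iu bm).
  have := multiplierD iu bm (multiplier_cst iu bm c)
    (multiplierZ iu bm (-1) (multiplier_cos_coord i 0)).
  by under eq_fun do rewrite /= addr0 mulN1r.
have mS : multiplier_set [set x | 0 < - sin (tnth x i)].
  apply: (multiplier_set_gt0 iu bm).
  have := multiplierZ iu bm (-1) (multiplier_sin_coord i).
  by under eq_fun do rewrite /= mulN1r.
have ma : measurable [set x : Tor | tnth x i < a].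
  rewrite (_ : [set x : Tor | tnth x i < a] = setT `&` (fun x : Tor => tnth x i) @^-1` `]-oo, a[%classic).
    by apply: (@measurable_tnth _ (measurableTypeR R) d i) => //; exact: measurable_itv.
  by apply/seteqP; split=> x /=; rewrite in_itv/= => // -[].
have box := ae_coord_box i.
have sin_lt0 x : 0 <= x < 2 * pi -> (0 < - sin x) = (pi < x).
  move=> /andP[x0 x2]; rewrite oppr_gt0; have [xp|px] := ltP pi x.
    have -> : (sin x < 0) = (0 < sin (x - pi)).
      by rewrite sinB sinpi cospi mulr0 subr0 mulrN1 oppr_gt0.
    apply: sin_gt0_pi.
    by rewrite subr_gt0 xp ltrBlDr; lra.
  by apply/negbTE; rewrite -leNgt sin_ge0_pi// x0.
have [a0|a0] := leP a 0.
  apply: (multiplier_set_ae iu bm (multiplier_setC iu bm (mC (-2)))) => //.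
  move: box; apply: filterS; first exact: (ae_filter_ringOfSetsType mu).
  move=> x /andP[x0 _]; split=> [/= []|/=].
    by rewrite opprK; have := cos_geN1 (tnth x i : R); lra.
  by move=> xa; have := le_lt_trans x0 (lt_le_trans xa a0); rewrite ltxx.
have [ap|ap] := leP a pi.
  apply: (multiplier_set_ae iu bm (multiplier_setI (mC (cos a)) (multiplier_setC iu bm mS))) => //.
  move: box; apply: filterS; first exact: (ae_filter_ringOfSetsType mu).
  move=> x xb; have /andP[x0 x2] := xb.
  have ltcos : tnth x i <= pi -> (cos a < cos (tnth x i : R)) = (tnth x i < a).
    move=> xp; rewrite ltr_cos// !in_itv/= ?x0 ?xp//.
    by rewrite (ltW a0) ap.
  rewrite /= subr_gt0 sin_lt0//; split=> [[h /negP]|xa].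
    by rewrite -leNgt => xp; move: h; rewrite ltcos.
  have xp : tnth x i <= pi := le_trans (ltW xa) ap.
  by rewrite ltcos//; split=> //; apply/negP; rewrite -leNgt.
have [a2|a2] := leP (2 * pi) a.
  apply: (multiplier_set_ae iu bm (multiplier_setC iu bm (mC 2))) => //.
  move: box; apply: filterS; first exact: (ae_filter_ringOfSetsType mu).
  move=> x /andP[_ x2]; split=> [_|_ /=].
    exact: lt_le_trans a2.
  by have := cos_le1 (tnth x i : R); lra.
apply: (multiplier_set_ae iu bm (multiplier_setC iu bm
  (multiplier_setI mS (multiplier_setC iu bm (mCN (cos a)))))) => //.
move: box; apply: filterS; first exact: (ae_filter_ringOfSetsType mu).
  move=> x xb; have /andP[x0 x2] := xb.
have cos2 (y : R) : cos y = cos (2 * pi - y).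
  by rewrite -[LHS]cosN -[LHS]cosD2pi -mulr_natl; congr cos; ring.
have ltcos : pi < tnth x i -> (cos (tnth x i : R) < cos a) = (tnth x i < a).
  move=> px; rewrite (cos2 a) (cos2 (tnth x i)) ltr_cos ?in_itv/=.
  - by rewrite ltrD2l ltrN2.
  - by apply/andP; split; lra.
  - by apply/andP; split; lra.
rewrite /= subr_gt0 sin_lt0//; split=> [h|xa [px]].
  have [xp|px] := leP (tnth x i) pi; first exact: le_lt_trans ap.
  rewrite ltNge; apply/negP => ax; apply: h; split=> //.
  by rewrite ltcos// => /lt_le_trans /(_ ax); rewrite ltxx.
by rewrite ltcos// xa.
Qed.

(** Multiplier sets form a sigma-algebra that contains the half-spaces [x_i < a]. *)
Lemma multiplier_set_measurable E : measurable E -> multiplier_set E.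
Proof.
have bm := cos_tests_bm.
pose B i := [set N : set (measurableTypeR R) | multiplier_set [set x | N (tnth x i)]].
have sB i : sigma_algebra setT (B i).
  split.
  - have := multiplier_setC iu bm (multiplier_set_gt0 iu bm (multiplier_cst iu bm 1)).
    congr multiplier_set; apply/seteqP; split=> x //=; apply; exact: ltr01.
  - move=> N BN; have := multiplier_setC iu bm BN.
    by congr multiplier_set; apply/seteqP; split=> x //= [].
  - move=> F BF; have := multiplier_set_bigcup iu bm BF.
    by congr multiplier_set; apply/seteqP; split=> x [n _ Fn]; exists n.
have BM i N : measurable N -> multiplier_set [set x | N (tnth x i)].
  rewrite [measurable N](_ : _ = (@ocitv R).-sigma.-measurable N)// RGenInftyO.measurableE.
  move: N; apply: smallest_sub (sB i) _ => _ [a ->].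
  rewrite /B /=.
  rewrite (_ : [set x : Tor | _] = [set x | tnth x i < a]).
    exact: multiplier_set_ltr.
  by apply/seteqP; split=> x /=; rewrite in_itv.
move: E; apply: smallest_sub.
  split.
  - have := multiplier_setC iu bm (multiplier_set_gt0 iu bm (multiplier_cst iu bm 1)).
    congr multiplier_set; apply/seteqP; split=> x //=; apply; exact: ltr01.
  - by move=> A /(multiplier_setC iu bm); rewrite setTD.
  - by move=> F; exact: multiplier_set_bigcup.
move=> A; rewrite -bigcup_seq => -[i _ [N mN <-]].
by rewrite setTI; exact: BM.
Qed.

Theorem torus_uniqueness_real :
  (forall k c, (\int[mu]_x (u x * cos (phase k x + c))%:E = 0)%E) ->
  {ae mu, forall x, u x = 0}.
Proof.
move=> u0; apply: (ae0_of_multiplier iu) multiplier_set_measurable _ _.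
  exists [tuple of nseq d 0], 0; apply/funext => x /=.
  by rewrite /phase big1 ?addr0 ?cos0// => j _; rewrite tnth_nseq mul0r.
by move=> _ [k [c ->]]; exact: u0.
Qed.

End Annihilated.
End Uniqueness.

Section ComplexUniqueness.
Context {R : realType} {d : nat}.
Local Notation Tor := (d.-tuple (measurableTypeR R)).
Local Notation mu := (@torus R d).
Implicit Types (k : d.-tuple int) (f g : Tor -> R[i]).

Lemma complexP (z w : R[i]) : complex.Re z = complex.Re w ->
  complex.Im z = complex.Im w -> z = w.
Proof. by case: z; case: w => ? ? ? ? /= -> ->. Qed.

Lemma phaseN k (x : Tor) : phase [tuple - tnth k i | i < d] x = - phase k x.
Proof.
by rewrite /phase -sumrN; apply: eq_bigr => i _; rewrite tnth_mktuple mulrNz mulNr.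
Qed.

Lemma cintegrable_mul_char f k : cmeasurable f -> cintegrable mu f ->
  cintegrable mu (fun x => f x * expi (- phase k x)).
Proof.
move=> [mr mi] [ir ii].
have bc := bm_cos_phase (R := R) k 0; have bs := bm_cos_phase (R := R) k (- (pi / 2)).
split.
- have h1 := integrable_bm ir bc; have h2 := integrable_bm ii bs.
  rewrite (_ : _ \o _ = (EFin \o ((@complex.Re R \o f) \* (fun x => cos (phase k x + 0)))%R)
     \+ (EFin \o ((@complex.Im R \o f) \* (fun x => cos (phase k x + - (pi / 2))))%R))%E.
    exact: integrableD.
  apply/funext => x /=; rewrite cReM -EFinD; congr EFin => /=.
  by rewrite cosN sinN addr0 cosBpihalf; ring.
- have h1 := integrable_bm ii bc; have h2 := integrable_bm ir bs.
  rewrite (_ : _ \o _ = (EFin \o ((@complex.Im R \o f) \* (fun x => cos (phase k x + 0)))%R)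
     \- (EFin \o ((@complex.Re R \o f) \* (fun x => cos (phase k x + - (pi / 2))))%R))%E.
    exact: integrableB.
  apply/funext => x /=; rewrite cImM -EFinB; congr EFin => /=.
  by rewrite cosN sinN addr0 cosBpihalf; ring.
Qed.

Lemma Rintegral_eq0 (h : Tor -> R) : mu.-integrable setT (EFin \o h) ->
  \int[mu]_x h x = 0 -> (\int[mu]_x (h x)%:E = 0)%E.
Proof.
move=> ih h0; rewrite -(@fineK _ (\int[mu]_x (h x)%:E)%E).
  by congr EFin; exact: h0.
by have := integrable_fin_num measurableT ih.
Qed.

(** A function with vanishing Fourier coefficients is null: both components are
    orthogonal to all [cos (k.x + c)], as the coefficients at [k] and [-k] show. *)
Lemma torus_uniqueness f : cmeasurable f -> cintegrable mu f ->
  (forall k, fourier f k = 0) -> {ae mu, forall x, f x = 0}.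
Proof.
move=> mf [ir ii] f0; pose u := @complex.Re R \o f; pose v := @complex.Im R \o f.
have bs k c : mu.-integrable setT (EFin \o (u \* (fun x => cos (phase k x + c)))).
  by apply: integrable_bm => //; exact: bm_cos_phase.
have bs' k c : mu.-integrable setT (EFin \o (v \* (fun x => cos (phase k x + c)))).
  by apply: integrable_bm => //; exact: bm_cos_phase.
pose I (w : Tor -> R) k c := \int[mu]_x (w \* (fun x => cos (phase k x + c))) x.
have reE k : I u k 0 + I v k (- (pi / 2)) = 0.
  have := f0 k => /(congr1 (@complex.Re R))/= h; rewrite -[RHS]h {h}.
  rewrite -RintegralD//; apply: eq_Rintegral => x _ /=.
  by rewrite cReM /= cosN sinN addr0 cosBpihalf; ring.
have imE k : I v k 0 - I u k (- (pi / 2)) = 0.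
  have := f0 k => /(congr1 (@complex.Im R))/= h; rewrite -[RHS]h {h}.
  rewrite -RintegralB//; apply: eq_Rintegral => x _ /=.
  by rewrite cImM /= cosN sinN addr0 cosBpihalf; ring.
have IN0 w k : I w [tuple - tnth k i | i < d] 0 = I w k 0.
  by apply: eq_Rintegral => x _ /=; rewrite phaseN !addr0 cosN.
have INs w k : (forall k c, mu.-integrable setT (EFin \o (w \* (fun x => cos (phase k x + c))))) ->
    I w [tuple - tnth k i | i < d] (- (pi / 2)) = - I w k (- (pi / 2)).
  move=> iw; rewrite /I -[RHS]mulN1r -RintegralZl//; apply: eq_Rintegral => x _ /=.
  by rewrite phaseN !cosBpihalf sinN; ring.
have I0 w k c : (forall k c, mu.-integrable setT (EFin \o (w \* (fun x => cos (phase k x + c))))) ->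
    I w k c = cos c * I w k 0 - sin c * I w k (- (pi / 2)).
  move=> iw; rewrite /I -!RintegralZl// -RintegralB//; last 2 first.
  - exact: (integrableZl measurableT (cos c) (iw k 0)).
  - exact: (integrableZl measurableT (sin c) (iw k (- (pi / 2)))).
  apply: eq_Rintegral => x _ /=.
  by rewrite cosBpihalf addr0 cosD; ring.
have Iu0 k c : I u k c = 0.
  rewrite I0//; have := reE k; have := reE [tuple - tnth k i | i < d].
  have := imE k; have := imE [tuple - tnth k i | i < d].
  rewrite !IN0 !INs// => h1 h2 h3 h4.
  have -> : I u k 0 = 0 by lra.
  have -> : I u k (- (pi / 2)) = 0 by lra.
  by rewrite !mulr0 subrr.
have Iv0 k c : I v k c = 0.
  rewrite I0//; have := reE k; have := reE [tuple - tnth k i | i < d].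
  have := imE k; have := imE [tuple - tnth k i | i < d].
  rewrite !IN0 !INs// => h1 h2 h3 h4.
  have -> : I v k 0 = 0 by lra.
  have -> : I v k (- (pi / 2)) = 0 by lra.
  by rewrite !mulr0 subrr.
have hu : {ae mu, forall x, u x = 0}.
  apply: (torus_uniqueness_real ir) => k c; exact: Rintegral_eq0 (bs k c) (Iu0 k c).
have hv : {ae mu, forall x, v x = 0}.
  apply: (torus_uniqueness_real ii) => k c; exact: Rintegral_eq0 (bs' k c) (Iv0 k c).
have F := ae_filter_ringOfSetsType mu.
by move: hu hv; apply: filterS2 => x ux vx; apply: complexP.
Qed.

Lemma torus_Rint_cos k c : k != [tuple of nseq d 0] ->
  \int[mu]_x cos (phase k x + c) = 0.
Proof. by move=> k0; rewrite /Rintegral torus_cos_phase. Qed.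

Definition trigpoly (S : seq (d.-tuple int)) (c : d.-tuple int -> R[i]) (x : Tor) : R[i] :=
  \sum_(k <- S) c k * expi (phase k x).

Definition cbounded f M := cmeasurable f /\ forall x, normc (f x) <= M.

Lemma cbounded_integrable f M : cbounded f M -> cintegrable mu f.
Proof.
move=> [[mr mi] fM]; split; apply: bm_integrable.
- split=> //; exists M => x; exact: le_trans (Re_le_normc _) (fM x).
- split=> //; exists M => x; exact: le_trans (Im_le_normc _) (fM x).
Qed.

Lemma cmeasurable_expi k : cmeasurable (fun x : Tor => expi (phase k x)).
Proof.
have := cmeasurable_char (R := R) [tuple - tnth k i | i < d].
by under eq_fun do rewrite phaseN opprK.
Qed.

Lemma normc_sum_le (I : Type) (r : seq I) (F : I -> R[i]) :
  normc (\sum_(i <- r) F i) <= \sum_(i <- r) normc (F i).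
Proof.
elim: r => [|i r IH]; first by rewrite !big_nil normc0.
by rewrite !big_cons; apply: le_trans (le_normcD _ _) _; rewrite lerD2l.
Qed.

Lemma cbounded_trigpoly S c : cbounded (trigpoly S c) (\sum_(k <- S) normc (c k)).
Proof.
split=> [|x].
  elim: S => [|k S IH].
    rewrite (_ : trigpoly _ _ = cst 0); first exact: cmeasurable_cst.
    by apply/funext => x; rewrite /trigpoly big_nil.
  rewrite (_ : trigpoly _ _ = (fun x => c k * expi (phase k x)) + trigpoly S c).
    apply: cmeasurableD IH.
    by apply: (@cmeasurableZ _ _ _ (c k)); exact: cmeasurable_expi.
  by apply/funext => x; rewrite /trigpoly big_cons.
apply: le_trans (normc_sum_le _ _) _; apply: ler_sum => k _.
by rewrite normcM normc_expi mulr1.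
Qed.

Lemma expiD (s t : R) : expi (s + t) = expi s * expi t.
Proof. by apply: complexP; rewrite ?cReM ?cImM /= ?cosD ?sinD; ring. Qed.

Lemma fourierDf f g k : cmeasurable f -> cintegrable mu f -> cmeasurable g ->
  cintegrable mu g -> fourier (fun x => f x + g x) k = fourier f k + fourier g k.
Proof.
move=> mf jf mg jg; rewrite -cintegralD; [|exact: cintegrable_mul_char..].
by congr cintegral; apply/funext => x /=; rewrite mulrDl.
Qed.

Lemma fourierZf (a : R[i]) f k : cmeasurable f -> cintegrable mu f ->
  fourier (fun x => a * f x) k = a * fourier f k.
Proof.
move=> mf jf; rewrite -cintegralZ; last exact: cintegrable_mul_char.
by congr cintegral; apply/funext => x; exact/esym/mulrA.
Qed.

Lemma fourier_expi k j : fourier (fun x : Tor => expi (phase k x)) j = (k == j)%:R.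
Proof.
pose m := [tuple tnth k i - tnth j i | i < d].
have E (x : Tor) : expi (phase k x) * expi (- phase j x) = expi (phase m x).
  rewrite -expiD; congr expi; rewrite /phase -sumrB; apply: eq_bigr => i _.
  by rewrite tnth_mktuple intrB mulrBl.
rewrite /fourier (_ : (fun _ => _) = (fun x => expi (phase m x))); last first.
  by apply/funext => x; exact: E.
have mE : (m == [tuple of nseq d 0]) = (k == j).
  apply/eqP/eqP => [m0|kj].
    apply: eq_from_tnth => i; apply/eqP; rewrite -subr_eq0.
    by have /eqP := congr1 (fun t => tnth t i) m0; rewrite tnth_mktuple tnth_nseq.
  by apply: eq_from_tnth => i; rewrite tnth_mktuple kj subrr tnth_nseq.
have [kj|kj] := eqVneq k j.
  have m0 (x : Tor) : phase m x = 0.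
    have -> : m = [tuple of nseq d 0] by apply/eqP; rewrite mE kj.
    by rewrite /phase big1// => i _; rewrite tnth_nseq mul0r.
  apply: complexP => /=.
    under eq_Rintegral do rewrite m0 cos0.
    rewrite Rintegral_cst// mul1r [X in fine X](_ : _ = 1%E)//.
    exact: (@probability_setT _ _ _ (torus d)).
  under eq_Rintegral do rewrite m0 sin0.
  by rewrite Rintegral_cst// mul0r.
have mn : m != [tuple of nseq d 0] by rewrite mE.
apply: complexP => /=.
  rewrite -(torus_Rint_cos 0 mn); apply: eq_Rintegral => x _; by rewrite addr0.
rewrite -(torus_Rint_cos (- (pi / 2)) mn); apply: eq_Rintegral => x _; by rewrite cosBpihalf.
Qed.

Lemma fourier_trigpoly S c k : uniq S ->
  fourier (trigpoly S c) k = if k \in S then c k else 0.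
Proof.
elim: S => [_|j S IH /andP[jS uS]].
  have -> : trigpoly [::] c = (fun x => 0 * expi (phase k x)).
    by apply/funext => x; rewrite /trigpoly big_nil mul0r.
  rewrite fourierZf ?mul0r//; first exact: cmeasurable_expi.
  apply: (@cbounded_integrable _ 1); split; first exact: cmeasurable_expi.
  by move=> x; rewrite normc_expi.
have ie : cintegrable mu (fun x : Tor => expi (phase j x)).
  apply: (@cbounded_integrable _ 1); split; first exact: cmeasurable_expi.
  by move=> x; rewrite normc_expi.
have -> : trigpoly (j :: S) c = (fun x => c j * expi (phase j x) + trigpoly S c x).
  by apply/funext => x; rewrite /trigpoly big_cons.
have bj : cbounded (fun x => c j * expi (phase j x)) (normc (c j)).
  split; first by apply: (@cmeasurableZ _ _ _ (c j)); exact: cmeasurable_expi.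
  by move=> x; rewrite normcM normc_expi mulr1.
have bS := cbounded_trigpoly S c.
rewrite fourierDf; [|exact: bj.1|exact: cbounded_integrable bj|exact: bS.1|exact: cbounded_integrable bS].
rewrite fourierZf//; last exact: cmeasurable_expi.
rewrite fourier_expi IH// inE [j == k]eq_sym; have [->|kj] /= := eqVneq k j.
  by rewrite (negbTE jS) addr0 mulr1.
by rewrite mulr0 add0r.
Qed.

End ComplexUniqueness.

(** * Functions with absolutely summable Fourier coefficients *)

Section SupBound.
Context {R : realType} {d : nat}.
Local Notation Tor := (d.-tuple (measurableTypeR R)).
Local Notation mu := (@torus R d).
Implicit Types (k : d.-tuple int) (f g : Tor -> R[i]).

Lemma Rintegral_bounded_cvg (h_ : (Tor -> R)^nat) h M :
  (forall n, measurable_fun setT (h_ n)) -> (forall n x, `|h_ n x| <= M) ->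
  (forall x, h_ n x @[n --> \oo] --> h x) ->
  \int[mu]_x h_ n x @[n --> \oo] --> \int[mu]_x h x.
Proof.
move=> mh hM hcvg.
have mh' : measurable_fun setT h by apply: (measurable_fun_cvg mh) => x _; exact: hcvg.
have iM : mu.-integrable setT (EFin \o cst M) by apply: bm_integrable; exact: bm_cst.
have [] := @dominated_convergence _ _ _ mu setT measurableT
   (fun n x => (h_ n x)%:E) (fun x => (h x)%:E) (EFin \o cst M).
- by move=> n; exact/measurable_EFinP.
- exact/measurable_EFinP.
- apply/nearW => x _; apply: cvg_EFin; first by near=> n.
  exact: hcvg.
- exact: iM.
- by apply/nearW => x n _ /=; rewrite lee_fin.
move=> ih _ hc; apply: fine_cvg; rewrite fineK//.
by have := integrable_fin_num measurableT ih.
Unshelve. all: by end_near. Qed.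

(** Listing the frequencies by their codes makes a Fourier series an ordinary series. *)
Definition enum_freq N : seq (d.-tuple int) := pmap pickle_inv (iota 0 N).

Lemma enum_freq_uniq N : uniq (enum_freq N).
Proof. by apply: (pmap_uniq (@pickle_invK _)); exact: iota_uniq. Qed.

Lemma mem_enum_freq N k : (pickle k < N)%N -> k \in enum_freq N.
Proof.
by move=> kN; rewrite mem_pmap; apply/mapP; exists (pickle k); rewrite ?mem_iota// pickleK_inv.
Qed.

(** An integrable function with absolutely summable Fourier coefficients is almost
    everywhere the sum of its Fourier series, by uniqueness, hence bounded by the
    sum of the moduli. *)
Lemma ae_le_sum_fourier f S : cmeasurable f -> cintegrable mu f ->
  (forall L, uniq L -> \sum_(k <- L) normc (fourier f k) <= S) ->
  {ae mu, forall x, normc (f x) <= S}.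
Proof.
move=> mf jf fS; pose c := fourier f.
pose G N := trigpoly (enum_freq N) c.
pose a n (x : Tor) : R[i] := oapp (fun k => c k * expi (phase k x)) 0 (@pickle_inv (d.-tuple int) n).
pose b n : R := oapp (fun k => normc (c k)) 0 (@pickle_inv (d.-tuple int) n).
have GE N x : G N x = \sum_(0 <= n < N) a n x.
  by rewrite /G /trigpoly /enum_freq big_pmap /index_iota subn0.
have bE N : series b N = \sum_(k <- enum_freq N) normc (c k).
  by rewrite /series /= /enum_freq big_pmap /index_iota subn0.
have b0 n : 0 <= b n by rewrite /b; case: pickle_inv => //= k; exact: normc_ge0.
have bS N : series b N <= S by rewrite bE; apply: fS; exact: enum_freq_uniq.
have S0 : 0 <= S by have := bS 0%N; rewrite /series /= big_geq.
have ab n x : normc (a n x) = b n.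
  rewrite /a /b; case: pickle_inv => [k|]; last exact: normc0.
  by rewrite [LHS]normcM normc_expi mulr1.
have cb : cvgn (series b).
  apply: nondecreasing_is_cvgn.
    by apply/nondecreasing_seqP => n; rewrite /series/= big_nat_recr//= lerDl.
  by exists S => _ [n _ <-]; exact: bS.
have cRe x : cvgn (series (fun n => complex.Re (a n x))).
  apply: normed_cvg; apply: (series_le_cvg _ b0 _ cb) => n; first exact: normr_ge0.
  by rewrite -(ab n x); exact: Re_le_normc.
have cIm x : cvgn (series (fun n => complex.Im (a n x))).
  apply: normed_cvg; apply: (series_le_cvg _ b0 _ cb) => n; first exact: normr_ge0.
  by rewrite -(ab n x); exact: Im_le_normc.
have ReG N x : complex.Re (G N x) = series (fun n => complex.Re (a n x)) N.
  rewrite GE /series/=; elim: N => [|N IH]; first by rewrite !big_geq.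
  by rewrite !big_nat_recr//= cReD IH.
have ImG N x : complex.Im (G N x) = series (fun n => complex.Im (a n x)) N.
  rewrite GE /series/=; elim: N => [|N IH]; first by rewrite !big_geq.
  by rewrite !big_nat_recr//= cImD IH.
pose g x := Complex (limn (series (fun n => complex.Re (a n x))))
                    (limn (series (fun n => complex.Im (a n x)))).
have gRe x : complex.Re (G N x) @[N --> \oo] --> complex.Re (g x).
  by under eq_fun do rewrite ReG; exact: cRe.
have gIm x : complex.Im (G N x) @[N --> \oo] --> complex.Im (g x).
  by under eq_fun do rewrite ImG; exact: cIm.
have GS N x : normc (G N x) <= S.
  have [_ /(_ x) h] := cbounded_trigpoly (enum_freq N) c.
  by apply: le_trans h _; apply: fS; exact: enum_freq_uniq.
have mG N : cmeasurable (G N) by have [] := cbounded_trigpoly (enum_freq N) c.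
have mg : cmeasurable g.
  split.
    apply: (@measurable_fun_cvg _ _ _ _ (fun N x => complex.Re (G N x))) => [N|x _]; last exact: gRe.
    by have [] := mG N.
  apply: (@measurable_fun_cvg _ _ _ _ (fun N x => complex.Im (G N x))) => [N|x _]; last exact: gIm.
  by have [] := mG N.
have gS x : normc (g x) <= S.
  rewrite -(ger0_norm S0) -sqrtr_sqr normc_sqrt ler_wsqrtr//.
  have h : (complex.Re (G N x) ^+ 2 + complex.Im (G N x) ^+ 2) @[N --> \oo] -->
      complex.Re (g x) ^+ 2 + complex.Im (g x) ^+ 2.
    by apply: cvgD; rewrite !expr2; under eq_fun do rewrite expr2; apply: cvgM.
  apply: (cvgr_to_le h); apply: nearW => N.
  have := GS N x; rewrite normc_sqrt => h1.
  rewrite -(@sqr_sqrtr _ (_ + _)) ?addr_ge0 ?sqr_ge0//.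
  by rewrite lerXn2r// nnegrE sqrtr_ge0.
have bg : cbounded g S by [].
have ig := cbounded_integrable bg.
(* the coefficients pass to the limit because the partial sums are bounded by S *)
have fg k : fourier g k = c k.
  have GN N : (pickle k < N)%N -> fourier (G N) k = c k.
    by move=> kN; rewrite fourier_trigpoly ?enum_freq_uniq// mem_enum_freq.
  have mGe N := cmeasurableM (mG N) (cmeasurable_char (R := R) k).
  have GeS N x : normc (G N x * expi (- phase k x)) <= S.
    by rewrite normcM normc_expi mulr1.
  have lim_eq (h : nat -> R) (A B : R) : h @ \oo --> A -> h @ \oo --> B -> A = B.
    by move=> hA hB; rewrite -[LHS](cvg_lim (@Rhausdorff R) hA); exact: cvg_lim hB.
  apply: complexP.
    apply: (lim_eq (fun N => \int[mu]_x complex.Re (G N x * expi (- phase k x)))).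
      apply: (Rintegral_bounded_cvg (M := S)).
      + by move=> N; have [] := mGe N.
      + by move=> N x; exact: le_trans (Re_le_normc _) (GeS N x).
      + move=> x; rewrite cReM; under eq_fun do rewrite cReM.
        by apply: cvgB; apply: cvgMr_tmp; [exact: gRe|exact: gIm].
    apply: cvg_near_cst; exists (pickle k).+1 => // N /= kN.
    by have := GN N kN => /(congr1 (@complex.Re R)).
  apply: (lim_eq (fun N => \int[mu]_x complex.Im (G N x * expi (- phase k x)))).
    apply: (Rintegral_bounded_cvg (M := S)).
    + by move=> N; have [] := mGe N.
    + by move=> N x; exact: le_trans (Im_le_normc _) (GeS N x).
    + move=> x; rewrite cImM; under eq_fun do rewrite cImM.
      by apply: cvgD; apply: cvgMr_tmp; [exact: gRe|exact: gIm].
  apply: cvg_near_cst; exists (pickle k).+1 => // N /= kN.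
  by have := GN N kN => /(congr1 (@complex.Im R)).
have mNg : cmeasurable (fun x => -1 * g x) := cmeasurableZ (-1) mg.
have iNg : cintegrable mu (fun x => -1 * g x).
  apply: (@cbounded_integrable _ _ _ S); split=> // x.
  by rewrite normcM normcN normc1 mul1r.
have mh : cmeasurable (fun x => f x + -1 * g x) := cmeasurableD mf mNg.
have ih : cintegrable mu (fun x => f x + -1 * g x).
  case: jf iNg => jr ji [nr ni]; split.
    rewrite (_ : _ \o _ = (EFin \o (@complex.Re R \o f)) \+
      (EFin \o (@complex.Re R \o (fun x => (-1 * g x)%R))))%E; first exact: integrableD.
    by apply/funext => x /=; rewrite cReD.
  rewrite (_ : _ \o _ = (EFin \o (@complex.Im R \o f)) \+
    (EFin \o (@complex.Im R \o (fun x => (-1 * g x)%R))))%E; first exact: integrableD.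
  by apply/funext => x /=; rewrite cImD.
have h0 : {ae mu, forall x, f x + -1 * g x = 0}.
  apply: torus_uniqueness => // k.
  by rewrite fourierDf// fourierZf// fg mulN1r subrr.
have F := ae_filter_ringOfSetsType mu.
move: h0; apply: filterS => x /eqP; rewrite mulN1r subr_eq0 => /eqP ->; exact: gS.
Qed.

End SupBound.

(** * L_p norms on the torus and Bessel's inequality *)

Section LpNorms.
Context {R : realType} {d : nat}.
Local Notation Tor := (d.-tuple (measurableTypeR R)).
Local Notation mu := (@torus R d).
Implicit Types (k : d.-tuple int) (f g : Tor -> R[i]) (p : \bar R).

Lemma torusT : mu setT = 1%E.
Proof. exact: (@probability_setT _ _ _ (torus d)). Qed.

Lemma cLnorm_le_ae p f M : (1 <= p)%E -> cmeasurable f -> 0 <= M ->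
  {ae mu, forall x, normc (f x) <= M} -> (cLnorm mu p f <= M%:E)%E.
Proof.
move=> p1 mf M0 fM; have F := ae_filter_ringOfSetsType mu.
rewrite /cLnorm unlock /Lnorm; case: p p1 => [r r1|_|//]; last first.
  rewrite [X in (0 < X)%E](_ : _ = 1%E); last exact: torusT.
  rewrite lte01; apply/ess_supP; move: fM; apply: filterS => x fx /=.
  by rewrite lee_fin ger0_norm ?normc_ge0.
have r0 : 0 < r by move: r1; rewrite lee_fin; exact: lt_le_trans.
have h : (\int[mu]_x `|(EFin \o (fun x => normc (f x))) x| `^ r <= (M `^ r)%:E)%E.
  apply: (@le_trans _ _ (\int[mu]_x (M `^ r)%:E)%E); last first.
    by rewrite integral_cst// [X in (_ * X)%E]torusT mule1.
  apply: ae_ge0_le_integral => //.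
  - by move=> x _; exact: poweR_ge0.
  - under eq_fun do rewrite /= ger0_norm ?normc_ge0//.
    apply/measurable_EFinP; apply: (@measurableT_comp _ _ _ _ _ _ (@powR R ^~ r)) => //.
    exact: measurable_normc.
  - by move=> x _; rewrite lee_fin powR_ge0.
  - move: fM; apply: filterS => x fx _ /=; rewrite ger0_norm ?normc_ge0// lee_fin.
    by apply: ge0_ler_powR; rewrite ?nnegrE ?normc_ge0// ltW.
have -> : M%:E = ((M `^ r)%:E `^ r^-1)%E.
  by rewrite poweR_EFin -powRrM divff ?gt_eqF// powRr1.
apply: gt0_ler_poweR => //.
- by rewrite invr_ge0 ltW.
- by rewrite in_itv/= leey andbT; apply: integral_ge0 => x _; rewrite lee_fin powR_ge0.
- by rewrite in_itv/= leey andbT lee_fin powR_ge0.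
Qed.

Lemma cLfun_L1 p (p1 : (1 <= p)%E) f : f \in cLfun mu p1 -> f \in cLfun mu (lexx 1%E).
Proof.
move=> fp; have := fp; rewrite inE => -[mf _].
have h := cLnorm_fin fp.
have fT : mu setT \is a fin_num by rewrite torusT.
have := Lfun_subset (lexx 1%E) p1 fT p1 h; rewrite inE => /andP[_].
by rewrite inE /= => fN; rewrite inE; split.
Qed.

Lemma cLfun_cintegrable p (p1 : (1 <= p)%E) f : f \in cLfun mu p1 -> cintegrable mu f.
Proof. by move=> /cLfun_L1; exact: cLfun1_integrable. Qed.

Lemma measurable_normc2 f : cmeasurable f -> measurable_fun setT (fun x => normc (f x) ^+ 2).
Proof. by move=> mf; apply: measurable_funX; exact: measurable_normc. Qed.

(** For p > 2 the L_p norm dominates the L_2 norm on a probability space; the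
    pointwise form of Jensen's inequality used here is the tangent line of a power. *)
Lemma integral_normc2_le p f e : (2%:E < p)%E -> cmeasurable f -> 0 < e ->
  (cLnorm mu p f <= e%:E)%E -> (\int[mu]_x (normc (f x) ^+ 2)%:E <= (e ^+ 2)%:E)%E.
Proof.
move=> p2 mf e0; have F := ae_filter_ringOfSetsType mu.
have mn := measurable_normc mf.
have m2 : measurable_fun setT (fun x => (normc (f x) ^+ 2)%:E).
  by apply/measurable_EFinP; exact: measurable_normc2.
rewrite /cLnorm unlock /Lnorm; case: p p2 => [r r2 h|_ h|//]; last first.
  apply: (@le_trans _ _ (\int[mu]_x (e ^+ 2)%:E)%E); last first.
    by rewrite integral_cst// [X in (_ * X)%E]torusT mule1.
  apply: ae_ge0_le_integral => //.
  - by move=> x _; rewrite lee_fin sqr_ge0.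
  - by move=> x _; rewrite lee_fin sqr_ge0.
  - move: h; rewrite [X in (0 < X)%E](_ : _ = 1%E); last exact: torusT.
    rewrite lte01 => /ess_supP; apply: filterS => x /=.
    rewrite lee_fin ger0_norm ?normc_ge0// => fe _; rewrite lee_fin.
    by rewrite lerXn2r// nnegrE ?normc_ge0// ltW.
rewrite lte_fin in r2; have r0 : 0 < r by apply: lt_trans r2.
pose q := r / 2; have q1 : 1 <= q by rewrite ler_pdivlMr// mul1r ltW.
have q0 : 0 < q by apply: lt_le_trans q1.
have Ir : (\int[mu]_x (normc (f x) `^ r)%:E <= (e `^ r)%:E)%E.
  move: h; rewrite (eq_integral (fun x => (normc (f x) `^ r)%:E)); last first.
    by move=> x _; rewrite /= ger0_norm ?normc_ge0.
  set I := (\int[_]_x _)%E => h.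
  have I0 : (0 <= I)%E by apply: integral_ge0 => x _; rewrite lee_fin powR_ge0.
  have -> : I = ((I `^ r^-1) `^ r)%E by rewrite -poweRrM mulVf ?gt_eqF// poweRe1.
  rewrite -poweR_EFin; apply: gt0_ler_poweR => //; first exact: ltW.
    by rewrite in_itv/= leey andbT poweR_ge0.
  by rewrite in_itv/= leey andbT lee_fin ltW.
(* the tangent line of y^(r/2) at y = 1, for y = (|f| / e)^2 *)
have pt x : normc (f x) ^+ 2 <= e ^+ 2 * q^-1 / e `^ r * normc (f x) `^ r + e ^+ 2 * (1 - q^-1).
  pose y := (normc (f x) / e) ^+ 2.
  have y0 : 0 <= y by rewrite sqr_ge0.
  have nf0 := normc_ge0 (f x).
  have yq : y `^ q = normc (f x) `^ r / e `^ r.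
    rewrite /y -powR_mulrn ?divr_ge0 ?(ltW e0)// -powRrM.
    rewrite [2%:R * q](_ : _ = r); last by rewrite /q mulrC divfK.
    rewrite powRM ?invr_ge0 ?(ltW e0)//; congr (_ * _).
    have -> : e^-1 = e `^ (-1) by rewrite powR_inv1 ?(ltW e0).
    by rewrite -powRrM mulN1r powRN.
  have := powR_tangent y0 q1; rewrite yq => h1.
  have -> : normc (f x) ^+ 2 = e ^+ 2 * y.
    by rewrite /y expr_div_n [RHS]mulrCA divff ?mulr1// expf_neq0// gt_eqF.
  have -> : e ^+ 2 * q^-1 / e `^ r * normc (f x) `^ r + e ^+ 2 * (1 - q^-1) =
    e ^+ 2 * (q^-1 * (normc (f x) `^ r / e `^ r) + (1 - q^-1)) by ring.
  rewrite ler_wpM2l ?sqr_ge0// -(ler_pM2l q0).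
  have -> : q * (q^-1 * (normc (f x) `^ r / e `^ r) + (1 - q^-1)) =
     normc (f x) `^ r / e `^ r + (q - 1) by field; rewrite ?gt_eqF ?powR_gt0.
  lra.
have mr : measurable_fun setT (fun x => (normc (f x) `^ r)%:E).
  by apply/measurable_EFinP; apply: (@measurableT_comp _ _ _ _ _ _ (@powR R ^~ r)).
set A := e ^+ 2 * q^-1 / e `^ r in pt.
have A0 : 0 <= A.
  apply: divr_ge0 (powR_ge0 _ _); apply: mulr_ge0 (sqr_ge0 _) _.
  by rewrite invr_ge0 ltW.
set B := e ^+ 2 * (1 - q^-1) in pt.
have B0 : 0 <= B by rewrite mulr_ge0 ?sqr_ge0// subr_ge0 invf_le1.
apply: (@le_trans _ _ (\int[mu]_x (A%:E * (normc (f x) `^ r)%:E + B%:E))%E).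
  apply: ge0_le_integral => //.
  - by move=> x _; rewrite lee_fin sqr_ge0.
  - apply: emeasurable_funD => //; exact: measurable_funeM.
  - by move=> x _; rewrite -EFinM -EFinD lee_fin.
rewrite ge0_integralD//; last 2 first.
- by move=> x _; rewrite -EFinM lee_fin mulr_ge0// powR_ge0.
- exact: measurable_funeM.
rewrite ge0_integralZl//; last by move=> x _; rewrite lee_fin powR_ge0.
rewrite integral_cst// [X in (_ + _ * X)%E]torusT mule1.
apply: (@le_trans _ _ (A%:E * (e `^ r)%:E + B%:E)%E).
  by apply: leeD => //; apply: lee_wpmul2l.
rewrite -EFinM -EFinD lee_fin /A /B divfK ?gt_eqF ?powR_gt0//.
by rewrite le_eqVlt; apply/orP; left; apply/eqP; ring.
Qed.

End LpNorms.

Section Bessel.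
Context {R : realType} {d : nat}.
Local Notation Tor := (d.-tuple (measurableTypeR R)).
Local Notation mu := (@torus R d).
Implicit Types (k : d.-tuple int) (f g : Tor -> R[i]) (p : \bar R).

Lemma mulc_conj (z : R[i]) : z * conjc z = Complex (normc z ^+ 2) 0.
Proof.
apply: complexP; rewrite ?cReM ?cImM normc_sqrt sqr_sqrtr ?addr_ge0 ?sqr_ge0//=;
  case: z => a b /=; ring.
Qed.

Lemma cintegrable_add f g : cintegrable mu f -> cintegrable mu g ->
  cintegrable mu (fun x => f x + g x).
Proof.
move=> [fr fi] [gr gi]; split.
  rewrite (_ : _ \o _ = (EFin \o (@complex.Re R \o f)) \+ (EFin \o (@complex.Re R \o g)))%E.
    exact: integrableD.
  by apply/funext => x /=; rewrite cReD.
rewrite (_ : _ \o _ = (EFin \o (@complex.Im R \o f)) \+ (EFin \o (@complex.Im R \o g)))%E.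
  exact: integrableD.
by apply/funext => x /=; rewrite cImD.
Qed.

Lemma cintegrable_scale (a : R[i]) f : cintegrable mu f -> cintegrable mu (fun x => a * f x).
Proof.
move=> [fr fi].
have Z (b : R) (h : Tor -> R) : mu.-integrable setT (EFin \o h) ->
    mu.-integrable setT (EFin \o (fun x => b * h x)).
  move=> ih; rewrite (_ : _ \o _ = (fun x => b%:E * (EFin \o h) x)%E)//.
  exact: integrableZl.
split.
  rewrite (_ : _ \o _ = (EFin \o (fun x => complex.Re a * complex.Re (f x))%R) \-
     (EFin \o (fun x => complex.Im a * complex.Im (f x))%R))%E.
    by apply: integrableB => //; exact: Z.
  by apply/funext => x /=; rewrite cReM.
rewrite (_ : _ \o _ = (EFin \o (fun x => complex.Re a * complex.Im (f x))%R) \+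
   (EFin \o (fun x => complex.Im a * complex.Re (f x))%R))%E.
  by apply: integrableD => //; exact: Z.
by apply/funext => x /=; rewrite cImM.
Qed.

Lemma pairing_trigpoly f S c : cmeasurable f -> cintegrable mu f ->
  cintegrable mu (fun x => f x * conjc (trigpoly S c x)) /\
  cintegral mu (fun x => f x * conjc (trigpoly S c x)) =
  \sum_(k <- S) conjc (c k) * fourier f k.
Proof.
move=> mf jf; elim: S => [|k S [IHi IHe]].
  have -> : (fun x => f x * conjc (trigpoly [::] c x)) = (fun x => 0 * f x).
    by apply/funext => x; rewrite /trigpoly big_nil rmorph0 mulr0 mul0r.
  split; first exact: cintegrable_scale.
  by rewrite big_nil -[RHS](mul0r (cintegral mu f)) -cintegralZ.
have E : (fun x => f x * conjc (trigpoly (k :: S) c x)) =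
    (fun x => conjc (c k) * (f x * expi (- phase k x)) + f x * conjc (trigpoly S c x)).
  apply/funext => x; rewrite /trigpoly big_cons rmorphD rmorphM mulrDr; congr (_ + _).
  rewrite mulrCA; congr (_ * (_ * _)).
  by apply: complexP; rewrite /= ?cosN ?sinN.
have ik := cintegrable_mul_char k mf jf.
split; first by rewrite E; apply: cintegrable_add => //; exact: cintegrable_scale.
rewrite E big_cons -IHe -[fourier f k]/(cintegral mu _) -cintegralZ// -cintegralD//.
exact: cintegrable_scale.
Qed.

(** Integrate [2 Re (f conj g) <= |f|^2 + |g|^2], where [g] is the partial sum of the
    Fourier series of [f] over [S]. *)
Lemma bessel f S (e : R) : uniq S -> cmeasurable f -> cintegrable mu f ->
  (\int[mu]_x (normc (f x) ^+ 2)%:E <= (e ^+ 2)%:E)%E ->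
  \sum_(k <- S) normc (fourier f k) ^+ 2 <= e ^+ 2.
Proof.
move=> uS mf jf fe; pose c := fourier f; pose g := trigpoly S c.
set B := \sum_(k <- S) _.
have bg := cbounded_trigpoly S c; have mg : cmeasurable g := bg.1.
have ig := cbounded_integrable bg.
have [ifg efg] := pairing_trigpoly S c mf jf.
have [igg egg] := pairing_trigpoly S c mg ig.
have sumRe (z : d.-tuple int -> R[i]) : (forall k, k \in S -> z k = Complex (normc (c k) ^+ 2) 0) ->
    complex.Re (\sum_(k <- S) z k) = B.
  move=> zc; rewrite /B -/c; elim: (S) zc => [|k S' IH] zc; first by rewrite !big_nil.
  rewrite !big_cons cReD zc ?mem_head// IH// => j jS; apply: zc.
  by rewrite inE jS orbT.
have B1 : \int[mu]_x complex.Re (f x * conjc (g x)) = B.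
  rewrite -[LHS]/(complex.Re (cintegral mu (fun x => f x * conjc (g x)))) efg.
  by apply: sumRe => k _; rewrite mulrC mulc_conj.
have B2 : \int[mu]_x complex.Re (g x * conjc (g x)) = B.
  rewrite -[LHS]/(complex.Re (cintegral mu (fun x => g x * conjc (g x)))) egg.
  by apply: sumRe => k kS; rewrite fourier_trigpoly// kS mulrC mulc_conj.
have m2 : measurable_fun setT (fun x => normc (f x) ^+ 2) := measurable_normc2 mf.
have i2 : mu.-integrable setT (EFin \o (fun x => normc (f x) ^+ 2)).
  apply/integrableP; split; first exact/measurable_EFinP.
  rewrite (eq_integral (fun x => (normc (f x) ^+ 2)%:E)).
    by apply: le_lt_trans fe _; rewrite ltry.
  by move=> x _; rewrite /= ger0_norm ?sqr_ge0.
have fe' : \int[mu]_x (normc (f x) ^+ 2) <= e ^+ 2.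
  have fin := integrable_fin_num measurableT i2.
  by rewrite /Rintegral -lee_fin fineK.
have le : \int[mu]_x (2 * complex.Re (f x * conjc (g x))) <=
    \int[mu]_x (normc (f x) ^+ 2 + complex.Re (g x * conjc (g x))).
  apply: le_Rintegral => //.
  - have := @integrableZl _ _ _ mu setT measurableT 2 _ ifg.1; exact.
  - have := @integrableD _ _ _ mu setT measurableT _ _ i2 igg.1; exact.
  move=> x _; rewrite mulc_conj /= !normc_sqrt !sqr_sqrtr ?addr_ge0 ?sqr_ge0//.
  rewrite cReM; case: (f x) => a b; case: (g x) => a' b' /=.
  rewrite -subr_ge0.
  have -> : a ^+ 2 + b ^+ 2 + (a' ^+ 2 + b' ^+ 2) - 2 * (a * a' - b * - b') =
    (a - a') ^+ 2 + (b - b') ^+ 2 by ring.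
  by rewrite addr_ge0 ?sqr_ge0.
move: le; rewrite RintegralZl//; last exact: ifg.1.
rewrite RintegralD//; last exact: igg.1.
by rewrite B1 B2; lra.
Qed.

End Bessel.

(** * Fourier coefficients and characters in L_p *)

Section LpTools.
Local Open Scope quotient_scope.
Context {R : realType} {d : nat} (p : \bar R) (p1 : (1 <= p)%E).
Local Notation Tor := (d.-tuple (measurableTypeR R)).
Local Notation mu := (@torus R d).
Local Notation Y := (Lp mu p1).
Implicit Types (x y : Y) (k : d.-tuple int).

Lemma Lp_ext x y : Lp_fun x = Lp_fun y %[ae mu] -> x = y.
Proof. by move=> xy; rewrite -[x]reprK -[y]reprK; apply/Lp_eqP. Qed.

Lemma Lp_fun_cmeasurable x : cmeasurable (Lp_fun x).
Proof. exact: cmeasurable_cLfun. Qed.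

Lemma Lp_fun_cLfun x : Lp_fun x \in cLfun mu p1.
Proof. exact: cLfunP. Qed.

Lemma Lp_fun_cintegrable x : cintegrable mu (Lp_fun x).
Proof. exact: cLfun_cintegrable (Lp_fun_cLfun x). Qed.

Lemma ae_eq_fourierf (f g : Tor -> R[i]) k : cmeasurable f -> cmeasurable g ->
  f = g %[ae mu] -> fourier f k = fourier g k.
Proof.
move=> mf mg fg; have F := ae_filter_ringOfSetsType mu.
apply: ae_eq_cintegral.
- exact: cmeasurableM mf (cmeasurable_char k).
- exact: cmeasurableM mg (cmeasurable_char k).
- by move: fg; apply: filterS => x /= h xT; rewrite h.
Qed.

Lemma fourier_LpD x y k :
  fourier (Lp_fun (x + y)) k = fourier (Lp_fun x) k + fourier (Lp_fun y) k.
Proof.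
rewrite (ae_eq_fourierf _ _ _ (Lp_funD x y)).
- exact: fourierDf (Lp_fun_cmeasurable x) (Lp_fun_cintegrable x)
    (Lp_fun_cmeasurable y) (Lp_fun_cintegrable y).
- exact: Lp_fun_cmeasurable.
- exact: cmeasurable_cLfun.
Qed.

Lemma fourier_LpZ (c : R[i]) x k :
  fourier (Lp_fun (c *: x)) k = c * fourier (Lp_fun x) k.
Proof.
rewrite (ae_eq_fourierf _ _ _ (Lp_funZ c x)).
- exact: fourierZf (Lp_fun_cmeasurable x) (Lp_fun_cintegrable x).
- exact: Lp_fun_cmeasurable.
- exact: cmeasurable_cLfun.
Qed.

Lemma fourier_Lp0 k : fourier (Lp_fun (0 : Y)) k = 0.
Proof. by rewrite -(scale0r (0 : Y)) fourier_LpZ mul0r. Qed.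

Lemma fourier_LpB x y k :
  fourier (Lp_fun (x - y)) k = fourier (Lp_fun x) k - fourier (Lp_fun y) k.
Proof. by rewrite fourier_LpD -scaleN1r fourier_LpZ mulN1r. Qed.

Lemma fourier_Lp_sum (I : Type) (r : seq I) (F : I -> Y) k :
  fourier (Lp_fun (\sum_(i <- r) F i)) k = \sum_(i <- r) fourier (Lp_fun (F i)) k.
Proof.
elim: r => [|i r IH]; first by rewrite !big_nil fourier_Lp0.
by rewrite !big_cons fourier_LpD IH.
Qed.

Lemma Lp_fun_sumZ (S : seq (d.-tuple int)) (c : d.-tuple int -> R[i]) (F : d.-tuple int -> Y)
    (G : d.-tuple int -> Tor -> R[i]) :
  (forall k, Lp_fun (F k) = G k %[ae mu]) ->
  Lp_fun (\sum_(k <- S) c k *: F k) = (fun z => \sum_(k <- S) c k * G k z) %[ae mu].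
Proof.
move=> FG; have Fl := ae_filter_ringOfSetsType mu.
elim: S => [|k S IH].
  rewrite big_nil -(scale0r (0 : Y)).
  move: (Lp_funZ 0 (0 : Y)); apply: filterS => x /= h xT.
  rewrite h// big_nil [LHS](_ : _ = 0 * Lp_fun (0 : Y) x)//.
  by rewrite mul0r.
rewrite big_cons; set T := \sum_(j <- S) _ in IH *.
have h1 := Lp_funD (c k *: F k) T; have h2 := Lp_funZ (c k) (F k); have h3 := FG k.
have h12 := @filterI _ _ Fl _ _ h1 h2; have h34 := @filterI _ _ Fl _ _ h3 IH.
have h4 := @filterI _ _ Fl _ _ h12 h34.
move: h4; apply: filterS => x [[/= k1 k2] [k3 k4]] xT.
rewrite k1// [LHS](_ : _ = Lp_fun (c k *: F k) x + Lp_fun T x)//.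
rewrite k2// k4// big_cons; congr (_ + _).
by rewrite [LHS](_ : _ = c k * Lp_fun (F k) x)// k3.
Qed.

Lemma cLnorm_fin_num x : cLnorm mu p (Lp_fun x) \is a fin_num.
Proof.
have := Lp_fun_cLfun x; rewrite inE => -[_ h]; rewrite ge0_fin_numE//.
exact: Lnorm_ge0.
Qed.

Lemma Lp_normE x : (Lp_norm x)%:E = cLnorm mu p (Lp_fun x).
Proof. by rewrite /Lp_norm fineK// cLnorm_fin_num. Qed.

Lemma Lp_norm_ge0 x : 0 <= Lp_norm x.
Proof. by rewrite -lee_fin Lp_normE Lnorm_ge0. Qed.

Lemma cbounded_cLfun (f : Tor -> R[i]) M : 0 <= M -> cbounded f M -> f \in cLfun mu p1.
Proof.
move=> M0 [mf fM]; rewrite inE; split=> //.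
by apply: le_lt_trans (cLnorm_le_ae p1 mf M0 _) (ltry _); apply: aeW.
Qed.

Lemma cbounded_char k : cbounded (fun x : Tor => expi (phase k x)) 1.
Proof. by split; [exact: cmeasurable_expi | move=> x; rewrite normc_expi]. Qed.

Definition chi k : Y := \pi_Y (CLfun (cbounded_cLfun ler01 (cbounded_char k))).

Lemma Lp_fun_chi k : Lp_fun (chi k) = (fun z => expi (phase k z)) %[ae mu].
Proof. exact: Lp_piK. Qed.

Lemma fourier_chi k j : fourier (Lp_fun (chi k)) j = (k == j)%:R.
Proof.
rewrite (ae_eq_fourierf _ _ _ (Lp_fun_chi k)).
- exact: fourier_expi.
- exact: Lp_fun_cmeasurable.
- exact: cmeasurable_expi.
Qed.

End LpTools.

(** * The embedding of the weighted Wiener algebra *)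

Section Embedding.
Local Open Scope quotient_scope.
Context {R : realType} {d : nat} (w : d.-tuple int -> {posnum R}).
Hypothesis w1 : forall k, 1 <= (w k)%:num.
Context (p : \bar R) (p1 : (1 <= p)%E).
Local Notation Tor := (d.-tuple (measurableTypeR R)).
Local Notation mu := (@torus R d).
Local Notation W := (wiener w).
Local Notation Y := (Lp mu p1).
Implicit Types (f g : W) (k : d.-tuple int).

Lemma wiener_valD f g : wiener_val (f + g) = wiener_val f + wiener_val g.
Proof. by []. Qed.

Lemma wiener_valZ (c : R[i]) f : wiener_val (c *: f) = c *: wiener_val f.
Proof. by []. Qed.

Lemma wiener_sum_fin f : wiener_sum w f \is a fin_num.
Proof.
have := wienerP f; rewrite inE => h; rewrite ge0_fin_numE//.
by apply: esum_ge0 => k _; rewrite lee_fin mulr_ge0// normc_ge0.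
Qed.

Lemma sum_fourier_le_wiener_norm f L : uniq L ->
  \sum_(k <- L) (w k)%:num * normc (fourier (Lp_fun f) k) <= wiener_norm f.
Proof.
move=> uL; rewrite -lee_fin /wiener_norm fineK ?wiener_sum_fin//.
apply: esum_ge; exists [set` L]; first by split => //; exact: finite_seq.
by rewrite -fsbig_seq// sumEFin.
Qed.

Lemma wiener_norm_ge0 f : 0 <= wiener_norm f.
Proof. by have := @sum_fourier_le_wiener_norm f [::] isT; rewrite big_nil. Qed.

Lemma ae_le_wiener_norm f : {ae mu, forall x, normc (Lp_fun f x) <= wiener_norm f}.
Proof.
apply: ae_le_sum_fourier; [exact: Lp_fun_cmeasurable|exact: Lp_fun_cintegrable|].
move=> L uL; apply: le_trans (sum_fourier_le_wiener_norm f uL).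
by apply: ler_sum => k _; rewrite ler_peMl ?normc_ge0.
Qed.

Lemma wiener_cLfun f : (Lp_fun f : Tor -> R[i]) \in cLfun mu p1.
Proof.
rewrite inE; split; first exact: Lp_fun_cmeasurable.
apply: le_lt_trans (cLnorm_le_ae p1 (Lp_fun_cmeasurable _) (wiener_norm_ge0 f) _) (ltry _).
exact: ae_le_wiener_norm.
Qed.

Definition embed f : Y := \pi_Y (CLfun (wiener_cLfun f)).

Lemma Lp_fun_embed f : Lp_fun (embed f) = Lp_fun f %[ae mu].
Proof. exact: Lp_piK. Qed.

Lemma fourier_embed f k : fourier (Lp_fun (embed f)) k = fourier (Lp_fun f) k.
Proof. by apply: ae_eq_fourierf (Lp_fun_embed f); exact: Lp_fun_cmeasurable. Qed.

Lemma embed_linear : linear embed.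
Proof.
move=> a f g; apply: Lp_ext; have F := ae_filter_ringOfSetsType mu.
have h1 := Lp_fun_embed (a *: f + g).
have h2 := Lp_funD (a *: wiener_val f) (wiener_val g).
have h3 := Lp_funZ a (wiener_val f).
have h4 := Lp_funD (a *: embed f) (embed g).
have h5 := Lp_funZ a (embed f).
have h6 := Lp_fun_embed f; have h7 := Lp_fun_embed g.
have h12 := @filterI _ _ F _ _ h1 h2; have h34 := @filterI _ _ F _ _ h3 h4.
have h56 := @filterI _ _ F _ _ h5 h6.
have := @filterI _ _ F _ _ (@filterI _ _ F _ _ h12 h34) (@filterI _ _ F _ _ h56 h7).
apply: filterS => x [[[k1 k2] [k3 k4]] [[k5 k6] k7]] xT.
rewrite k1// [LHS](k2 xT) k4//.
rewrite [LHS](_ : _ = Lp_fun (a *: wiener_val f) x + Lp_fun g x)//.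
rewrite [RHS](_ : _ = Lp_fun (a *: embed f) x + Lp_fun (embed g) x)//.
rewrite k3// k5// k7//; congr (_ + _).
rewrite [LHS](_ : _ = a * Lp_fun f x)//.
by rewrite [RHS](_ : _ = a * Lp_fun (embed f) x)// k6.
Qed.

Definition embed_lin : {linear W -> Y} :=
  HB.pack embed (GRing.isLinear.Build _ _ _ _ embed embed_linear).

Lemma embed_is_embedding : is_embedding embed_lin.
Proof.
split; first exact: Lp_fun_embed.
exists 1 => f; rewrite mul1r -lee_fin Lp_normE; apply: cLnorm_le_ae => //.
- exact: Lp_fun_cmeasurable.
- exact: wiener_norm_ge0.
have F := ae_filter_ringOfSetsType mu.
move: (ae_le_wiener_norm f) (Lp_fun_embed f); apply: filterS2 => x fx ->//.
Qed.

Definition partial_sum L f : Y := \sum_(k <- L) fourier (Lp_fun f) k *: chi p1 k.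

Lemma partial_sum_linear L : linear (partial_sum L).
Proof.
move=> a f g; rewrite /partial_sum scaler_sumr -big_split/=; apply: eq_bigr => k _.
by rewrite fourierD fourierZ scalerDl scalerA.
Qed.

Definition partial_sum_lin L : {linear W -> Y} :=
  HB.pack (partial_sum L) (GRing.isLinear.Build _ _ _ _ (partial_sum L) (partial_sum_linear L)).

(** The remainder has the Fourier coefficients of [f] outside [L], where the weight is
    at least [t], and is bounded by the sum of their moduli. *)
Lemma partial_sum_err L (t : R) f : uniq L -> 0 < t -> (forall k, k \notin L -> t <= (w k)%:num) ->
  Lp_norm (embed f - partial_sum L f) <= wiener_norm f / t.
Proof.
move=> uL t0 wt; rewrite -lee_fin Lp_normE.
pose c := fourier (Lp_fun f).
have nt0 : 0 <= wiener_norm f / t by rewrite divr_ge0 ?wiener_norm_ge0 ?(ltW t0).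
apply: cLnorm_le_ae => //; first exact: Lp_fun_cmeasurable.
apply: ae_le_sum_fourier; [exact: Lp_fun_cmeasurable|exact: Lp_fun_cintegrable|].
move=> S uS.
have cE k : fourier (Lp_fun (embed f - partial_sum L f)) k = if k \in L then 0 else c k.
  rewrite fourier_LpB fourier_embed fourier_Lp_sum.
  under eq_bigr do rewrite fourier_LpZ fourier_chi.
  have [kL|kL] := boolP (k \in L).
    rewrite (bigD1_seq k)//= eqxx mulr1 big1 ?addr0 ?subrr// => j /negbTE ->.
    by rewrite mulr0.
  rewrite big1_seq ?subr0// => j /andP[_ jL].
  by rewrite (_ : j == k = false) ?mulr0//; apply: contraNF kL => /eqP <-.
rewrite ler_pdivlMr// mulr_suml; apply: le_trans (sum_fourier_le_wiener_norm f uS).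
apply: ler_sum => k _; rewrite cE; case: ifPn => kL.
  by rewrite normc0 mul0r mulr_ge0// normc_ge0.
by rewrite mulrC ler_wpM2r ?normc_ge0// wt.
Qed.

Lemma wchi_sum k : wiener_sum w (chi (lexx 1%E) k) = (w k)%:num%:E.
Proof.
rewrite /wiener_sum (eq_esum (b := fun j => if j \in [set k] then (w k)%:num%:E else 0%E)).
  by rewrite -esum_mkcond esum_set1// lee_fin.
move=> j _; rewrite fourier_chi; have [->|jk] := eqVneq j k.
  by rewrite mem_set// normc1 mulr1.
by rewrite normc0 mulr0 memNset//; exact/eqP.
Qed.

Lemma wchi_pred k : chi (lexx 1%E) k \in wiener_pred w.
Proof. by rewrite inE /= wchi_sum ltry. Qed.

Definition wchi k : W := Wiener (wchi_pred k).

Lemma fourier_wchi k j : fourier (Lp_fun (wchi k)) j = (k == j)%:R.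
Proof. exact: fourier_chi. Qed.

Lemma wiener_norm_wchi (a : R[i]) k : wiener_norm (a *: wchi k) = normc a * (w k)%:num.
Proof.
have a0 := normc_ge0 a.
rewrite /wiener_norm /wiener_sum (eq_esum (b := fun j =>
    if j \in [set k] then (normc a * (w k)%:num)%:E else 0%E)).
  by rewrite -esum_mkcond esum_set1// lee_fin mulr_ge0.
move=> j _; rewrite fourierZ fourier_wchi normcM; have [->|jk] := eqVneq j k.
  by rewrite mem_set// normc1 mulr1 mulrC.
by rewrite normc0 !mulr0 memNset//; exact/eqP.
Qed.

End Embedding.

(** * Bounds for approximation and Kolmogorov numbers *)

Section SNumberBounds.
Context {R : realType} {d : nat} (w : d.+1.-tuple int -> {posnum R}).
Hypothesis w1 : forall k, 1 <= (w k)%:num.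
Context (p : \bar R) (p1 : (1 <= p)%E).
Local Notation mu := (@torus R d.+1).
Local Notation W := (wiener w).
Local Notation Y := (Lp mu p1).
Local Notation id_ := (embed_lin w1 p1).
Local Notation approx := (approx_number wiener_norm (@Lp_norm _ _ _ mu p p1) id_).
Local Notation kolmogorov := (kolmogorov_number wiener_norm (@Lp_norm _ _ _ mu p p1) id_).
Implicit Types (f g : W) (L S : seq (d.+1.-tuple int)) (n : nat).

Lemma exists_fresh S : exists k : d.+1.-tuple int, k \notin S.
Proof.
pose F (i : nat) : d.+1.-tuple int := [tuple of nseq d.+1 (Posz i)].
have Finj : injective F by move=> i j /(congr1 (fun t => tnth t ord0)); rewrite !tnth_nseq => -[].
apply: contrapT => /forallNP nk.
have sub : {subset map F (iota 0 (size S).+1) <= S}.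
  by move=> k _; move/negP: (nk k); rewrite negbK.
have := uniq_leq_size _ sub; rewrite map_inj_uniq// iota_uniq size_map size_iota ltnn.
by move/(_ isT).
Qed.

(** Kolmogorov numbers involve subspaces of dimension exactly [n - 1], so a cross with
    fewer points has to be filled up. *)
Lemma uniq_extend S m : uniq S -> (size S <= m)%N ->
  exists L, [/\ uniq L, size L = m & {subset S <= L}].
Proof.
move=> uS; elim: m => [|m IH].
  by rewrite leqn0 => /eqP S0; exists S; split.
rewrite leq_eqVlt => /predU1P[Sm|/IH[L [uL Lm SL]]]; first by exists S; split.
have [k kL] := exists_fresh L; exists (k :: L); split=> /=; first by rewrite kL.
  by rewrite Lm.
by move=> j /SL jL; rewrite inE jL orbT.
Qed.

Lemma tnth_in_tuple_eq L (i j : 'I_(size L)) : uniq L ->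
  (tnth (in_tuple L) i == tnth (in_tuple L) j) = (i == j).
Proof. by move=> uL; rewrite !(tnth_nth [tuple of nseq d.+1 0]) nth_uniq. Qed.

Lemma has_dim_partial_sum L : uniq L -> has_dim (size L) (range (partial_sum (w := w) p1 L)).
Proof.
move=> uL; exists (fun i => chi p1 (tnth (in_tuple L) i)); split=> [c c0 i|].
  have := congr1 (fun y : Y => fourier (Lp_fun y) (tnth (in_tuple L) i)) c0.
  rewrite fourier_Lp_sum fourier_Lp0; under eq_bigr do rewrite fourier_LpZ fourier_chi.
  rewrite (bigD1 i)//= eqxx mulr1 big1 ?addr0// => j ji.
  by rewrite tnth_in_tuple_eq// (negbTE ji) mulr0.
apply/seteqP; split=> [_ [f _ <-]|_ [c _ <-]] /=.
  exists (fun i => fourier (Lp_fun f) (tnth (in_tuple L) i)) => //.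
  by rewrite /partial_sum [RHS]big_tnth.
exists (\sum_(i < size L) c i *: wchi w (tnth (in_tuple L) i)) => //.
rewrite /partial_sum [LHS]big_tnth; apply: eq_bigr => i _; congr (_ *: _).
have vs (I : Type) (r : seq I) (F : I -> W) : wiener_val (\sum_(i <- r) F i) = \sum_(i <- r) wiener_val (F i).
  by elim: r => [|j r IH]; rewrite ?big_nil// !big_cons wiener_valD IH.
rewrite vs fourier_Lp_sum (bigD1 i)//= big1 ?addr0 => [|j ji].
  by rewrite fourierZ (fourier_wchi w) eqxx mulr1.
by rewrite fourierZ (fourier_wchi w) tnth_in_tuple_eq// (negbTE ji) mulr0.
Qed.

Lemma partial_sum_bounded L : uniq L -> bounded_op wiener_norm Lp_norm (partial_sum (w := w) p1 L).
Proof.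
move=> uL; exists 1 => f; rewrite mul1r -lee_fin Lp_normE.
have F := ae_filter_ringOfSetsType mu.
apply: cLnorm_le_ae => //; [exact: Lp_fun_cmeasurable|exact: wiener_norm_ge0|].
have := Lp_fun_sumZ L (fourier (Lp_fun f)) (Lp_fun_chi p1).
apply: filterS => z -> //.
have [_ /(_ z) h] := cbounded_trigpoly L (fourier (Lp_fun f)).
apply: le_trans h _; apply: le_trans (sum_fourier_le_wiener_norm f uL).
by apply: ler_sum => k _; rewrite ler_peMl ?normc_ge0.
Qed.

Section Upper.
Variables (L : seq (d.+1.-tuple int)) (t : R).
Hypotheses (uL : uniq L) (t0 : 0 < t) (wt : forall k, k \notin L -> t <= (w k)%:num).

Lemma unit_ball_err f : unit_ball wiener_norm f ->
  Lp_norm (id_ f - partial_sum p1 L f) <= t^-1.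
Proof.
rewrite /unit_ball /= => f1; apply: le_trans (partial_sum_err w1 p1 f uL t0 wt) _.
by rewrite ler_pdivrMr// mulVf ?gt_eqF.
Qed.

Lemma approx_upper n : size L = n.-1 -> (0 < n)%N -> (approx n <= (t^-1)%:E)%E.
Proof.
move=> Ln n0.
have h : (op_norm wiener_norm (@Lp_norm _ _ _ mu p p1)
    (fun f => id_ f - partial_sum_lin w p1 L f)%R <= (t^-1)%:E)%E.
  by apply: ge_ereal_sup => _ [f f1 <-]; rewrite lee_fin; exact: unit_ball_err.
apply: le_trans h; apply: ereal_inf_lbound; exists (partial_sum_lin w p1 L) => //; split.
  exact: partial_sum_bounded.
by exists n.-1; [rewrite prednK|rewrite -Ln; exact: has_dim_partial_sum].
Qed.

Lemma kolmogorov_upper n : size L = n.-1 -> (kolmogorov n <= (t^-1)%:E)%E.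
Proof.
move=> Ln; pose V := range (partial_sum (w := w) p1 L).
have h : (ereal_sup [set ereal_inf [set (Lp_norm (id_ f - y)%R)%:E | y in V] |
    f in unit_ball wiener_norm] <= (t^-1)%:E)%E.
  apply: ge_ereal_sup => _ [f f1 <-].
  have h : ((Lp_norm (id_ f - partial_sum p1 L f)%R)%:E <= (t^-1)%:E)%E.
    by rewrite lee_fin; exact: unit_ball_err.
  apply: le_trans h.
  by apply: ereal_inf_lbound; exists (partial_sum p1 L f) => //; exists f.
apply: le_trans h; apply: ereal_inf_lbound; exists V => //.
by rewrite /V -Ln; exact: has_dim_partial_sum.
Qed.
End Upper.

(** The characters with frequencies in [S], normalized in the weighted algebra, are
    approximated within [e] in L_p, hence in L_2. By Bessel's inequality the error matrix
    [1 - Y] of their coefficients, with row [k] multiplied by [w k], has squared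
    Frobenius norm at most [e^2 sum_(k in S) (w k)^2], and [Y] has rank at most [m]. *)
Lemma lower_of_subspace (p2 : (2%:E < p)%E) (V : set Y) m S (e : R) :
  has_dim m V -> uniq S -> 0 < e ->
  (forall f, unit_ball wiener_norm f -> exists2 y, V y & Lp_norm (id_ f - y) <= e) ->
  (size S)%:R - m%:R <= e ^+ 2 * \sum_(k <- S) (w k)%:num ^+ 2.
Proof.
move=> [b [_ ->]] uS e0 H.
pose N := size S; pose k (i : 'I_N) := tnth (in_tuple S) i.
pose fi (i : 'I_N) : W := (Complex ((w (k i))%:num^-1) 0) *: wchi w (k i).
have nre (x : R) : 0 <= x -> normc (Complex x 0) = x.
  by move=> x0; rewrite /= expr0n/= addr0 sqrtr_sqr ger0_norm.
have fi1 i : unit_ball wiener_norm (fi i).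
  by rewrite /unit_ball /= wiener_norm_wchi nre ?invr_ge0// mulVf.
have /choice[y yP] : forall i, exists c : 'I_m -> R[i],
    Lp_norm (id_ (fi i) - \sum_(j < m) c j *: b j) <= e.
  by move=> i; have [_ [c _ <-] h] := H _ (fi1 i); exists c.
(* A B has rank at most m; its row i lists, multiplied by w (k i), the coefficients of
   the approximant of the i-th normalized character *)
pose A := \matrix_(i < N, j < m) (Complex (w (k i))%:num 0 * y i j).
pose B := \matrix_(j < m, l < N) fourier (Lp_fun (b j)) (k l).
have rk : (\rank (A *m B) <= m)%N.
  by apply: leq_trans (mxrankM_maxl _ _) (rank_leq_col _).
have entry i l : (1%:M - A *m B) i l =
    Complex (w (k i))%:num 0 * fourier (Lp_fun (id_ (fi i) - \sum_(j < m) y i j *: b j)) (k l).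
  rewrite fourier_LpB fourier_embed /fi [wiener_val _]wiener_valZ fourierZ (fourier_wchi w).
  rewrite fourier_Lp_sum mulrBr mulr_sumr !mxE; congr (_ - _).
    rewrite tnth_in_tuple_eq// mulrA.
    have -> : Complex (w (k i))%:num 0 * Complex (w (k i))%:num^-1 0 = 1 :> R[i].
      by apply: complexP => /=; rewrite ?mulr0 ?mul0r ?subr0 ?addr0// mulfV.
    by rewrite mul1r.
  by apply: eq_bigr => j _; rewrite !mxE fourier_LpZ mulrA.
have := frobenius_rank_ge (A *m B).
pose F i l := normc (fourier (Lp_fun (id_ (fi i) - \sum_(j < m) y i j *: b j)) (k l)) ^+ 2.
have realc_sum (I : Type) (r : seq I) (G : I -> R) :
    \sum_(i <- r) Complex (G i) 0 = Complex (\sum_(i <- r) G i) 0.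
  elim: r => [|i r IH]; first by rewrite !big_nil.
  by rewrite !big_cons IH; apply: complexP; rewrite ?cReD ?cImD/= ?addr0.
have realc_nat n : n%:R = Complex n%:R 0 :> R[i].
  elim: n => // n IH; rewrite -natr1 IH -[in RHS]natr1.
  by apply: complexP; rewrite ?cReD ?cImD/= ?addr0.
have -> : \sum_i \sum_j `|(1%:M - A *m B) i j| ^+ 2 =
    Complex (\sum_i \sum_l (w (k i))%:num ^+ 2 * F i l) 0.
  rewrite -realc_sum; apply: eq_bigr => i _; rewrite -realc_sum; apply: eq_bigr => l _.
  rewrite entry /F -exprMn -[X in (X * _) ^+ 2](nre (w (k i))%:num)// -normcM.
  move: (_ * _) => z; rewrite -[`|z|]/(Complex (normc z) 0).
  by apply: complexP; rewrite !expr2 ?cReM ?cImM /=; ring.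
rewrite realc_nat lecE /= eqxx/= => h.
have rN : (\rank (A *m B) <= N)%N by apply: rank_leq_row.
apply: le_trans (_ : _ <= (N - \rank (A *m B))%:R) _.
  by rewrite natrB// lerB// ler_nat.
apply: le_trans h _.
rewrite mulr_sumr [leRHS]big_tnth; apply: ler_sum => i _.
rewrite -mulr_sumr mulrC ler_wpM2r ?sqr_ge0//.
have -> : \sum_l F i l = \sum_(x <- S) normc (fourier (Lp_fun (id_ (fi i) -
    \sum_(j < m) y i j *: b j)) x) ^+ 2 by rewrite [RHS]big_tnth.
apply: bessel => //; [exact: Lp_fun_cmeasurable|exact: Lp_fun_cintegrable|].
apply: (integral_normc2_le p2) => //; first exact: Lp_fun_cmeasurable.
by rewrite -Lp_normE lee_fin; exact: yP.
Qed.

Section Lower.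
Hypothesis p2 : (2%:E < p)%E.

Lemma approx_lower n S (e : R) : uniq S -> 0 < e -> (approx n < e%:E)%E ->
  (size S)%:R - n%:R <= e ^+ 2 * \sum_(k <- S) (w k)%:num ^+ 2.
Proof.
move=> uS e0 /ereal_inf_lt[_ [A [_ [m mn hm] <-]] Ae].
have := lower_of_subspace p2 hm uS e0; move=> h.
apply: le_trans (h _) => [|f f1]; first by rewrite lerB// ler_nat ltnW.
exists (A f); first by exists f.
rewrite -lee_fin; apply: le_trans (ltW Ae).
by apply: ereal_sup_ubound; exists f.
Qed.

Lemma kolmogorov_lower n S (e : R) : uniq S -> 0 < e -> (kolmogorov n < e%:E)%E ->
  (size S)%:R - n%:R <= e ^+ 2 * \sum_(k <- S) (w k)%:num ^+ 2.
Proof.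
move=> uS e0 /ereal_inf_lt[_ [V hV <-] Ve].
have := lower_of_subspace p2 hV uS e0; move=> h.
apply: le_trans (h _) => [|f f1]; first by rewrite lerB// ler_nat leq_pred.
have : (ereal_inf [set (Lp_norm (id_ f - y)%R)%:E | y in V] < e%:E)%E.
  apply: le_lt_trans Ve; apply: ereal_sup_ubound; by exists f.
move=> /ereal_inf_lt[_ [y Vy <-]]; rewrite lte_fin => /ltW ye; by exists y.
Qed.

End Lower.

End SNumberBounds.

(** * The mixed weights *)

Section MixedWeight.
Context {R : realType}.
Implicit Types (s : R) (r : \bar R) (k : int).

(** The weight of one coordinate with the exponent [s] removed. For every [r] it lies
    between [|k|] and [(1 + o(1)) |k|], and this is all that the counting uses. *)
Definition coord_weight r k : R :=
  if r is r'%:E then (1 + `|k%:~R| `^ r') `^ r'^-1 else Num.max 1 `|k%:~R|.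

Let intr_abs k : `|(k%:~R : R)| = `|k|%:R.
Proof. by rewrite -intr_norm. Qed.

Lemma coord_weight_ge1 r k : (0 < r)%E -> 1 <= coord_weight r k.
Proof.
case: r => [r|_|//]; last by rewrite /coord_weight le_max lexx.
rewrite lte_fin => r0; rewrite /coord_weight -[leLHS](powRr0 (1 + `|k%:~R| `^ r)).
by rewrite ler_powR ?invr_ge0 ?(ltW r0)// lerDl powR_ge0.
Qed.

Lemma coord_weight_ge_abs r k : (0 < r)%E -> `|k|%:R <= coord_weight r k.
Proof.
rewrite -intr_abs; case: r => [r|_|//]; last by rewrite /coord_weight le_max lexx orbT.
rewrite lte_fin => r0; rewrite /coord_weight; set x := `|_|.
have x0 : 0 <= x := normr_ge0 _.
have {1}-> : x = (x `^ r) `^ r^-1 by rewrite -powRrM mulfV ?gt_eqF// powRr1.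
apply: ge0_ler_powR; rewrite ?nnegrE ?powR_ge0 ?addr_ge0 ?powR_ge0 ?invr_ge0 ?(ltW r0)//.
by rewrite lerDr.
Qed.

Lemma coord_weight_le r c : (0 < r)%E -> 1 < c ->
  exists2 K : nat, (0 < K)%N & forall k, (K <= `|k|)%N -> coord_weight r k <= c * `|k|%:R.
Proof.
move=> r0 c1; have c0 : 0 < c := lt_trans ltr01 c1.
case: r r0 => [r|_|//]; last first.
  exists 1%N => // k k1; rewrite /coord_weight intr_abs ge_max.
  have k1' : 1 <= `|k|%:R :> R by rewrite ler1n.
  by rewrite mulr_ege1 ?(ltW c1)//= ler_peMl// ltW.
rewrite lte_fin => r0.
have cr : 1 < c `^ r.
  have <- : 1 `^ r = 1 :> R by rewrite powR1.
  by rewrite gt0_ltr_powR// ?nnegrE// ltW.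
have cr0 : 0 < c `^ r - 1 by rewrite subr_gt0.
pose B := (c `^ r - 1)^-1 `^ r^-1.
have B0 : 0 <= B by exact: powR_ge0.
exists (Num.trunc B).+1 => // k Bk; rewrite /coord_weight intr_abs.
have kB : B <= `|k|%:R.
  by apply: ltW; apply: lt_le_trans (truncnS_gt B) _; rewrite ler_nat.
set x := `|k|%:R in kB *; have x0 : 0 <= x := le_trans B0 kB.
have h : 1 + x `^ r <= (c * x) `^ r.
  rewrite powRM ?(ltW c0)// -lerBrDr -[X in _ - X]mul1r -mulrBl.
  rewrite mulrC -ler_pdivrMr// mul1r.
  have <- : B `^ r = (c `^ r - 1)^-1.
    by rewrite /B -powRrM mulVf ?gt_eqF// powRr1// invr_ge0 ltW.
  by apply: ge0_ler_powR; rewrite ?nnegrE// ltW.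
have cx0 : 0 <= c * x by rewrite mulr_ge0 ?(ltW c0).
have <- : ((c * x) `^ r) `^ r^-1 = c * x by rewrite -powRrM mulfV ?gt_eqF// powRr1.
by apply: ge0_ler_powR; rewrite ?nnegrE ?powR_ge0 ?addr_ge0 ?powR_ge0 ?invr_ge0 ?(ltW r0).
Qed.

Lemma mix_weightE s r d (t : d.-tuple int) : (0 < r)%E ->
  mix_weight s r t = prod_weight (coord_weight r) t `^ s.
Proof.
have prodX (f : 'I_d -> R) : (forall i, 0 <= f i) ->
    \prod_(i < d) f i `^ s = (\prod_(i < d) f i) `^ s.
  move=> f0; elim: (index_enum _) => [|i l IH]; first by rewrite !big_nil powR1.
  by rewrite !big_cons IH powRM// prodr_ge0.
rewrite /mix_weight /prod_weight; case: r => [r|_|//]; last first.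
  by rewrite -prodX// => i; rewrite le_max ler01.
rewrite lte_fin => r0; rewrite -prodX => [|i]; last exact: powR_ge0.
by apply: eq_bigr => i _; rewrite -powRrM mulrC.
Qed.

End MixedWeight.

Section SNumbersGe0.
Context {R : realType} {X Y : lmodType R[i]} (normX : X -> R) (normY : Y -> R).
Hypotheses (normX0 : normX 0 <= 1) (normY_ge0 : forall y, 0 <= normY y).

Lemma approx_number_ge0 (T : X -> Y) n : (0 <= approx_number normX normY T n)%E.
Proof.
apply: le_ereal_inf_tmp => _ [A _ <-].
have h : (0 <= (normY (T 0 - A 0)%R)%:E)%E by rewrite lee_fin.
by apply: le_trans h _; apply: ereal_sup_ubound; exists 0.
Qed.

Lemma kolmogorov_number_ge0 (T : X -> Y) n : (0 <= kolmogorov_number normX normY T n)%E.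
Proof.
apply: le_ereal_inf_tmp => _ [V _ <-].
have h : (0 <= ereal_inf [set (normY (T 0 - y)%R)%:E | y in V])%E.
  by apply: le_ereal_inf_tmp => _ [y _ <-]; rewrite lee_fin.
by apply: le_trans h _; apply: ereal_sup_ubound; exists 0.
Qed.

End SNumbersGe0.

(** * The asymptotic bounds *)

Theorem theorem4p7 (R : realType) (d : nat) (hd : (0 < d)%N) (s : R) (hs : 0 < s)
    (r : \bar R) (hr : (0 < r)%E) (p : \bar R) (hp : (2%:E < p)%E) :
  exists2 id : {linear Amix d s r -> Lp (torus d) (gt2_ge1 hp)},
    is_embedding id &
    forall u : nat -> \bar R,
      u = approx_number wiener_norm Lp_norm id \/
      u = kolmogorov_number wiener_norm Lp_norm id ->
    forall eps : R, 0 < eps ->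
    exists2 n0 : nat, (0 < n0)%N & forall n : nat, (n0 <= n)%N ->
      (((2 * s / (2 * s + 1)) `^ s * (2 ^+ d / (d.-1)`!%:R) `^ s - eps)%:E
        <= u n / (n%:R `^ (- s) * ln n%:R `^ (s * d.-1%:R))%:E
        <= ((2 ^+ d / (d.-1)`!%:R) `^ s + eps)%:E)%E.
Proof.
case: d hd => // d _.
pose v := coord_weight r.
have v1 k : 1 <= v k by exact: coord_weight_ge1.
have vk k : `|k|%:R <= v k by exact: coord_weight_ge_abs.
have vc c : 1 < c -> exists2 K : nat, (0 < K)%N &
    forall k : int, (K <= `|k|)%N -> v k <= c * `|k|%:R by exact: coord_weight_le.
pose w := fun k : d.+1.-tuple int => PosNum (mix_weight_gt0 s r k).
have wE k : (w k)%:num = prod_weight v k `^ s by exact: mix_weightE.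
have w1 k : 1 <= (w k)%:num.
  rewrite wE -[leLHS](powRr0 (prod_weight v k)); apply: ler_powR; last exact: ltW.
  exact: prod_weight_ge1.
exists (embed_lin w1 (gt2_ge1 hp)); first exact: embed_is_embedding.
move=> u uE eps eps0.
have normX0 : wiener_norm (0 : wiener w) <= 1.
  rewrite -(scale0r (wchi w [tuple of nseq d.+1 0])) wiener_norm_wchi.
  by rewrite normc0 mul0r.
apply: (near_rate v1 vk vc hs _ _ _ eps0) => [n|n T T0 sT|n e S uS e0 ue].
- case: uE => ->; [apply: approx_number_ge0|apply: kolmogorov_number_ge0] => //;
    by move=> y; exact: Lp_norm_ge0.
- have n0 : (0 < n)%N by apply: leq_ltn_trans sT.
  have sT' : (size (cross v d.+1 T) <= n.-1)%N by rewrite -ltnS prednK.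
  have [L [uL Ln TL]] := uniq_extend (cross_uniq v d.+1 T) sT'.
  have Ts0 : 0 < T `^ s by rewrite powR_gt0.
  have wL k : k \notin L -> T `^ s <= (w k)%:num.
    move=> kL; rewrite wE; apply: ge0_ler_powR; rewrite ?nnegrE ?(ltW hs) ?(ltW T0)//.
      exact: ltW (prod_weight_gt0 v1 k).
    rewrite leNgt; apply: contra kL => /ltW kT; apply: TL; by rewrite mem_cross.
  by rewrite powRN; case: uE => ->; [exact: (approx_upper w1 _ uL Ts0 wL Ln n0)|exact: (kolmogorov_upper w1 _ uL Ts0 wL Ln)].
have -> : \sum_(t <- S) (prod_weight v t `^ s) ^+ 2 = \sum_(t <- S) (w t)%:num ^+ 2.
  by apply: eq_bigr => t _; rewrite wE.
by case: uE ue => -> ue; [exact: approx_lower ue|exact: kolmogorov_lower ue].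
Qed.
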